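(* Let $G\curvearrowright\mathbb{T}$ be a free Denjoy action of a countably infinite discrete abelian group $G$ on the circle with unique minimal set $Y$, let $A=C(\mathbb{T})\rtimes G$, and let $J=C_0(\mathbb{T}\setminus Y)\rtimes G$ be the unique maximal ideal of $A$. Let $Y_0=\bigcup_{i=1}^k I_{n_i}$ be the union of a choice of representative intervals, one for each $G$-orbit of connected components of $\mathbb{T}\setminus Y$ (where $k\in\mathbb{N}\cup\{\infty\}$ is the number of such orbits), with the subspace topology from $\mathbb{T}$. Then $\mathrm{Prim}(A)$ is homeomorphic to $Y_0\cup\{J\}$, where $Y_0$ carries its subspace topology and the point $J$ is contained in the closure of every non-empty subset; that is, the closed subsets of $Y_0\cup\{J\}$ are $\emptyset$ and the sets $F\cup\{J\}$ with $F$ closed in $Y_0$.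
   Context: $\mathbb{T}=\mathbb{R}/\mathbb{Z}$. A homeomorphism of $\mathbb{T}$ is orientation-preserving if it admits an increasing lift $F:\mathbb{R}\to\mathbb{R}$ with $F(x+1)=F(x)+1$. A Denjoy action is an action $G\curvearrowright\mathbb{T}$ by orientation-preserving homeomorphisms that is non-minimal and has all orbits infinite. A minimal set is a non-empty closed $G$-invariant set with no proper non-empty closed $G$-invariant subset; the action is minimal if $\mathbb{T}$ is a minimal set. A Denjoy action has a unique minimal set $Y\subsetneq\mathbb{T}$, homeomorphic to the Cantor set (Ghys); its complement is a countable disjoint union of open intervals $I_n$ (the connected components), which are permuted by $G$. Free means $gx=x$ for some $x$ implies $g=e$. The induced action on functions is $(gf)(x)=f(g^{-1}x)$; full and reduced crossed products coincide since $G$ is amenable. $C_0(\mathbb{T}\setminus Y)\rtimes G$ is regarded as an ideal of $A$, namely the kernel of the map $A\to C(Y)\rtimes G$ induced by restriction of functions. An ideal (closed, two-sided) is primitive if it is the kernel of an irreducible representation. $\mathrm{Prim}(A)$ is the set of primitive ideals with the hull-kernel topology, where the closure of a non-empty set $F$ is $\{P\in\mathrm{Prim}(A):\bigcap_{I\in F}I\subseteq P\}$. *)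

(* Defs.v *)
From HB Require Import structures.
From mathcomp Require Import all_boot all_order all_algebra.
From mathcomp Require Import all_classical all_reals all_analysis.
From mathcomp Require Import complex.

Set Implicit Arguments.
Unset Strict Implicit.
Unset Printing Implicit Defensive.

Import Order.TTheory GRing.Theory Num.Theory numFieldNormedType.Exports.

Local Open Scope quotient_scope.
Local Open Scope complex_scope.
Local Open Scope classical_set_scope.
Local Open Scope ring_scope.

Section Circle.
Variable R : realType.

Definition int_shift (x y : R) : bool := (x - y) \is a Num.int.

Lemma int_shift_refl : reflexive int_shift.
Proof. by move=> x; rewrite /int_shift subrr rpred0. Qed.

Lemma int_shift_sym : symmetric int_shift.
Proof. by move=> x y; rewrite /int_shift -rpredN opprB. Qed.

Lemma int_shift_trans : transitive int_shift.
Proof.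
move=> y x z xy yz; rewrite /int_shift.
by rewrite -(subrK y x) -addrA rpredD.
Qed.

Definition int_shift_equiv :=
  EquivRel int_shift int_shift_refl int_shift_sym int_shift_trans.

Definition circle := {eq_quot int_shift_equiv}.

HB.instance Definition _ := Quotient.on circle.
HB.instance Definition _ := Topological.copy circle (quotient_topology circle).

Definition to_circle (x : R) : circle := \pi_circle x.

End Circle.

Section Actions.
Variables (G : zmodType) (X : Type) (act : G -> X -> X).

Definition is_action : Prop :=
  (forall x, act 0 x = x) /\
  (forall g h x, act (g + h) x = act g (act h x)).

Definition free_action : Prop := forall g x, act g x = x -> g = 0.

Definition orbit_of (x : X) : set X := [set act g x | g in [set: G]].

Definition invariant_set (Y : set X) : Prop := forall g x, Y x -> Y (act g x).

Definition restrict_action (Y : set X) (invY : invariant_set Y)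
    (g : G) (y : set_type Y) : set_type Y :=
  SigSub (mem_set (invY g (set_val y) (set_valP y))).

Definition translate (C : Type) (g : G) (f : X -> C) : X -> C :=
  fun x => f (act (- g) x).

End Actions.

Section TopologicalActions.
Variables (G : zmodType) (X : topologicalType) (act : G -> X -> X).

Definition minimal_set (Y : set X) : Prop :=
  [/\ Y !=set0, closed Y, invariant_set act Y &
    forall Z, Z !=set0 -> closed Z -> invariant_set act Z ->
      Z `<=` Y -> Z = Y].

Lemma minimal_set_invariant (Y : set X) : minimal_set Y -> invariant_set act Y.
Proof. by case. Qed.

Definition minimal_action : Prop := minimal_set [set: X].

Definition components (U : set X) : set (set X) :=
  [set connected_component U x | x in U].

Definition component_transversal (U : set X) (I : set (set X)) : Prop :=
  I `<=` components U /\
  forall C, components U C ->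
    exists! D, I D /\ exists g, D = act g @` C.

End TopologicalActions.

Section CircleActions.
Variables (R : realType) (G : zmodType) (act : G -> circle R -> circle R).

(* F need not be assumed continuous: an increasing lift of a surjective map is. *)
Definition orientation_preserving (phi : circle R -> circle R) : Prop :=
  exists F : R -> R,
    [/\ {homo F : x y / x < y}, forall x, F (x + 1) = F x + 1 &
      forall x, to_circle (F x) = phi (to_circle x)].

Definition denjoy_action : Prop :=
  [/\ is_action act,
      forall g, continuous (act g) /\ orientation_preserving (act g),
      ~ minimal_action act &
      forall x, infinite_set (orbit_of act x)].

End CircleActions.

HB.mixin Record NormedModule_isHilbert (R : realType) H
    of CompleteNormedModule R[i] H := {
  dot : H -> H -> R[i] ;
  dotDZl : forall (k : R[i]) (x y z : H),
    dot (k *: x + y) z = k * dot x z + dot y z ;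
  dotC : forall x y : H, dot y x = (dot x y)^* ;
  dotxx : forall x : H, dot x x = `|x| ^+ 2
}.

#[short(type="hilbertType")]
HB.structure Definition Hilbert (R : realType) :=
  { H of CompleteNormedModule R[i] H & NormedModule_isHilbert R H }.

(* Unital C*-algebras. The multiplication is not the one of GRing.Algebra:
   Hierarchy Builder rejects a second join (besides Num.NumDomain) of ring
   structures with normed Z-modules. *)
HB.mixin Record NormedModule_isCStarAlg (R : realType) A
    of CompleteNormedModule R[i] A := {
  cone : A ;
  cmul : A -> A -> A ;
  star : A -> A ;
  cmulA : associative cmul ;
  cmul1l : left_id cone cmul ;
  cmul1r : right_id cone cmul ;
  cmulDZl : forall (k : R[i]) (a b c : A),
    cmul (k *: a + b) c = k *: cmul a c + cmul b c ;
  cmulDZr : forall (k : R[i]) (a b c : A),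
    cmul c (k *: a + b) = k *: cmul c a + cmul c b ;
  starDZ : forall (k : R[i]) (a b : A),
    star (k *: a + b) = k^* *: star a + star b ;
  starM : forall a b : A, star (cmul a b) = cmul (star b) (star a) ;
  starK : involutive star ;
  ler_norm_cmul : forall a b : A, `|cmul a b| <= `|a| * `|b| ;
  cstar_identity : forall a : A, `|cmul (star a) a| = `|a| ^+ 2
}.

#[short(type="cstarAlgType")]
HB.structure Definition CStarAlg (R : realType) :=
  { A of CompleteNormedModule R[i] A & NormedModule_isCStarAlg R A }.

Record star_hom (R : realType) (A B : cstarAlgType R) (q : A -> B) : Prop := {
  star_hom_linear : linear q ;
  star_homM : forall a b, q (cmul a b) = cmul (q a) (q b) ;
  star_hom_star : forall a, q (star a) = star (q a)
}.

Section PrimitiveIdeals.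
Variables (R : realType) (A : cstarAlgType R).

Record representation (H : hilbertType R) (rho : A -> H -> H) : Prop := {
  rep_linear : forall a, linear (rho a) ;
  rep_continuous : forall a, continuous (rho a) ;
  rep_DZ : forall (k : R[i]) a b x,
    rho (k *: a + b) x = k *: rho a x + rho b x ;
  repM : forall a b x, rho (cmul a b) x = rho a (rho b x) ;
  rep_star : forall a x y, dot (rho (star a) x) y = dot x (rho a y)
}.

Definition irreducible_rep (H : hilbertType R) (rho : A -> H -> H) : Prop :=
  (exists a x, rho a x != 0) /\
  forall K : set H, closed K -> K 0 ->
    (forall (k : R[i]) x y, K x -> K y -> K (k *: x + y)) ->
    (forall a x, K x -> K (rho a x)) ->
    K = [set 0] \/ K = setT.

Definition rep_kernel (H : hilbertType R) (rho : A -> H -> H) : set A :=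
  [set a | forall x, rho a x = 0].

Definition primitive_ideal (P : set A) : Prop :=
  exists (H : hilbertType R) (rho : A -> H -> H),
    [/\ representation rho, irreducible_rep rho & P = rep_kernel rho].

Definition prim : Type := {P : set A | primitive_ideal P}.

Definition ideal_of (P : prim) : set A := sval P.

Definition hull_kernel (F : set prim) : set prim :=
  [set P | \bigcap_(I in F) ideal_of I `<=` ideal_of P].

Definition prim_open (U : set prim) : Prop := hull_kernel (~` U) `<=` ~` U.

Lemma hull_kernel_sub F : F `<=` hull_kernel F.
Proof. by move=> P FP a; apply. Qed.

Lemma hull_kernelS F1 F2 : F1 `<=` F2 -> hull_kernel F1 `<=` hull_kernel F2.
Proof. by move=> F12 P FP a Fa; apply: FP => I F1I; exact/Fa/F12. Qed.

Lemma hull_kernelK F : hull_kernel (hull_kernel F) `<=` hull_kernel F.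
Proof. by move=> P hP a Fa; apply: hP => I; exact. Qed.

Lemma primitive_ideal_proper P : primitive_ideal P -> ~ P cone.
Proof.
move=> [H [rho [rep [[a [x /eqP ax]] _] ->]]] /(_ x) one0; apply: ax.
have lin_a := rep_linear rep a.
rewrite -[a in LHS]cmul1r (repM rep) one0.
by have := lin_a (-1) 0 0; rewrite scaler0 addr0 scaleN1r addNr.
Qed.

Lemma primitive_idealMr P a b : primitive_ideal P -> P b -> P (cmul a b).
Proof.
move=> [H [rho [rep _ ->]]] Pb x; rewrite (repM rep) Pb.
by have := rep_linear rep a (-1) 0 0; rewrite scaler0 addr0 scaleN1r addNr.
Qed.

Lemma primitive_idealMl P a b : primitive_ideal P -> P a -> P (cmul a b).
Proof. by move=> [H [rho [rep _ ->]]] Pa x; rewrite (repM rep) Pa. Qed.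

Lemma primitive_ideal_prime P a b : primitive_ideal P ->
  (forall c, P (cmul a (cmul c b))) -> P a \/ P b.
Proof.
move=> [H [rho [rep [_ irr] ->]]] Pab; have lin := rep_linear rep.
have rho0 d : rho d 0 = 0.
  by have := lin d (-1) 0 0; rewrite scaler0 addr0 scaleN1r addNr.
have [Pb|/existsNP[x bx]] := pselect (rep_kernel rho b); [by right|left].
pose K := \bigcap_(c in [set: A]) ((fun y => rho a (rho c y)) @^-1` [set 0]).
have [||||/seteqP[K0 _]|KT] := irr K.
- apply: closed_bigI => c _; apply: preimage_closed.
    by move=> y _; apply: continuous_comp; exact: rep_continuous.
  exact/accessible_closed_set1/hausdorff_accessible/norm_hausdorff.
- by move=> c _ /=; rewrite !rho0.
- move=> k y z Ky Kz c _ /=; rewrite !lin.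
  have -> : rho a (rho c y) = 0 := Ky c I.
  by have -> : rho a (rho c z) = 0 := Kz c I; rewrite scaler0 addr0.
- by move=> d y Ky c _; have := Ky (cmul c d) I; rewrite /= (repM rep).
- case: bx; apply: K0 => c _ /=.
  by have := Pab c x; rewrite !(repM rep).
- move=> y; have /(_ cone) : K y by rewrite KT.
  by move=> /(_ I) /=; rewrite -(repM rep) cmul1r.
Qed.

Lemma hull_kernel_setU F1 F2 :
  hull_kernel (F1 `|` F2) `<=` hull_kernel F1 `|` hull_kernel F2.
Proof.
move=> P hP; have [?|nP1] := pselect (hull_kernel F1 P); [by left|right].
have [a a1 Pa] : exists2 a, (\bigcap_(I in F1) ideal_of I) a & ~ ideal_of P a.
  apply: contrapT => na; apply: nP1 => a a1; apply: contrapT => Pa.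
  by apply: na; exists a.
move=> b b2; suff /(primitive_ideal_prime (svalP P)) [] :
  forall c, sval P (cmul a (cmul c b)) by [].
move=> c; apply: hP => I [F1I|F2I].
  by apply: primitive_idealMl; [exact: (svalP I)|exact: a1].
apply: primitive_idealMr; first exact: (svalP I).
by apply: primitive_idealMr; [exact: (svalP I)|exact: b2].
Qed.

HB.instance Definition _ := gen_eqMixin prim.
HB.instance Definition _ := gen_choiceMixin prim.

Lemma prim_openT : prim_open setT.
Proof.
move=> P; rewrite setCT => hP.
by apply: (primitive_ideal_proper (svalP P)); exact: hP.
Qed.

Lemma prim_openI : setI_closed prim_open.
Proof.
move=> U V oU oV P; rewrite setCI.
by move=> /hull_kernel_setU[/oU|/oV] ?; [left|right].
Qed.

Lemma prim_open_bigU (I : Type) (f : I -> set prim) :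
  (forall i, prim_open (f i)) -> prim_open (\bigcup_i f i).
Proof.
move=> of_ P hP [i _ fiP]; apply: (of_ i P) => //.
by apply: hull_kernelS hP => Q nQ fiQ; apply: nQ; exists i.
Qed.

HB.instance Definition _ :=
  isOpenTopological.Build prim prim_openT prim_openI prim_open_bigU.

Lemma closure_primE (F : set prim) : closure F = hull_kernel F.
Proof.
apply/seteqP; split=> P.
  rewrite closureE; apply; split; last exact: hull_kernel_sub.
  by rewrite -openC /open/= /prim_open setCK; exact: hull_kernelK.
rewrite closureE => hP C [clC FC].
move: clC; rewrite -openC /open/= /prim_open setCK; apply.
exact: hull_kernelS hP.
Qed.

End PrimitiveIdeals.

(* Crossed products of C(X) by a discrete abelian group. Maps defined on C(X)
   are total functions on X -> R[i]^o, constrained on continuous functions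
   only. *)

Section CrossedProduct.
Variables (R : realType) (G : zmodType) (X : topologicalType).
Variable act : G -> X -> X.

Record covariant_rep (H : hilbertType R)
    (pi : (X -> R[i]^o) -> H -> H) (U : G -> H -> H) : Prop := {
  covrep_linear : forall f : X -> R[i]^o, continuous f -> linear (pi f) ;
  covrep_continuous : forall f : X -> R[i]^o, continuous f -> continuous (pi f) ;
  covrep_DZ : forall (k : R[i]) (f g : X -> R[i]^o) x, continuous f -> continuous g ->
    pi (fun t => k * f t + g t) x = k *: pi f x + pi g x ;
  covrep_1 : forall x, pi (fun=> 1) x = x ;
  covrep_M : forall (f g : X -> R[i]^o) x, continuous f -> continuous g ->
    pi (fun t => f t * g t) x = pi f (pi g x) ;
  covrep_star : forall (f : X -> R[i]^o) x y, continuous f ->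
    dot (pi (fun t => (f t)^*) x) y = dot x (pi f y) ;
  covrep_unitary_linear : forall g, linear (U g) ;
  covrep_unitary : forall g x y, dot (U g x) (U g y) = dot x y ;
  covrep_action : is_action U ;
  covrep_covariant : forall g (f : X -> R[i]^o) x, continuous f ->
    U g (pi f x) = pi (translate act g f) (U g x)
}.

Record covariant_pair (A : cstarAlgType R)
    (i : (X -> R[i]^o) -> A) (u : G -> A) : Prop := {
  covpair_DZ : forall (k : R[i]) (f g : X -> R[i]^o), continuous f -> continuous g ->
    i (fun t => k * f t + g t) = k *: i f + i g ;
  covpair_1 : i (fun=> 1) = cone ;
  covpair_M : forall f g : X -> R[i]^o, continuous f -> continuous g ->
    i (fun t => f t * g t) = cmul (i f) (i g) ;
  covpair_star : forall f : X -> R[i]^o, continuous f ->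
    i (fun t => (f t)^*) = star (i f) ;
  covpair_unitary0 : u 0 = cone ;
  covpair_unitaryD : forall g h, u (g + h) = cmul (u g) (u h) ;
  covpair_unitary_star : forall g, star (u g) = u (- g) ;
  covpair_covariant : forall g (f : X -> R[i]^o), continuous f ->
    cmul (u g) (i f) = cmul (i (translate act g f)) (u g)
}.

(* (A, i, u) is the full crossed product of C(X) by G: the completion of the
   convolution *-algebra C_c(G, C(X)), whose elements are the finite sums
   \sum_k f_k u_(g_k), for the norm that is the supremum of the operator norms
   of \sum_k pi(f_k) U(g_k) over all covariant representations (pi, U). *)
Record crossed_product (A : cstarAlgType R)
    (i : (X -> R[i]^o) -> A) (u : G -> A) : Prop := {
  cp_covariant : covariant_pair i u ;
  cp_dense :
    closure [set a | exists n (f : 'I_n -> X -> R[i]^o) (g : 'I_n -> G),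
      (forall k, continuous (f k)) /\
      a = \sum_(k < n) cmul (i (f k)) (u (g k))] = setT ;
  cp_norm : forall n (f : 'I_n -> X -> R[i]^o) (g : 'I_n -> G) (M : R),
    (forall k, continuous (f k)) -> 0 <= M ->
    `|\sum_(k < n) cmul (i (f k)) (u (g k))| <= M%:C <->
    forall (H : hilbertType R) (pi : (X -> R[i]^o) -> H -> H) (U : G -> H -> H),
      covariant_rep pi U -> forall x : H,
      `|\sum_(k < n) pi (f k) (U (g k) x)| <= M%:C * `|x|
}.

End CrossedProduct.

(* For Y closed and invariant, i, u, j, v the canonical maps of C(X) x| G and
   C(Y) x| G, the kernel of q is the ideal C_0(X \ Y) x| G. *)
Definition induced_by_restriction (R : realType) (G : zmodType)
    (X : topologicalType) (Y : set X) (A B : cstarAlgType R)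
    (i : (X -> R[i]^o) -> A) (u : G -> A)
    (j : (set_type Y -> R[i]^o) -> B) (v : G -> B) (q : A -> B) : Prop :=
  [/\ star_hom q,
      forall f : X -> R[i]^o, continuous f -> q (i f) = j (f \o set_val) &
      forall g, q (u g) = v g].

(* The space X together with an extra point None that lies in the closure of
   every non-empty subset *)

Definition adjoin_point (X : Type) : Type := option X.

Section AdjoinPoint.
Variable X : topologicalType.

HB.instance Definition _ := Choice.on (adjoin_point X).

Definition adjoin_open (U : set (adjoin_point X)) : Prop :=
  U = setT \/ exists2 V : set X, open V & U = Some @` V.

Lemma adjoin_openT : adjoin_open setT. Proof. by left. Qed.

Lemma adjoin_openI : setI_closed adjoin_open.
Proof.
move=> U V [->|[U' oU ->]]; first by rewrite setTI.
case=> [->|[V' oV ->]]; first by rewrite setIT; right; exists U'.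
right; exists (U' `&` V'); first exact: openI.
apply/seteqP; split=> [_ [[x Ux <-] [y Vy [yx]]]|_ [x [Ux Vx] <-]].
  by exists x => //; split => //; rewrite -yx.
by split; exists x.
Qed.

Lemma adjoin_open_bigU (I : Type) (f : I -> set (adjoin_point X)) :
  (forall i, adjoin_open (f i)) -> adjoin_open (\bigcup_i f i).
Proof.
move=> of_; have [[i fiT]|nT] := pselect (exists i, f i = setT).
  by left; apply/seteqP; split=> // x _; exists i => //; rewrite fiT.
right; exists (\bigcup_i (Some @^-1` f i)).
  apply: bigcup_open => i _; case: (of_ i) => [fiT|[V oV ->]].
    by case: nT; exists i.
  suff -> : Some @^-1` (Some @` V) = V by [].
  by apply/seteqP; split=> [x [y Vy [<-]]|x Vx] //; exists x.
apply/seteqP; split=> [x [i _ fix_]|_ [x [i _ fix_] <-]]; last by exists i.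
case: (of_ i) => [fiT|[V oV fiE]]; first by case: nT; exists i.
have := fix_; rewrite fiE => -[y Vy yx]; exists y => //; exists i => //=.
by rewrite fiE; exists y.
Qed.

HB.instance Definition _ := isOpenTopological.Build (adjoin_point X)
  adjoin_openT adjoin_openI adjoin_open_bigU.

Lemma closed_adjoinP (C : set (adjoin_point X)) :
  closed C <->
  C = set0 \/ exists2 F : set X, closed F & C = Some @` F `|` [set None].
Proof.
rewrite -openC; split=> [[CT|[V oV CV]]|[->|[F cF ->]]].
- by left; rewrite -(setCK C) CT setCT.
- right; exists (~` V); first exact: open_closedC.
  rewrite -(setCK C) CV; apply/seteqP; split=> [[x|] nVx|].
  + by left; exists x => // Vx; apply: nVx; exists x.
  + by right.
  + move=> _ [[x nVx <-] [y Vy [yx]]|->]; last by case.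
    by apply: nVx; rewrite -yx.
- by left; rewrite setC0.
- right; exists (~` F); first exact: closed_openC.
  apply/seteqP; split=> [[x|] nF|].
  + by exists x => // Fx; apply: nF; left; exists x.
  + by case: nF; right.
  + move=> _ [x nFx <-] [[y Fy [yx]]|//].
    by apply: nFx; rewrite -yx.
Qed.

End AdjoinPoint.

Definition homeomorphism (X Y : topologicalType) (h : X -> Y) : Prop :=
  continuous h /\
  exists k : Y -> X, [/\ continuous k, cancel h k & cancel k h].

(* Main.v *)
Require Import Defs.
From HB Require Import structures.
From mathcomp Require Import all_boot all_order all_algebra.
From mathcomp Require Import all_classical all_reals all_analysis.
From mathcomp Require Import complex.
From mathcomp Require Import ring lra.

Set Implicit Arguments.
Unset Strict Implicit.
Unset Printing Implicit Defensive.

Import Order.TTheory GRing.Theory Num.Theory numFieldNormedType.Exports.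

Local Open Scope complex_scope.
Local Open Scope classical_set_scope.
Local Open Scope ring_scope.

(** Every ideal of A turns out to be determined by the continuous functions that it
    contains, so Prim(A) is a space of closures of orbits in the circle.

    The engine is [ideal_intersection]: if a representation sigma of A kills every
    function that lies in all the ideals of a family, then it kills every element
    that lies in all of them. Freeness enters through functions h supported so
    close to a point x that their support is disjoint from finitely many of its
    translates: compressing by h leaves a single term of a finite sum of f_k u_g_k,
    so the Fourier coefficients of an element are bounded, on the common zero set
    of the functions in the ideals, by its norm modulo the ideals ([coef_bound]).
    Hence the regular representation on l2(G, H) induced from sigma kills the
    elements of the intersection ([regular_killed]). Commutativity enters through
    amenability: l2(G) has finitely supported unit vectors almost fixed by any
    finite set of translations ([almost_invariant_vectors]), and through these the
    regular representation recovers sigma ([regular_faithful]).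

    A point x gives an irreducible representation on l2 of its orbit
    ([orbit_rep_irreducible]). Its kernel P_x contains a function exactly when the
    function vanishes on the orbit, hence on its closure. A component of the
    complement of Y has trivial stabiliser, since a lift that preserves an
    interval up to an integer translation fixes its right endpoint up to the same
    translation ([component_fixed_point]). So an orbit outside Y meets each
    component at most once and, the circle being compact, accumulates at Y, hence
    on all of Y by minimality ([minimal_sub_closure]). The closures of orbits are
    therefore Y and the sets Gx U Y with x in Y0, and bump functions supported
    near x in Y0 tell them apart and yield the topology of Y0. Since primitive
    ideals are prime, the zero set of one of them cannot contain two orbits
    outside Y ([prim_hull_prime]), so there are no others. Finally J is P_y for any
    y in Y, because the representations of the full crossed product by Y separate
    its points ([restriction_kernel]). *)

(** * Norms, inner products and C*-algebras *)

Section RealNorm.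
Variables (R : realType) (V : normedModType R[i]).
Implicit Types (x y : V) (k : R[i]).

(** Norms over R[i] take values in R[i]; this is the same norm with values in R,
    where the order is total. *)
Definition nrm x : R := complex.Re `|x|.

Lemma nrmE x : `|x| = (nrm x)%:C.
Proof. by rewrite RRe_real// ger0_real. Qed.

Lemma nrm_le x (M : R) : (`|x| <= M%:C) = (nrm x <= M).
Proof. by rewrite nrmE lecR. Qed.

Lemma nrm_lt x (M : R) : (`|x| < M%:C) = (nrm x < M).
Proof. by rewrite nrmE ltcR. Qed.

Lemma nrm_ge0 x : 0 <= nrm x.
Proof. by rewrite -ler0c -nrmE. Qed.

Lemma nrm0 : nrm 0 = 0.
Proof. by rewrite /nrm normr0. Qed.

Lemma nrm_eq0 x : nrm x = 0 -> x = 0.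
Proof. by move=> x0; apply/normr0_eq0; rewrite nrmE x0. Qed.

Lemma nrmD x y : nrm (x + y) <= nrm x + nrm y.
Proof. by rewrite -lecR rmorphD/= -!nrmE ler_normD. Qed.

Lemma nrmN x : nrm (- x) = nrm x.
Proof. by rewrite /nrm normrN. Qed.

Lemma nrmBC x y : nrm (x - y) = nrm (y - x).
Proof. by rewrite -nrmN opprB. Qed.

Lemma nrmB_trans y x z : nrm (x - z) <= nrm (x - y) + nrm (y - z).
Proof. by rewrite -[x - z](subrKA y) nrmD. Qed.

Lemma nrm_le_eps x : (forall e : R, 0 < e -> nrm x <= e) -> x = 0.
Proof.
move=> h; apply: nrm_eq0; apply/eqP; rewrite eq_le nrm_ge0 andbT.
by apply/ler_addgt0Pr => e e0; rewrite add0r; exact: h.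
Qed.

Lemma nbhs_nrm x (P : set V) :
  nbhs x P <-> exists2 e : R, 0 < e & forall y, nrm (x - y) < e -> P y.
Proof.
split=> [/nbhs_ballP[e /= e0 eP]|[e e0 eP]].
- exists (complex.Re e).
    by rewrite -ltcR RRe_real ?gtr0_real.
  move=> y xy; apply: eP; rewrite -ball_normE /= nrmE.
  by rewrite -[e]RRe_real ?gtr0_real// ltcR.
- apply/nbhs_ballP; exists e%:C; first by rewrite /= ltcR.
  by move=> y; rewrite -ball_normE /= nrm_lt; exact: eP.
Qed.

Lemma closure_nrm (S : set V) x :
  closure S x <-> forall e : R, 0 < e -> exists2 y, S y & nrm (x - y) < e.
Proof.
split=> [xS e e0|h B /nbhs_nrm[e e0 eB]].
  have [|y [Sy xy]] := xS [set y | nrm (x - y) < e]; last by exists y.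
  by apply/nbhs_nrm; exists e.
by have [y Sy xy] := h _ e0; exists y; split => //; exact: eB.
Qed.

Lemma continuous_nrmP (T : topologicalType) (f : T -> V) :
  continuous f <->
  forall t (e : R), 0 < e -> \forall s \near t, nrm (f t - f s) < e.
Proof.
split=> [cf t e e0|h t B /nbhs_nrm[e e0 eB]].
  by apply: (cf t [set y | nrm (f t - y) < e]); apply/nbhs_nrm; exists e.
by have := h t _ e0; apply: filterS => s; exact: eB.
Qed.

End RealNorm.

Lemma nrm_le_epsM (R : realType) (V : normedModType R[i]) (x : V) (K : R) :
  (forall e : R, 0 < e -> nrm x <= e * K) -> x = 0.
Proof.
move=> h; apply: nrm_le_eps => e e0.
have K1 : 0 < `|K| + 1 by rewrite ltr_wpDl.
have eK : 0 < e / (`|K| + 1) by rewrite divr_gt0.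
apply: (le_trans (h _ eK)); rewrite -mulrA ler_piMr ?(ltW e0)//.
by rewrite mulrC ler_pdivrMr// mul1r (le_trans (ler_norm _))// lerDl.
Qed.

Lemma nrmZ (R : realType) (V : normedModType R[i]) (k : R[i]) (x : V) :
  nrm (k *: x) = nrm (k : R[i]^o) * nrm x.
Proof. by apply: complexI; rewrite rmorphM/= -!nrmE normrZ. Qed.

Lemma bounded_linear_continuous_nrm (R : realType) (V W : normedModType R[i])
    (T : V -> W) (K : R) :
  linear T -> (forall x, nrm (T x) <= K * nrm x) -> continuous T.
Proof.
move=> linT TK; apply/continuous_nrmP => x e e0.
have K1 : 0 < `|K| + 1 by rewrite ltr_wpDl.
apply/nbhs_nrm; exists (e / (`|K| + 1)); first by rewrite divr_gt0.
move=> y xy; have -> : T x - T y = T (x - y).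
  have := linT (-1) y x; rewrite !scaleN1r => h.
  by rewrite addrC -h addrC.
apply: (le_lt_trans (TK _)); apply: (@le_lt_trans _ _ ((`|K| + 1) * nrm (x - y))).
  by rewrite ler_wpM2r ?nrm_ge0// (le_trans (ler_norm _))// lerDl.
by rewrite mulrC -ltr_pdivlMr.
Qed.

Notation cabs k := (nrm ((k : _[i]) : _[i]^o)).

Section ComplexModulus.
Variable R : realType.
Implicit Types (k l : R[i]) (r : R).

Lemma cabsM k l : cabs (k * l) = cabs k * cabs l.
Proof. by rewrite -[k * l]/(k *: (l : R[i]^o)) nrmZ. Qed.

Lemma cabs_real r : cabs r%:C = `|r|.
Proof. by rewrite /nrm normc_def/= expr0n/= addr0 sqrtr_sqr. Qed.

Lemma cabs_conj k : cabs k^* = cabs k.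
Proof. by rewrite /nrm norm_conjC. Qed.

Lemma conj_realC r : (r%:C : R[i])^* = r%:C.
Proof. exact: conjc_real. Qed.

Lemma cabs_sqr k : (cabs k ^+ 2)%:C = k * k^*.
Proof. by rewrite rmorphXn/= -nrmE normCK. Qed.

Lemma Re_le_cabs k : complex.Re k <= cabs k.
Proof.
rewrite /nrm normc_def/= (le_trans (ler_norm _))// -sqrtr_sqr.
by rewrite ler_wsqrtr// lerDl sqr_ge0.
Qed.

Lemma Im_le_cabs k : `|complex.Im k| <= cabs k.
Proof.
by rewrite /nrm normc_def/= -sqrtr_sqr ler_wsqrtr// lerDr sqr_ge0.
Qed.

Lemma cabs_le_ReIm k : cabs k <= `|complex.Re k| + `|complex.Im k|.
Proof.
rewrite {1}[k]complexE (le_trans (nrmD _ _))// cabsM !cabs_real lerD2l.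
rewrite -[leRHS]mul1r ler_wpM2r// /nrm normc_def/=.
by rewrite expr0n/= add0r expr1n sqrtr1.
Qed.

Lemma cabs1 : cabs (1 : R[i]) = 1.
Proof. by rewrite /nrm normr1. Qed.

End ComplexModulus.

Section HilbertBasics.
Variables (R : realType) (H : hilbertType R).
Implicit Types (x y z : H) (k : R[i]).

Lemma dotDl x y z : dot (x + y) z = dot x z + dot y z.
Proof. by have := dotDZl 1 x y z; rewrite scale1r mul1r. Qed.

Lemma dot0l z : dot (0 : H) z = 0.
Proof.
have := dotDl 0 0 z; rewrite addr0 => /eqP.
by rewrite addrC -subr_eq subrr => /eqP.
Qed.

Lemma dotZl k x z : dot (k *: x) z = k * dot x z.
Proof. by have := dotDZl k x 0 z; rewrite addr0 dot0l addr0. Qed.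

Lemma dotNl x z : dot (- x) z = - dot x z.
Proof. by rewrite -scaleN1r dotZl mulN1r. Qed.

Lemma dotDr x y z : dot z (x + y) = dot z x + dot z y.
Proof. by rewrite dotC dotDl rmorphD/= -!dotC. Qed.

Lemma dot0r z : dot z (0 : H) = 0.
Proof. by rewrite dotC dot0l conjC0. Qed.

Lemma dotZr k x z : dot z (k *: x) = k^* * dot z x.
Proof. by rewrite dotC dotZl rmorphM/= -!dotC. Qed.

Lemma dotNr x z : dot z (- x) = - dot z x.
Proof. by rewrite dotC dotNl rmorphN/= -dotC. Qed.

Lemma dot_sumr (I : Type) (s : seq I) (P : pred I) (F : I -> H) x :
  dot x (\sum_(t <- s | P t) F t) = \sum_(t <- s | P t) dot x (F t).
Proof. by elim/big_rec2: _ => [|t y1 y2 _ <-]; rewrite ?dot0r// dotDr. Qed.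

Lemma dot_suml (I : Type) (s : seq I) (P : pred I) (F : I -> H) x :
  dot (\sum_(t <- s | P t) F t) x = \sum_(t <- s | P t) dot (F t) x.
Proof. by elim/big_rec2: _ => [|t y1 y2 _ <-]; rewrite ?dot0l// dotDl. Qed.

Lemma dot_nrm x : dot x x = (nrm x ^+ 2)%:C.
Proof. by rewrite dotxx nrmE rmorphXn. Qed.

Lemma nrm_sqr x : nrm x ^+ 2 = complex.Re (dot x x).
Proof. by rewrite dot_nrm. Qed.

Lemma cauchy_schwarz x y : cabs (dot x y) <= nrm x * nrm y.
Proof.
have [y0|ny] := eqVneq (nrm y) 0.
  by rewrite (nrm_eq0 y0) dot0r nrm0 mulr0 nrm0.
set n := nrm y; set d := dot x y.
have n0 : 0 < n by rewrite lt_neqAle eq_sym ny nrm_ge0.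
have := nrm_sqr ((n ^+ 2)%:C *: x - d *: y).
rewrite !(dotDl, dotDr, dotNl, dotNr, dotZl, dotZr) conj_realC !dot_nrm.
rewrite -/n (dotC x y) -/d.
have -> : (n ^+ 2)%:C * ((n ^+ 2)%:C * (nrm x ^+ 2)%:C - d^* * d) -
    d * ((n ^+ 2)%:C * d^* - d^* * (n ^+ 2)%:C)
  = (n ^+ 4 * nrm x ^+ 2 - n ^+ 2 * cabs d ^+ 2)%:C.
  rewrite rmorphB/= [X in _ = _ - X]rmorphM/= cabs_sqr rmorphM/= !rmorphXn/=.
  ring.
move=> /= E; have : 0 <= n ^+ 2 * (n ^+ 2 * nrm x ^+ 2 - cabs d ^+ 2).
  by rewrite mulrBr mulrA -exprD -E sqr_ge0.
rewrite pmulr_rge0 ?exprn_gt0// subr_ge0 -exprMn.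
by rewrite ler_pXn2r// ?nnegrE ?mulr_ge0 ?nrm_ge0// mulrC.
Qed.

Lemma dot_eq0 x : (forall y, dot x y = 0) -> x = 0.
Proof.
move=> /(_ x); rewrite dot_nrm => /complexI/eqP.
by rewrite sqrf_eq0 => /eqP/nrm_eq0.
Qed.

End HilbertBasics.

Lemma nrm_complete (R : realType) (V : completeNormedModType R[i])
    (t : nat -> V) :
  (forall e : R, 0 < e -> exists N, forall n, (N <= n)%N -> nrm (t N - t n) < e) ->
  exists l, forall e : R, 0 < e ->
    exists N, forall n, (N <= n)%N -> nrm (l - t n) < e.
Proof.
move=> ct; have /cauchy_cvg/cvg_ex[l tl] : cauchy (t @ \oo).
  apply/cauchyP => e e0; have [|N tN] := ct (complex.Re e).
    by rewrite -ltcR RRe_real ?gtr0_real.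
  exists (t N); exists N => // n /= /tN tNn; rewrite -ball_normE /= nrmE.
  by rewrite -[e]RRe_real ?gtr0_real// ltcR.
exists l => e e0; have [|N _ tN] := tl [set y | nrm (l - y) < e].
  by apply/nbhs_nrm; exists e.
by exists N => n /tN.
Qed.

Section CStarBasics.
Variables (R : realType) (A : cstarAlgType R).
Implicit Types (a b c : A) (k : R[i]).

Lemma cmulDl a b c : cmul (a + b) c = cmul a c + cmul b c.
Proof. by have := cmulDZl 1 a b c; rewrite !scale1r. Qed.

Lemma cmulDr a b c : cmul c (a + b) = cmul c a + cmul c b.
Proof. by have := cmulDZr 1 a b c; rewrite !scale1r. Qed.

Lemma cmul0l c : cmul (0 : A) c = 0.
Proof.
by have /eqP := cmulDl 0 0 c; rewrite addr0 addrC -subr_eq subrr => /eqP.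
Qed.

Lemma cmul0r c : cmul c (0 : A) = 0.
Proof.
by have /eqP := cmulDr 0 0 c; rewrite addr0 addrC -subr_eq subrr => /eqP.
Qed.

Lemma cmulZl k a c : cmul (k *: a) c = k *: cmul a c.
Proof. by have := cmulDZl k a 0 c; rewrite addr0 cmul0l addr0. Qed.

Lemma cmulZr k a c : cmul c (k *: a) = k *: cmul c a.
Proof. by have := cmulDZr k a 0 c; rewrite addr0 cmul0r addr0. Qed.

Lemma cmulNl a c : cmul (- a) c = - cmul a c.
Proof. by rewrite -scaleN1r cmulZl scaleN1r. Qed.

Lemma cmulNr a c : cmul c (- a) = - cmul c a.
Proof. by rewrite -scaleN1r cmulZr scaleN1r. Qed.

Lemma starD a b : star (a + b) = star a + star b.
Proof. by have := starDZ 1 a b; rewrite conjC1 !scale1r. Qed.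

Lemma star0 : star (0 : A) = 0.
Proof.
by have /eqP := starD 0 0; rewrite addr0 addrC -subr_eq subrr => /eqP.
Qed.

Lemma starZ k a : star (k *: a) = k^* *: star a.
Proof. by have := starDZ k a 0; rewrite addr0 star0 addr0. Qed.

Lemma starN a : star (- a) = - star a.
Proof. by rewrite -scaleN1r starZ rmorphN1 scaleN1r. Qed.

Lemma star1 : star cone = cone :> A.
Proof.
by rewrite -[LHS]cmul1r -[X in cmul _ X]starK -starM cmul1r starK.
Qed.

Lemma nrm_cmul a b : nrm (cmul a b) <= nrm a * nrm b.
Proof. by rewrite -lecR rmorphM/= -!nrmE ler_norm_cmul. Qed.

Lemma nrm_cstar a : nrm (cmul (star a) a) = nrm a ^+ 2.
Proof. by apply: complexI; rewrite rmorphXn/= -!nrmE cstar_identity. Qed.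

Lemma nrm_star a : nrm (star a) = nrm a.
Proof.
suff le b : nrm b <= nrm (star b).
  by apply/eqP; rewrite eq_le le -[X in _ <= nrm X]starK le.
have [b0|b0] := eqVneq (nrm b) 0; first by rewrite b0 nrm_ge0.
rewrite -(@ler_pM2r _ (nrm b)) ?lt_neqAle 1?eq_sym ?b0 ?nrm_ge0//.
by rewrite -expr2 -nrm_cstar nrm_cmul.
Qed.

Lemma nrm_isometry a : cmul (star a) a = cone -> nrm a <= 1.
Proof.
have one1 : nrm (cone : A) <= 1.
  have : nrm (cone : A) ^+ 2 = nrm (cone : A).
    by rewrite -nrm_cstar cmul1r star1.
  have := nrm_ge0 (cone : A); nra.
move=> a1; have := nrm_cstar a; rewrite a1.
have := nrm_ge0 a; nra.
Qed.

(** A self-adjoint contraction [h] leaves room for a self-adjoint square root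
    of [1 - h]: writing it [1 - t], the equation becomes the fixed point
    problem t = (h + t^2) / 2, whose iterates from 0 stay in the ball of
    radius |h|, where t |-> t^2 / 2 contracts by the factor |h|. *)
Lemma sqrt_one_minus h : star h = h -> nrm h < 1 ->
  exists2 s : A, star s = s & cmul s s = cone - h.
Proof.
move=> sh; set r := nrm h => r1; have r0 : 0 <= r := nrm_ge0 h.
have half0 : nrm ((2^-1)%:C : R[i]^o) = 2^-1 by rewrite cabs_real ger0_norm.
pose f (t : A) : A := (2^-1)%:C *: (h + cmul t t).
pose t n := iter n f 0.
have tS n : t n.+1 = f (t n) by [].
have tr n : nrm (t n) <= r.
  elim: n => [|n ih]; first by rewrite nrm0.
  rewrite tS nrmZ half0.
  have := nrmD h (cmul (t n) (t n)); have := nrm_cmul (t n) (t n).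
  have := nrm_ge0 (t n); rewrite -/r; nra.
have st n : star (t n) = t n.
  elim: n => [|n ih]; first by rewrite star0.
  by rewrite tS starZ conj_realC starD starM sh ih.
have fB (x y : A) : nrm x <= r -> nrm y <= r -> nrm (f x - f y) <= r * nrm (x - y).
  move=> xr yr; rewrite /f -scalerBr nrmZ half0 opprD addrACA subrr add0r.
  have -> : cmul x x - cmul y y = cmul x (x - y) + cmul (x - y) y.
    by rewrite cmulDr cmulDl cmulNl cmulNr addrA subrK.
  have := nrmD (cmul x (x - y)) (cmul (x - y) y).
  have := nrm_cmul x (x - y); have := nrm_cmul (x - y) y.
  have := nrm_ge0 (x - y); nra.
have dt n : nrm (t n - t n.+1) <= r ^+ n.
  elim: n => [|n ih].
    by rewrite expr0 sub0r nrmN (le_trans (tr _))// ltW.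
  rewrite tS [X in nrm (_ - X)]tS (le_trans (fB _ _ (tr _) (tr _)))//.
  by rewrite exprS ler_wpM2l.
have dtk n (k : nat) : (1 - r) * nrm (t n - t (n + k)%N) <= r ^+ n - r ^+ (n + k).
  elim: k => [|k ih]; first by rewrite addn0 !subrr nrm0 mulr0.
  have := nrmB_trans (t (n + k)%N) (t n) (t (n + k).+1).
  by have := dt (n + k)%N; rewrite addnS exprS; nra.
have [|l tl] := @nrm_complete _ A t.
  move=> e e0; have : `|r| < 1 by rewrite ger0_norm.
  move=> /cvg_expr/cvgrPdist_lt/(_ ((1 - r) * e)).
  rewrite mulr_gt0 ?subr_gt0// => /(_ isT)[N _ /(_ N (leqnn _))/=].
  rewrite sub0r normrN ger0_norm ?exprn_ge0// => rN; exists N => n Nn.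
  have := dtk N (n - N)%N; rewrite subnKC//.
  have : 0 <= r ^+ n by rewrite exprn_ge0.
  by rewrite -(@ltr_pM2l _ (1 - r)) ?subr_gt0//; lra.
have lr : nrm l <= r.
  apply/ler_addgt0Pr => e e0; have [N /(_ N (leqnn _)) lN] := tl _ e0.
  by have := nrmD (l - t N) (t N); rewrite subrK; have := tr N; lra.
have sl : star l = l.
  apply/subr0_eq; apply: nrm_le_eps => e e0.
  have [|N /(_ N (leqnn _)) lN] := tl (e / 2); first by rewrite divr_gt0.
  have := nrmB_trans (t N) (star l) l.
  by rewrite -{1}st -starN -starD nrm_star [nrm (t N - l)]nrmBC; lra.
have fl : f l = l.
  apply/subr0_eq; apply: nrm_le_eps => e e0.
  have [|N lN] := tl (e / 2); first by rewrite divr_gt0.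
  have := nrmB_trans (t N.+1) (f l) l; have := fB _ _ lr (tr N).
  have := lN _ (leqnn N); have := lN _ (leqnSn N); rewrite tS.
  rewrite [nrm (l - f _)]nrmBC; have := nrm_ge0 (l - t N); nra.
exists (cone - l).
  by rewrite starD starN sl star1.
have : (2%:C : R[i]) *: f l = h + cmul l l.
  by rewrite scalerA -rmorphM/= divff ?pnatr_eq0// scale1r.
rewrite fl [2]mulr2n rmorphD scalerDl scale1r => /eqP.
rewrite -subr_eq => /eqP <-.
rewrite cmulDr cmul1r cmulNr cmulDl cmul1l cmulNl.
by rewrite -!addrA -!opprD !addrA.
Qed.

End CStarBasics.

Section Contractivity.
Variables (R : realType) (A : cstarAlgType R) (H : hilbertType R).
Variables (rho : A -> H -> H) (rep : representation rho).

Lemma repDv a x y : rho a (x + y) = rho a x + rho a y.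
Proof. by have := rep_linear rep a 1 x y; rewrite !scale1r. Qed.

Lemma rep0v a : rho a 0 = 0.
Proof.
by have /eqP := repDv a 0 0; rewrite addr0 addrC -subr_eq subrr => /eqP.
Qed.

Lemma repZv a k x : rho a (k *: x) = k *: rho a x.
Proof. by have := rep_linear rep a k x 0; rewrite rep0v !addr0. Qed.

Lemma repD a b x : rho (a + b) x = rho a x + rho b x.
Proof. by have := rep_DZ rep 1 a b x; rewrite !scale1r. Qed.

Lemma rep0 x : rho 0 x = 0.
Proof.
by have /eqP := repD 0 0 x; rewrite addr0 addrC -subr_eq subrr => /eqP.
Qed.

Lemma repZ k a x : rho (k *: a) x = k *: rho a x.
Proof. by have := rep_DZ rep k a 0 x; rewrite rep0 !addr0. Qed.

Lemma repN a x : rho (- a) x = - rho a x.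
Proof. by rewrite -scaleN1r repZ scaleN1r. Qed.

Lemma rep_nrm_sqr a x : (nrm (rho a x) ^+ 2)%:C = dot (rho (cmul (star a) a) x) x.
Proof. by rewrite -dot_nrm (repM rep) (rep_star rep). Qed.

(** Continuity in the algebra variable is automatic: for |a| < 1 a square root
    [s] of 1 - a^* a turns |rho(a) x|^2 into |rho(1) x|^2 - |rho(s) x|^2. *)
Lemma rep_contractive a x : nrm (rho a x) <= nrm a * nrm x.
Proof.
have one_le : nrm (rho cone x) <= nrm x.
  have := cauchy_schwarz (rho cone x) x.
  have := rep_nrm_sqr cone x; rewrite star1 cmul1r => <-.
  rewrite cabs_real ger0_norm ?sqr_ge0// expr2.
  have := nrm_ge0 (rho cone x); have := nrm_ge0 x; nra.
have unit_ball b : nrm b < 1 -> nrm (rho b x) <= nrm x.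
  move=> b1; have [||s ss sE] := @sqrt_one_minus _ _ (cmul (star b) b).
  - by rewrite starM starK.
  - by rewrite nrm_cstar expr_lt1// nrm_ge0.
  have := rep_nrm_sqr s x; rewrite ss sE repD repN dotDl dotNl -rep_nrm_sqr.
  have := rep_nrm_sqr cone x; rewrite star1 cmul1r => <-.
  rewrite -rmorphB => /complexI E.
  have := sqr_ge0 (nrm (rho s x)); rewrite E => E'.
  have := nrm_ge0 (rho b x); have := nrm_ge0 (rho cone x); nra.
apply/ler_addgt0Pr => e e0.
pose d := e / (nrm x + 1).
have d0 : 0 < d by rewrite divr_gt0// ltr_wpDl// nrm_ge0.
have ad0 : 0 < nrm a + d by rewrite ltr_wpDl// nrm_ge0.
have := unit_ball (((nrm a + d)^-1)%:C *: a).
rewrite nrmZ cabs_real ger0_norm ?invr_ge0 ?(ltW ad0)// mulrC.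
rewrite ltr_pdivrMr// mul1r ltrDl => /(_ d0).
rewrite repZ nrmZ cabs_real ger0_norm ?invr_ge0 ?(ltW ad0)//.
rewrite mulrC ler_pdivrMr// => /le_trans; apply.
rewrite mulrDr mulrC lerD2l /d mulrCA ler_piMr// ?(ltW e0)//.
by rewrite ler_pdivrMr ?mul1r ?lerDl// ltr_wpDl// nrm_ge0.
Qed.

Lemma repBv a x y : rho a (x - y) = rho a x - rho a y.
Proof. by rewrite -[- y]scaleN1r repDv repZv scaleN1r. Qed.

End Contractivity.

(** * Continuous functions and their representations *)

Section ContinuousFunctions.
Variables (R : realType) (X : topologicalType).
Implicit Types (f g : X -> R[i]^o) (k l : X -> R).

Lemma continuous_nrm (V : normedModType R[i]) (f : X -> V) :
  continuous f -> continuous (fun t => nrm (f t)).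
Proof.
move=> /continuous_nrmP cf t; apply/cvgrPdist_lt => e e0.
apply: filterS (cf t e e0) => s /(le_lt_trans _); apply.
rewrite ler_norml; apply/andP; split.
  by have := nrmD (f s - f t) (f t); rewrite subrK nrmBC; lra.
by have := nrmD (f t - f s) (f s); rewrite subrK; lra.
Qed.

Lemma continuous_realC k :
  continuous k -> continuous (fun t => (k t)%:C : R[i]^o).
Proof.
move=> ck; apply/continuous_nrmP => t e e0.
have /cvgrPdist_lt/(_ e e0) := ck t; apply: filterS => s.
by rewrite -rmorphB/= cabs_real.
Qed.

Lemma continuous_conj f : continuous f -> continuous (fun t => (f t)^* : R[i]^o).
Proof.
move=> /continuous_nrmP cf; apply/continuous_nrmP => t e e0.
by apply: filterS (cf t e e0) => s; rewrite -rmorphB/= cabs_conj.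
Qed.

Lemma continuousMC f g :
  continuous f -> continuous g -> continuous (fun t => f t * g t : R[i]^o).
Proof. by move=> cf cg t; apply: (@cvgM _ _ (nbhs t)); [exact: cf|exact: cg]. Qed.

Lemma continuousDC f g :
  continuous f -> continuous g -> continuous (fun t => f t + g t : R[i]^o).
Proof. by move=> cf cg t; apply: (@cvgD _ _ _ (nbhs t)); [exact: cf|exact: cg]. Qed.

Lemma continuous_constC (c : R[i]) : continuous (fun _ : X => c : R[i]^o).
Proof. by move=> t; exact: cvg_cst. Qed.

Lemma continuousDZ (c : R[i]) f g :
  continuous f -> continuous g -> continuous (fun t => c * f t + g t : R[i]^o).
Proof.
move=> cf cg.
exact: (continuousDC (continuousMC (@continuous_constC c) cf) cg).
Qed.

Lemma continuous_maxr k (c : R) :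
  continuous k -> continuous (fun t => Num.max (k t) c).
Proof.
move=> ck t; apply/cvgrPdist_lt => e e0.
have /cvgrPdist_lt/(_ e e0) := ck t; apply: filterS => s.
by move: (k t) (k s) => a b; case: (leP a c); case: (leP b c);
   rewrite !ltr_norml => *; lra.
Qed.

Lemma continuousMr k l :
  continuous k -> continuous l -> continuous (fun t => k t * l t).
Proof. by move=> ck cl t; apply: (@cvgM _ _ (nbhs t)); [exact: ck|exact: cl]. Qed.

Lemma continuousDr k l :
  continuous k -> continuous l -> continuous (fun t => k t + l t).
Proof. by move=> ck cl t; apply: (@cvgD _ _ _ (nbhs t)); [exact: ck|exact: cl]. Qed.

Lemma continuous_constr (c : R) : continuous (fun _ : X => c).
Proof. by move=> t; exact: cvg_cst. Qed.

Lemma continuous_sqrtr k : continuous k -> continuous (fun t => Num.sqrt (k t)).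
Proof. by move=> ck t; apply: continuous_comp; [exact: ck|exact: sqrt_continuous]. Qed.

End ContinuousFunctions.

(** Representations of C(X) alone, the part of a covariant representation that
    does not involve the group; evaluation at a point is the basic example. *)
Record function_rep (R : realType) (X : topologicalType) (H : hilbertType R)
    (pi : (X -> R[i]^o) -> H -> H) : Prop := {
  frep_linear : forall f : X -> R[i]^o, continuous f -> linear (pi f) ;
  frep_DZ : forall (k : R[i]) (f g : X -> R[i]^o) x,
    continuous f -> continuous g ->
    pi (fun t => k * f t + g t) x = k *: pi f x + pi g x ;
  frep_1 : forall x, pi (fun=> 1) x = x ;
  frep_M : forall (f g : X -> R[i]^o) x, continuous f -> continuous g ->
    pi (fun t => f t * g t) x = pi f (pi g x) ;
  frep_star : forall (f : X -> R[i]^o) x y, continuous f ->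
    dot (pi (fun t => (f t)^*) x) y = dot x (pi f y)
}.

Section FunctionRep.
Variables (R : realType) (X : topologicalType) (H : hilbertType R).
Variables (pi : (X -> R[i]^o) -> H -> H) (fr : function_rep pi).
Implicit Types (f g h : X -> R[i]^o).

Lemma frepDv f x y : continuous f -> pi f (x + y) = pi f x + pi f y.
Proof. by move=> cf; have := frep_linear fr cf 1 x y; rewrite !scale1r. Qed.

Lemma frep0v f : continuous f -> pi f 0 = 0.
Proof.
move=> cf; have /eqP := frepDv 0 0 cf.
by rewrite addr0 addrC -subr_eq subrr => /eqP.
Qed.

Lemma frep_cst (c : R[i]) x : pi (fun=> c) x = c *: x.
Proof.
pose one : X -> R[i]^o := fun=> 1.
have c1 : continuous one by exact: continuous_constC.
have -> : (fun=> c) = (fun t : X => (c - 1) * one t + one t : R[i]^o).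
  by apply/funext => t; rewrite mulr1 subrK.
by rewrite (frep_DZ fr _ _ c1 c1) (frep_1 fr) scalerBl scale1r subrK.
Qed.

Lemma frep_nrm_sqr f x : continuous f ->
  (nrm (pi f x) ^+ 2)%:C = dot (pi (fun t => (f t)^* * f t) x) x.
Proof.
move=> cf; rewrite (frep_M fr _ (continuous_conj cf) cf).
by rewrite (frep_star fr _ _ cf) dot_nrm.
Qed.

(** Pointwise identities between squared moduli become identities between
    norms; this replaces functional calculus. *)
Lemma frep_pythagoras f g h x :
  continuous f -> continuous g -> continuous h ->
  (forall t, cabs (f t) ^+ 2 = cabs (g t) ^+ 2 + cabs (h t) ^+ 2) ->
  nrm (pi f x) ^+ 2 = nrm (pi g x) ^+ 2 + nrm (pi h x) ^+ 2.
Proof.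
move=> cf cg ch fgh; apply: complexI; rewrite rmorphD/=.
rewrite (frep_nrm_sqr x cf) (frep_nrm_sqr x cg) (frep_nrm_sqr x ch).
have -> : (fun t => (f t)^* * f t) =
  (fun t => 1 * ((g t)^* * g t) + (h t)^* * h t : R[i]^o).
  apply/funext => t; rewrite mul1r ![_^* * _]mulrC -!cabs_sqr fgh.
  by rewrite rmorphD.
rewrite (frep_DZ fr 1 x (continuousMC (continuous_conj cg) cg)
  (continuousMC (continuous_conj ch) ch)).
by rewrite scale1r dotDl.
Qed.

(** M^2 - |f|^2 is the square of a continuous function when |f| <= M. *)
Lemma frep_bound f (M : R) x : continuous f -> 0 <= M ->
  (forall t, cabs (f t) <= M) -> nrm (pi f x) <= M * nrm x.
Proof.
move=> cf M0 fM.
pose k t : R := Num.sqrt (M ^+ 2 - cabs (f t) ^+ 2).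
have ck : continuous k.
  have cn := continuous_nrm cf.
  have -> : k = fun t => Num.sqrt (M ^+ 2 + -1 * (cabs (f t) * cabs (f t))).
    by apply/funext => t; rewrite mulN1r.
  exact: (continuous_sqrtr (continuousDr (@continuous_constr R X (M ^+ 2))
    (continuousMr (@continuous_constr R X (-1)) (continuousMr cn cn)))).
have fk t : cabs M%:C ^+ 2 = cabs (f t) ^+ 2 + cabs (k t)%:C ^+ 2.
  rewrite !cabs_real (ger0_norm M0) ger0_norm ?sqrtr_ge0//.
  rewrite sqr_sqrtr; first by rewrite addrC subrK.
  by rewrite subr_ge0 ler_pXn2r// nnegrE nrm_ge0.
have := frep_pythagoras x (@continuous_constC _ _ M%:C) cf
  (continuous_realC ck) fk.
rewrite frep_cst nrmZ cabs_real ger0_norm// => E.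
have : nrm (pi f x) ^+ 2 <= (M * nrm x) ^+ 2.
  by rewrite E lerDl sqr_ge0.
by rewrite ler_pXn2r// nnegrE ?mulr_ge0 ?nrm_ge0.
Qed.

(** For v = (|f| - m')^+, the function |f v|^2 dominates m'^2 v^2, whereas
    pi(f) multiplies norms by at most m < m'; so pi(v) has to vanish. *)
Lemma frep_cut_eq0 f (m m' : R) x : continuous f -> 0 <= m -> m < m' ->
  (forall y, nrm (pi f y) <= m * nrm y) ->
  pi (fun t => (Num.max (cabs (f t) - m') 0)%:C) x = 0.
Proof.
move=> cf m0 mm' fm.
pose v t : R := Num.max (cabs (f t) - m') 0.
pose e t : R := Num.sqrt (Num.max (cabs (f t) ^+ 2 - m' ^+ 2) 0) * v t.
have cn := @continuous_nrm R X _ _ cf.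
have cv : continuous v.
  exact: (continuous_maxr (c := 0) (continuousDr cn (@continuous_constr R X (- m')))).
have ce : continuous e.
  exact: (continuousMr (continuous_sqrtr (continuous_maxr (c := 0)
    (continuousDr (continuousMr cn cn) (@continuous_constr R X (- m' ^+ 2))))) cv).
pose V := (fun t => (v t)%:C : R[i]^o).
have cV : continuous V := continuous_realC cv.
rewrite -[LHS]/(pi V x).
have m'0 : 0 <= m' by lra.
have fve t : cabs (f t * V t) ^+ 2 = cabs (m'%:C * V t) ^+ 2 + cabs (e t)%:C ^+ 2.
  rewrite !cabsM /V !cabs_real (ger0_norm m'0).
  rewrite !exprMn !real_normK ?num_real// /e /v exprMn sqr_sqrtr; last first.
    by rewrite le_max lexx orbT.
  case: (leP (cabs (f t) - m') 0) => h; first by rewrite !expr0n/= !mulr0 addr0.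
  rewrite max_l ?subr_ge0; first by ring.
  by rewrite ler_pXn2r ?nnegrE ?nrm_ge0//; lra.
have := frep_pythagoras x (continuousMC cf cV)
  (continuousMC (@continuous_constC _ _ m'%:C) cV) (continuous_realC ce) fve.
rewrite (frep_M fr _ cf cV) (frep_M fr _ (@continuous_constC _ _ _) cV).
rewrite frep_cst nrmZ cabs_real (ger0_norm m'0).
move=> E; have := fm (pi V x); move: E.
set a := nrm (pi f _); set b := nrm (pi V x); set c := nrm _ => E ab.
have [a0 b0] : 0 <= a /\ 0 <= b by rewrite !nrm_ge0.
apply: nrm_eq0; rewrite -/b; apply/eqP; rewrite eq_le b0 andbT leNgt.
apply/negP => b1; have : m * b < m' * b by rewrite ltr_pM2r.
have := sqr_ge0 c; have : a ^+ 2 <= (m * b) ^+ 2.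
  by rewrite ler_pXn2r ?nnegrE// mulr_ge0.
have := mulr_ge0 m0 b0; nra.
Qed.

End FunctionRep.

Lemma compact_bounded (R : realType) (X : topologicalType) (f : X -> R[i]^o) :
  compact [set: X] -> continuous f ->
  exists2 M : R, 0 <= M & forall x, cabs (f x) <= M.
Proof.
move=> cX cf; have [/set0P X0|/set0P/negP/negPn/eqP X0] := pselect ([set: X] !=set0).
  have [||c _ cmax] := @compact_EVT_max X R (fun x => cabs (f x)) [set: X] _ cX.
  - exact/set0P.
  - by apply: continuous_subspaceT; exact: continuous_nrm.
  exists (cabs (f c)); first exact: nrm_ge0.
  by move=> x; apply: cmax; rewrite inE.
exists 0 => // x; have : [set: X] x by [].
by rewrite X0.
Qed.

Lemma compact_finite_cover (T : topologicalType) (K : set T) (U : T -> set T) :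
  compact K -> (forall x, K x -> nbhs x (U x)) ->
  exists2 s : seq T, {in s, forall x, K x} &
    forall t, K t -> exists2 x, x \in s & U x t.
Proof.
move=> /compact_near_coveringP cK KU.
pose F : set_system (seq T) :=
  filter_from setT (fun s : seq T => [set s' : seq T | {subset s <= s'}]).
have FF : Filter F.
  apply: filter_fromT_filter; first by exists [::].
  move=> s1 s2; exists (s1 ++ s2) => s' /= sub.
  by split=> x xs; apply: sub; rewrite mem_cat xs ?orbT.
have [|s _ sP] := cK _ F (fun (s : seq T) t => exists2 x, x \in s /\ K x & U x t) FF.
  move=> x Kx; exists (U x, [set s : seq T | x \in s]).
    split=> /=; first exact: KU.
    by exists [:: x] => // s; apply; rewrite mem_head.
  by move=> [t s] /= [Uxt xs]; exists x.
have {}sP := sP s (fun=> id).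
exists [seq x <- s | `[< K x >]].
  by move=> x; rewrite mem_filter => /andP[/asboolP].
move=> t /sP[x [xs Kx] Uxt]; exists x => //.
by rewrite mem_filter xs andbT; apply/asboolP.
Qed.

Section FunctionIdeal.
Variables (R : realType) (X : topologicalType) (cX : compact [set: X]).
Variable N : set (X -> R[i]^o).
Implicit Types (f g : X -> R[i]^o).
Hypothesis N_continuous : forall f, N f -> continuous f.
Hypothesis N0 : N (fun=> 0).
Hypothesis ND : forall f g, N f -> N g -> N (fun t => f t + g t).
Hypothesis NM : forall f g : X -> R[i]^o, continuous f -> N g -> N (fun t => f t * g t).

Definition zero_set : set X := [set x | forall f, N f -> f x = 0].

Lemma ideal_sum (I : Type) (s : seq I) (F : I -> X -> R[i]^o) :
  (forall t, N (F t)) -> N (fun x => \sum_(t <- s) F t x).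
Proof.
move=> NF; elim: s => [|a s ih].
  by have -> : (fun x => \sum_(t <- [::]) F t x) = (fun=> 0)
    by apply/funext => x; rewrite big_nil.
have -> : (fun x => \sum_(t <- a :: s) F t x) =
  (fun x => F a x + \sum_(t <- s) F t x) by apply/funext => x; rewrite big_cons.
exact: ND.
Qed.

(** On the compact set where |f| >= e + d, some finite sum of |g|^2 with [g] in
    the ideal is bounded below by a constant c > 0; multiplying [f] by the
    quotient of this sum by its maximum with c gives [f1]. *)
Lemma ideal_approx f (e d : R) : continuous f -> 0 <= e -> 0 < d ->
  (forall x, zero_set x -> cabs (f x) <= e) ->
  exists2 f1, N f1 & forall x, cabs (f x - f1 x) <= e + d.
Proof.
move=> cf e0 d0 fe; pose K := [set x | e + d <= cabs (f x)].
have cn := @continuous_nrm R X _ _ cf.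
have cK : compact K.
  apply: (subclosed_compact _ cX) => //.
  by apply: (@preimage_closed _ _ (fun t => cabs (f t)) [set r | e + d <= r]);
    [move=> x _; exact: cn|exact: closed_ge].
have [K0|/set0P/negP/negPn/eqP K0] := pselect (K !=set0); last first.
  exists (fun=> 0) => // x; rewrite subr0 leNgt; apply/negP => /ltW Kx.
  by have : K x by []; rewrite K0.
have exg x : exists g, N g /\ (K x -> g x <> 0).
  have [Kx|nKx] := pselect (K x); last by exists (fun=> 0); split.
  have /existsNP[g /not_implyP[Ng gx]] : ~ zero_set x.
    move=> /fe; rewrite leNgt => /negP; apply.
    by rewrite (lt_le_trans _ Kx)// ltrDl.
  by exists g.
have [g gP] := choice exg.
have Ng x : N (g x) by case: (gP x).
have cg x : continuous (g x) := N_continuous (Ng x).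
have cng x : continuous (fun t => cabs (g x t)) := @continuous_nrm R X _ _ (cg x).
have [||D _ Dcov] := @compact_finite_cover _ K (fun x => [set t | 0 < cabs (g x t)]).
- exact: cK.
- move=> x Kx; apply: open_nbhs_nbhs; split => /=.
    apply: (@open_comp _ _ (fun t => cabs (g x t)) [set r | 0 < r]).
      by move=> t _; exact: cng.
    exact: open_gt.
  rewrite lt_neqAle nrm_ge0 andbT eq_sym.
  by apply/negP => /eqP/nrm_eq0; case: (gP x) => _; exact.
pose r t : R := \sum_(x <- D) cabs (g x t) ^+ 2.
have cr : continuous r.
  rewrite /r; elim: (D) => [|a s ih].
    have -> : (fun t => \sum_(x <- [::]) cabs (g x t) ^+ 2) = (fun=> 0).
      by apply/funext => t; rewrite big_nil.
    exact: (@continuous_constr R X).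
  have -> : (fun t => \sum_(x <- a :: s) cabs (g x t) ^+ 2) =
    (fun t => cabs (g a t) ^+ 2 + \sum_(x <- s) cabs (g x t) ^+ 2).
    by apply/funext => t; rewrite big_cons.
  exact: (continuousDr (continuousMr (cng a) (cng a)) ih).
have r0 t : 0 <= r t by apply: sumr_ge0 => x _; exact: sqr_ge0.
have rK t : K t -> 0 < r t.
  move=> /Dcov[x xD /= gx]; rewrite /r (big_rem x)//=.
  rewrite ltr_pwDl ?exprn_gt0// sumr_ge0// => y _; exact: sqr_ge0.
have [x0 /[!inE] Kx0 rmin] : exists2 c, c \in K & forall t, t \in K -> r c <= r t.
  apply: compact_EVT_min => //.
  by apply: continuous_subspaceT => t; exact: cr.
pose c := r x0; have c0 : 0 < c := rK _ Kx0.
pose m t : R := Num.max (r t) c.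
have m0 t : 0 < m t by rewrite lt_max c0 orbT.
have cm : continuous m := continuous_maxr (c := c) cr.
pose w t : R[i]^o := f t * ((m t)^-1)%:C.
have cw : continuous w.
  apply: (continuousMC cf); apply: continuous_realC => t.
  by apply: cvgV; [rewrite gt_eqF|exact: cm].
exists (fun t => w t * \sum_(x <- D) (g x t)^* * g x t).
  apply: (NM cw); apply: ideal_sum => x.
  exact: (NM (continuous_conj (cg x)) (Ng x)).
move=> t; have -> : \sum_(x <- D) (g x t)^* * g x t = (r t)%:C.
  by rewrite rmorph_sum; apply: eq_bigr => x _; rewrite /= cabs_sqr mulrC.
have -> : f t - w t * (r t)%:C = f t * (1 - (m t)^-1 * r t)%:C.
  by rewrite rmorphB rmorph1 rmorphM mulrBr mulr1 mulrA.
have mr : (m t)^-1 * r t <= 1 by rewrite mulrC ler_pdivrMr// mul1r le_max lexx.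
have mr0 : 0 <= (m t)^-1 * r t by rewrite mulr_ge0// invr_ge0 ltW.
rewrite cabsM cabs_real ger0_norm ?subr_ge0//.
have [Kt|/negP] := boolP (e + d <= cabs (f t)).
  have rc : c <= r t by apply: rmin; rewrite inE.
  by rewrite /m max_l// mulVf ?gt_eqF ?rK// subrr mulr0 addr_ge0// ltW.
move=> /negP; rewrite -ltNge => /ltW ft.
by rewrite (le_trans _ ft)// ler_piMr ?nrm_ge0// gerBl.
Qed.

End FunctionIdeal.

(** * Two Hilbert spaces: the complex line and square-summable families *)

Lemma cauchy_nrmP (R : realType) (V : normedModType R[i]) (F : set_system V) :
  ProperFilter F ->
  cauchy F <-> forall e : R, 0 < e -> exists x, F [set y | nrm (x - y) < e].
Proof.
move=> FF; rewrite cauchyP; split=> [cF e e0|cF e e0].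
  have [|x Fx] := cF e%:C; first by rewrite ltcR.
  exists x; apply: filterS Fx => y; rewrite -ball_normE/= nrm_lt; exact.
have e0' : 0 < complex.Re e by rewrite -ltcR RRe_real ?gtr0_real.
have [x Fx] := cF _ e0'; exists x; apply: filterS Fx => y /= xy.
by rewrite -ball_normE/= nrmE -[e]RRe_real ?gtr0_real// ltcR.
Qed.

Section ComplexLine.
Variable R : realType.

(** The one-dimensional Hilbert space, under a name of its own so that its
    structures do not compete with those of the regular module of a real field. *)
Definition cline : Type := R[i]^o.

HB.instance Definition _ := NormedModule.on cline.

Lemma cline_complete (F : set_system cline) : ProperFilter F -> cauchy F -> cvg F.
Proof.
move=> FF /cauchy_nrmP cF.
have part (p : cline -> R) : (forall x y, `|p x - p y| <= nrm (x - y)) -> cvg (p @ F).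
  move=> plip; apply: cauchy_cvg; apply/cauchyP => e e0.
  have [x Fx] := cF e e0; exists (p x).
  change (F (p @^-1` ball (p x) e)); apply: filterS Fx => y /= xy.
  by rewrite -ball_normE; exact: le_lt_trans (plip _ _) xy.
have /part/cvg_ex[a Fa] : forall x y : cline, `|complex.Re x - complex.Re y| <= nrm (x - y).
  move=> x y; rewrite -raddfB ler_norml; apply/andP; split.
    by rewrite lerNl -raddfN opprB nrmBC; exact: Re_le_cabs.
  exact: Re_le_cabs.
have /part/cvg_ex[b Fb] : forall x y : cline, `|complex.Im x - complex.Im y| <= nrm (x - y).
  by move=> x y; rewrite -raddfB; exact: Im_le_cabs.
apply/cvg_ex; exists (a +i* b) => P /nbhs_nrm[e e0 eP].
have e2 : 0 < e / 2 by rewrite divr_gt0.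
move/cvgrPdist_lt/(_ _ e2): Fa => Fa; move/cvgrPdist_lt/(_ _ e2): Fb => Fb.
apply: filterS2 Fa Fb => y ya yb; apply: eP.
apply: le_lt_trans (cabs_le_ReIm _) _.
by case: y ya yb => c d /= ya yb; lra.
Qed.

HB.instance Definition _ := Uniform_isComplete.Build cline cline_complete.

Definition cline_dot (x y : cline) : R[i] := (x : R[i]) * (y : R[i])^*.

Lemma cline_dotDZl (k : R[i]) (x y z : cline) :
  cline_dot (k *: x + y) z = k * cline_dot x z + cline_dot y z.
Proof. by rewrite /cline_dot mulrDl mulrA. Qed.

Lemma cline_dotC (x y : cline) : cline_dot y x = (cline_dot x y)^*.
Proof. by rewrite /cline_dot rmorphM/= conjCK mulrC. Qed.

Lemma cline_dotxx (x : cline) : cline_dot x x = `|x| ^+ 2.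
Proof. by rewrite /cline_dot -normCK. Qed.

HB.instance Definition _ := NormedModule_isHilbert.Build R cline
  cline_dotDZl cline_dotC cline_dotxx.

End ComplexLine.

Section SquareSummable.
Variables (R : realType) (I : choiceType) (H : hilbertType R).
Implicit Types (phi psi : I -> H) (S T : seq I).

Definition sumsq phi S : R := \sum_(s <- S) nrm (phi s) ^+ 2.

(** Finite sets of coordinates are duplicate-free sequences. *)
Definition square_summable phi : Prop :=
  exists M, forall S, uniq S -> sumsq phi S <= M.

Lemma sumsq_ge0 phi S : 0 <= sumsq phi S.
Proof. by apply: sumr_ge0 => s _; exact: sqr_ge0. Qed.

Lemma big_uniq_sub (V : zmodType) (F : I -> V) S T :
  uniq S -> uniq T -> {subset S <= T} ->
  \sum_(s <- T) F s = \sum_(s <- S) F s + \sum_(s <- T | s \notin S) F s.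
Proof.
move=> uS uT ST; rewrite (bigID (mem S))/=; congr (_ + _).
rewrite -big_filter; apply: perm_big; apply: uniq_perm => //.
  exact: filter_uniq.
by move=> s; rewrite mem_filter andb_idr//; exact: ST.
Qed.

Lemma sumsq_split phi S T : uniq S -> uniq T -> {subset S <= T} ->
  sumsq phi T = sumsq phi S + sumsq phi [seq s <- T | s \notin S].
Proof. by move=> uS uT ST; rewrite /sumsq (big_uniq_sub _ uS uT ST) big_filter. Qed.

Lemma sumsq_mono phi S T : uniq S -> uniq T -> {subset S <= T} ->
  sumsq phi S <= sumsq phi T.
Proof. by move=> uS uT /(sumsq_split phi uS uT)->; rewrite lerDl sumsq_ge0. Qed.

Lemma ler_sumsq phi psi S : {in S, forall s, nrm (phi s) <= nrm (psi s)} ->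
  sumsq phi S <= sumsq psi S.
Proof.
move=> h; rewrite /sumsq big_seq [leRHS]big_seq; apply: ler_sum => s /h.
by rewrite ler_pXn2r ?nnegrE ?nrm_ge0.
Qed.

(** A triangle inequality between squares, with a free weight, so that it can be
    summed over the coordinates. *)
Lemma nrmD_sqr (x y : H) (l : R) : 0 < l ->
  nrm (x + y) ^+ 2 <= (1 + l) * nrm x ^+ 2 + (1 + l^-1) * nrm y ^+ 2.
Proof.
move=> l0; have := nrmD x y; have := nrm_ge0 (x + y).
move: (nrm _) (nrm x) (nrm y) => c a b c0 cab.
have : c ^+ 2 <= (a + b) ^+ 2 by rewrite ler_pXn2r// nnegrE//; lra.
move/le_trans; apply; rewrite -subr_ge0.
have -> : (1 + l) * a ^+ 2 + (1 + l^-1) * b ^+ 2 - (a + b) ^+ 2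
    = l^-1 * (l * a - b) ^+ 2.
  by field; rewrite gt_eqF.
by rewrite mulr_ge0 ?sqr_ge0// invr_ge0 ltW.
Qed.

Lemma sumsqD phi psi S (l : R) : 0 < l ->
  sumsq (phi + psi) S <= (1 + l) * sumsq phi S + (1 + l^-1) * sumsq psi S.
Proof.
move=> l0; rewrite /sumsq !mulr_sumr -big_split/=; apply: ler_sum => s _.
exact: nrmD_sqr.
Qed.

Lemma sumsqZ (k : R[i]) phi S : sumsq (k *: phi) S = cabs k ^+ 2 * sumsq phi S.
Proof. by rewrite /sumsq mulr_sumr; apply: eq_bigr => s _; rewrite nrmZ exprMn. Qed.

Definition l2_pred : {pred I -> H} := fun phi => `[< square_summable phi >].

Lemma l2_pred_submod : submod_closed l2_pred.
Proof.
split=> [|k phi psi /asboolP[M phiM] /asboolP[N psiN]].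
  by apply/asboolP; exists 0 => S _; rewrite /sumsq big1// => s _; rewrite nrm0 expr0n.
apply/asboolP; exists (2 * (cabs k ^+ 2 * M) + 2 * N) => S uS.
have := @sumsqD (k *: phi) psi S _ ltr01; rewrite sumsqZ invr1.
move/le_trans; apply; apply: lerD; rewrite ler_wpM2l ?psiN//.
by rewrite ler_wpM2l ?sqr_ge0 ?phiM.
Qed.

HB.instance Definition _ :=
  GRing.isSubmodClosed.Build R[i] (I -> H) l2_pred l2_pred_submod.

Record l2 : Type := L2 { l2_fun :> I -> H ; l2P : l2_fun \in l2_pred }.

HB.instance Definition _ := [isSub for l2_fun].
HB.instance Definition _ := gen_eqMixin l2.
HB.instance Definition _ := gen_choiceMixin l2.
HB.instance Definition _ := [SubChoice_isSubLmodule of l2 by <:].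

Implicit Types (x y z : l2).

Lemma l2D x y s : (x + y) s = x s + y s. Proof. by []. Qed.
Lemma l2Z (k : R[i]) x s : (k *: x) s = k *: x s. Proof. by []. Qed.
Lemma l2N x s : (- x) s = - x s. Proof. by []. Qed.
Lemma l20 s : (0 : l2) s = 0. Proof. by []. Qed.

Lemma l2_ext x y : (forall s, x s = y s) -> x = y.
Proof. by move=> xy; apply/val_inj/funext. Qed.

Definition l2norm x : R :=
  Num.sqrt (sup [set sumsq x S | S in [set S | uniq S]]).

Lemma has_sup_l2 x : has_sup [set sumsq x S | S in [set S | uniq S]].
Proof.
split; first by exists (sumsq x [::]), [::].
have /asboolP[M xM] := l2P x.
by exists M => _ [S uS <-]; exact: xM.
Qed.

Lemma l2norm_ge0 x : 0 <= l2norm x. Proof. exact: sqrtr_ge0. Qed.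

Lemma l2norm_sqr x :
  l2norm x ^+ 2 = sup [set sumsq x S | S in [set S | uniq S]].
Proof.
rewrite sqr_sqrtr//; apply: (le_trans (sumsq_ge0 x [::])).
by apply: (ub_le_sup (proj2 (has_sup_l2 x))); exists [::].
Qed.

Lemma sumsq_le x S : uniq S -> sumsq x S <= l2norm x ^+ 2.
Proof.
move=> uS; rewrite l2norm_sqr; apply: (ub_le_sup (proj2 (has_sup_l2 x))).
by exists S.
Qed.

Lemma l2norm_le x (M : R) : 0 <= M ->
  (forall S, uniq S -> sumsq x S <= M ^+ 2) -> l2norm x <= M.
Proof.
move=> M0 xM; rewrite -(@ler_pXn2r _ 2)// ?nnegrE ?l2norm_ge0// l2norm_sqr.
by apply: ge_sup; [case: (has_sup_l2 x)|move=> _ [S uS <-]; exact: xM].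
Qed.

Lemma l2norm_approx x (e : R) : 0 < e ->
  exists2 S, uniq S & l2norm x ^+ 2 - e < sumsq x S.
Proof.
move=> e0; have [_ [S uS <-]] := sup_adherent e0 (has_sup_l2 x).
by rewrite -l2norm_sqr; exists S.
Qed.

Lemma l2norm0_eq0 x : l2norm x = 0 -> x = 0.
Proof.
move=> x0; apply: l2_ext => s; apply: nrm_eq0; apply/eqP.
have := @sumsq_le x [:: s] isT; rewrite x0 /sumsq big_seq1 expr0n/=.
by move=> le0; rewrite -sqrf_eq0 eq_le le0 sqr_ge0.
Qed.

Lemma ler_l2normD x y : l2norm (x + y) <= l2norm x + l2norm y.
Proof.
apply/ler_addgt0Pr => e e0.
set a := l2norm x + e / 2; set b := l2norm y + e / 2.
have e2 : 0 < e / 2 by rewrite divr_gt0.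
have a0 : 0 < a by rewrite ltr_wpDl// l2norm_ge0.
have b0 : 0 < b by rewrite ltr_wpDl// l2norm_ge0.
have -> : l2norm x + l2norm y + e = a + b by rewrite /a /b; lra.
apply: l2norm_le => [|S uS]; first by rewrite addr_ge0// ltW.
have ba : 0 < b / a by rewrite divr_gt0.
apply: (le_trans (sumsqD x y S ba)).
have -> : (a + b) ^+ 2 = (1 + b / a) * a ^+ 2 + (1 + (b / a)^-1) * b ^+ 2.
  by field; rewrite !gt_eqF.
have le_sq z c : 0 < c -> sumsq z S <= (l2norm z + c) ^+ 2.
  move=> c0; rewrite (le_trans (sumsq_le z uS))//.
  by rewrite ler_pXn2r ?nnegrE ?l2norm_ge0 ?lerDl ?addr_ge0 ?l2norm_ge0 ?(ltW c0).
by apply: lerD; rewrite ler_wpM2l ?le_sq// addr_ge0// ?invr_ge0 ltW.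
Qed.

Lemma l2normZ (k : R[i]) x : l2norm (k *: x) = cabs k * l2norm x.
Proof.
have le l y : l2norm (l *: y) <= cabs l * l2norm y.
  apply: l2norm_le => [|S uS]; first by rewrite mulr_ge0 ?nrm_ge0 ?l2norm_ge0.
  by rewrite sumsqZ exprMn ler_wpM2l ?sqr_ge0// sumsq_le.
apply/eqP; rewrite eq_le le/=; have [->|k0] := eqVneq k 0.
  by rewrite nrm0 mul0r l2norm_ge0.
have := le k^-1 (k *: x); rewrite scalerA mulVf// scale1r.
have kp : 0 < cabs k.
  rewrite lt_neqAle nrm_ge0 andbT eq_sym; apply: contra_neq k0.
  by move=> /nrm_eq0.
have : cabs k * cabs k^-1 = 1 by rewrite -cabsM divff// cabs1.
move=> kk; rewrite -(ler_pM2l kp) mulrA kk mul1r; exact.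
Qed.

Let l2normC x : R[i] := (l2norm x)%:C.

Let l2normC_D x y : l2normC (x + y) <= l2normC x + l2normC y.
Proof. by rewrite -rmorphD lecR ler_l2normD. Qed.

Let l2normC_Z (k : R[i]) x : l2normC (k *: x) = `|k| * l2normC x.
Proof. by rewrite /l2normC l2normZ rmorphM/= -(nrmE (k : R[i]^o)). Qed.

Let l2normC_eq0 x : l2normC x = 0 -> x = 0.
Proof. by move=> /complexI/l2norm0_eq0. Qed.

HB.instance Definition _ :=
  Lmodule_isNormed.Build R[i] l2 l2normC_D l2normC_Z l2normC_eq0.

Lemma nrm_l2E x : nrm x = l2norm x. Proof. by []. Qed.

Lemma nrm_coord x s : nrm (x s) <= nrm x.
Proof.
rewrite -(@ler_pXn2r _ 2)// ?nnegrE ?nrm_ge0//.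
by have := @sumsq_le x [:: s] isT; rewrite /sumsq big_seq1.
Qed.

(** The limit is taken coordinatewise; on a finite set of coordinates it is
    within 2 e of every approximate limit at scale e. *)
Lemma l2_complete (F : set_system l2) : ProperFilter F -> cauchy F -> cvg F.
Proof.
move=> FF /cauchy_nrmP cF.
have /choice[L FL] s : exists l : H, (fun x : l2 => x s) @ F --> l.
  apply/cvg_ex; apply: cauchy_cvg; apply/cauchy_nrmP => e e0.
  have [x Fx] := cF e e0.
  exists (x s).
  change (F ((fun x : l2 => x s) @^-1` [set z | nrm (x s - z) < e])).
  apply: filterS Fx => y /=; apply: le_lt_trans.
  by rewrite -[x s - y s]/((x - y) s) nrm_coord.
have near_L (e : R) x : 0 < e -> F [set y | nrm (x - y) < e] ->
    forall S, uniq S -> sumsq ((x : I -> H) - L) S <= (2 * e) ^+ 2.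
  move=> e0 Fx S uS; pose n := (size S)%:R : R.
  have n0 : 0 <= n by rewrite ler0n.
  pose d := e / (n + 1); have d0 : 0 < d by rewrite divr_gt0// ltr_wpDl.
  have FS T : F [set y | {in T, forall s, nrm (L s - y s) < d}].
    elim: T => [|s T ih]; first by apply: filterS filterT => y.
    have Fs : F [set y | nrm (L s - y s) < d].
      by apply: (FL s [set z | nrm (L s - z) < d]); apply/nbhs_nrm; exists d.
    apply: filterS2 Fs ih => y ys yT t.
    by rewrite inE => /orP[/eqP->//|/yT].
  have [y [/= xy yS]] := filter_ex (filterI Fx (FS S)).
  have -> : (x : I -> H) - L = ((x - y : l2) : I -> H) + ((y : I -> H) - L).
    by apply/funext => s /=; rewrite /GRing.add/= addrA subrK.
  apply: (le_trans (sumsqD _ _ _ ltr01)); rewrite invr1.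
  have h1 : sumsq (x - y) S <= e ^+ 2.
    apply: (le_trans (sumsq_le _ uS)).
    by rewrite ler_pXn2r ?nnegrE ?l2norm_ge0 ?(ltW e0) ?(ltW xy).
  have h2 : sumsq ((y : I -> H) - L) S <= e ^+ 2.
    apply: (@le_trans _ _ (\sum_(s <- S) d ^+ 2)).
      rewrite /sumsq big_seq [leRHS]big_seq; apply: ler_sum => s /yS /ltW.
      by rewrite nrmBC => ?; rewrite ler_pXn2r ?nnegrE ?nrm_ge0 ?(ltW d0).
    rewrite big_const_seq count_predT iter_addr_0 -mulr_natl -/n.
    have dn : d * (n + 1) = e by rewrite /d divfK// gt_eqF// ltr_wpDl.
    rewrite -dn; nra.
  nra.
have LS : L \in l2_pred.
  have [x Fx] := cF 1 ltr01.
  have -> : L = (x : I -> H) - ((x : I -> H) - L).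
    by apply/funext => s /=; rewrite /GRing.add/= /GRing.opp/= opprB addrC subrK.
  apply: rpredB; first exact: l2P.
  by apply/asboolP; exists ((2 * 1) ^+ 2); exact: near_L.
have [l lE] : exists l : l2, (l : I -> H) = L by exists (L2 LS).
apply/cvg_ex; exists l => P /nbhs_nrm[e e0 eP].
have e4 : 0 < e / 4 by rewrite divr_gt0.
have [x Fx] := cF _ e4; apply: filterS (Fx) => y /= xy; apply: eP.
have xl : nrm (x - l) <= 2 * (e / 4).
  apply: l2norm_le; first by rewrite mulr_ge0// ltW.
  move=> S uS; have := near_L _ _ e4 Fx _ uS.
  by rewrite -lE.
have -> : e = 2 * (e / 4) + e / 4 + e / 4 by field.
apply: (le_lt_trans (nrmB_trans x l y)); rewrite nrmBC -addrA.
by apply: ler_ltD => //; rewrite (lt_trans xy)// ltrDl.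
Qed.

HB.instance Definition _ := Uniform_isComplete.Build l2 l2_complete.

Definition partial_dot x y S : R[i] := \sum_(s <- S) dot (x s) (y s).

(** Unconditional convergence of the inner product, along finite sets of
    coordinates ordered by inclusion. *)
Definition dot_limit x y (l : R[i]) : Prop :=
  forall e : R, 0 < e -> exists S0, forall S, uniq S -> {subset S0 <= S} ->
    cabs (l - partial_dot x y S) <= e.

Lemma dot_limit_unique x y l l' : dot_limit x y l -> dot_limit x y l' -> l = l'.
Proof.
move=> lx l'x; apply/subr0_eq; apply: (@nrm_le_eps _ R[i]^o) => e e0.
have e2 : 0 < e / 2 by rewrite divr_gt0.
have [S0 h0] := lx _ e2; have [S1 h1] := l'x _ e2.
pose S := undup (S0 ++ S1).
have uS : uniq S by exact: undup_uniq.
have := h0 S uS; have := h1 S uS.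
move=> /(_ _)/wrap[|k1 /(_ _)/wrap[|k0]].
- by move=> s sS; rewrite mem_undup mem_cat sS orbT.
- by move=> s sS; rewrite mem_undup mem_cat sS.
have := @nrmB_trans _ R[i]^o (partial_dot x y S) l l'.
rewrite (@nrmBC _ R[i]^o (partial_dot x y S)).
move: k1 k0; move: (nrm _) (nrm _) (nrm _) => a b c; lra.
Qed.

Definition l2_dot x y : R[i] :=
  4^-1 * ((nrm (x + y) ^+ 2)%:C - (nrm (x - y) ^+ 2)%:C
    + 'i * (nrm (x + 'i *: y) ^+ 2)%:C - 'i * (nrm (x - 'i *: y) ^+ 2)%:C).

Lemma hilbert_polarization (a b : H) :
  dot a b = 4^-1 * ((nrm (a + b) ^+ 2)%:C - (nrm (a - b) ^+ 2)%:C
    + 'i * (nrm (a + 'i *: b) ^+ 2)%:C - 'i * (nrm (a - 'i *: b) ^+ 2)%:C).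
Proof.
rewrite -!dot_nrm !(dotDl, dotDr, dotNl, dotNr, dotZl, dotZr) conjCi.
have i2 : 'i * 'i = -1 :> R[i] by rewrite -expr2 sqrCi.
have n4 : (4 : R[i]) != 0 by rewrite pnatr_eq0.
apply: (mulfI n4); rewrite mulVKf//; ring: i2.
Qed.

Lemma nrm_sqr_limit x (e : R) : 0 < e ->
  exists S0, forall S, uniq S -> {subset S0 <= S} ->
    cabs ((nrm x ^+ 2)%:C - (sumsq x S)%:C) <= e.
Proof.
move=> e0; have [S0 uS0 S0x] := l2norm_approx x e0; exists S0 => S uS S0S.
have := sumsq_mono x uS0 uS S0S; have := sumsq_le x uS.
rewrite -rmorphB cabs_real nrm_l2E => h1 h2.
rewrite ger0_norm; last by rewrite subr_ge0.
by rewrite lerBlDr -lerBlDl (le_trans (ltW S0x)).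
Qed.

Lemma l2_dot_limit x y : dot_limit x y (l2_dot x y).
Proof.
move=> e e0.
have [S1 h1] := nrm_sqr_limit (x + y) e0.
have [S2 h2] := nrm_sqr_limit (x - y) e0.
have [S3 h3] := nrm_sqr_limit (x + 'i *: y) e0.
have [S4 h4] := nrm_sqr_limit (x - 'i *: y) e0.
exists (S1 ++ S2 ++ S3 ++ S4) => S uS sub.
have sub1 : {subset S1 <= S} by move=> s sS; apply: sub; rewrite !mem_cat sS ?orbT.
have {}h1 := h1 S uS sub1.
have sub2 : {subset S2 <= S} by move=> s sS; apply: sub; rewrite !mem_cat sS ?orbT.
have {}h2 := h2 S uS sub2.
have sub3 : {subset S3 <= S} by move=> s sS; apply: sub; rewrite !mem_cat sS ?orbT.
have {}h3 := h3 S uS sub3.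
have sub4 : {subset S4 <= S} by move=> s sS; apply: sub; rewrite !mem_cat sS ?orbT.
have {}h4 := h4 S uS sub4.
have -> : partial_dot x y S = 4^-1 * ((sumsq (x + y) S)%:C - (sumsq (x - y) S)%:C
    + 'i * (sumsq (x + 'i *: y) S)%:C - 'i * (sumsq (x - 'i *: y) S)%:C).
  rewrite /sumsq !rmorph_sum !mulr_sumr -!sumrB -!big_split/= -sumrB mulr_sumr.
  by apply: eq_bigr => s _; exact: hilbert_polarization.
rewrite /l2_dot -mulrBr.
set a1 := (nrm (x + y) ^+ 2)%:C in h1 *; set b1 := (sumsq (x + y) S)%:C in h1 *.
set a2 := (nrm (x - y) ^+ 2)%:C in h2 *; set b2 := (sumsq (x - y) S)%:C in h2 *.
set a3 := (nrm (x + 'i *: y) ^+ 2)%:C in h3 *.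
set b3 := (sumsq (x + 'i *: y) S)%:C in h3 *.
set a4 := (nrm (x - 'i *: y) ^+ 2)%:C in h4 *.
set b4 := (sumsq (x - 'i *: y) S)%:C in h4 *.
clearbody a1 a2 a3 a4 b1 b2 b3 b4.
have -> : a1 - a2 + 'i * a3 - 'i * a4 - (b1 - b2 + 'i * b3 - 'i * b4) =
   (a1 - b1) + (b2 - a2) + 'i * (a3 - b3) + 'i * (b4 - a4) :> R[i] by ring.
have i1 : cabs ('i : R[i]) = 1 by rewrite /nrm normCi.
rewrite (@nrmBC _ R[i]^o a2) in h2; rewrite (@nrmBC _ R[i]^o a4) in h4.
have k3 : cabs ('i * (a3 - b3)) <= e by rewrite cabsM i1 mul1r.
have k4 : cabs ('i * (b4 - a4)) <= e by rewrite cabsM i1 mul1r.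
have := @nrmD _ R[i]^o (a1 - b1 + (b2 - a2) + 'i * (a3 - b3)) ('i * (b4 - a4)).
have := @nrmD _ R[i]^o (a1 - b1 + (b2 - a2)) ('i * (a3 - b3)).
have := @nrmD _ R[i]^o (a1 - b1) (b2 - a2).
have -> : (4^-1 : R[i]) = (4^-1)%:C by rewrite fmorphV rmorph_nat.
rewrite (cabsM (4^-1)%:C) cabs_real ger0_norm//; move: h1 h2 k3 k4.
do 7! move: (nrm _); move=> *; lra.
Qed.

Lemma l2_dotDZl (k : R[i]) x y z : l2_dot (k *: x + y) z = k * l2_dot x z + l2_dot y z.
Proof.
apply: (@dot_limit_unique (k *: x + y) z); first exact: l2_dot_limit.
move=> e e0.
have k0 : 0 < 2 * (cabs k + 1) by rewrite mulr_gt0// ltr_wpDl// nrm_ge0.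
have [S1 h1] := @l2_dot_limit x z (e / (2 * (cabs k + 1))) (divr_gt0 e0 k0).
have e2 : 0 < e / 2 by rewrite divr_gt0.
have [S2 h2] := @l2_dot_limit y z _ e2.
exists (S1 ++ S2) => S uS sub.
have sub1 : {subset S1 <= S} by move=> s sS; apply: sub; rewrite !mem_cat sS ?orbT.
have {}h1 := h1 S uS sub1.
have sub2 : {subset S2 <= S} by move=> s sS; apply: sub; rewrite !mem_cat sS ?orbT.
have {}h2 := h2 S uS sub2.
have -> : partial_dot (k *: x + y) z S = k * partial_dot x z S + partial_dot y z S.
  rewrite /partial_dot mulr_sumr -big_split/=; apply: eq_bigr => s _.
  by rewrite -dotDZl.
rewrite opprD addrACA -mulrBr (le_trans (@nrmD _ R[i]^o _ _))// cabsM.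
have -> : e = e / 2 + e / 2 by field.
apply: lerD => //; apply: (le_trans (ler_wpM2l (nrm_ge0 _) h1)).
have c1 : 0 < cabs k + 1 by rewrite ltr_wpDl// nrm_ge0.
have -> : cabs k * (e / (2 * (cabs k + 1))) = e / 2 * (cabs k / (cabs k + 1)).
  by field; rewrite gt_eqF.
by rewrite ler_piMr ?(ltW e2)// ler_pdivrMr// mul1r lerDl.
Qed.

Lemma l2_dotC x y : l2_dot y x = (l2_dot x y)^*.
Proof.
apply: (@dot_limit_unique y x); first exact: l2_dot_limit.
move=> e e0; have [S0 h] := @l2_dot_limit x y e e0.
exists S0 => S uS sub.
have -> : partial_dot y x S = (partial_dot x y S)^*.
  by rewrite /partial_dot rmorph_sum; apply: eq_bigr => s _; exact: dotC.
by rewrite -rmorphB cabs_conj h.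
Qed.

Lemma l2_dotxx x : l2_dot x x = `|x| ^+ 2.
Proof.
apply: (@dot_limit_unique x x); first exact: l2_dot_limit.
move=> e e0; have [S0 h] := nrm_sqr_limit x e0; exists S0 => S uS sub.
have -> : partial_dot x x S = (sumsq x S)%:C.
  by rewrite /sumsq rmorph_sum; apply: eq_bigr => s _; rewrite dot_nrm.
by rewrite nrmE -rmorphXn h.
Qed.

HB.instance Definition _ := NormedModule_isHilbert.Build R l2
  l2_dotDZl l2_dotC l2_dotxx.

End SquareSummable.

Lemma isometry_dot (R : realType) (H K : hilbertType R) (T : H -> K) :
  linear T -> (forall x, nrm (T x) = nrm x) ->
  forall x y, dot (T x) (T y) = dot x y.
Proof.
move=> linT isoT x y.
have e k : T x + k *: T y = T (x + k *: y) by rewrite addrC -linT addrC.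
have e1 : T x + T y = T (x + y) by have := e 1; rewrite !scale1r.
have e2 : T x - T y = T (x - y) by have := e (-1); rewrite !scaleN1r.
have e3 := e 'i.
have e4 : T x - 'i *: T y = T (x - 'i *: y) by have := e (- 'i); rewrite !scaleNr.
by rewrite !hilbert_polarization e1 e2 e3 e4 !isoT.
Qed.

Section SquareSummableTools.
Variables (R : realType) (I : choiceType) (H : hilbertType R).
Implicit Types (phi : I -> H) (x y : l2 I H) (S : seq I).

(** Total, with 0 as default value, so that operators can be defined by a formula
    on the coordinates before they are known to be bounded. *)
Definition l2_of phi : l2 I H :=
  if pselect (phi \in @l2_pred R I H) is left h then L2 h else 0.

Lemma l2_of_bounded phi (M : R) : 0 <= M ->
  (forall S, uniq S -> sumsq phi S <= M ^+ 2) ->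
  (forall s, l2_of phi s = phi s) /\ nrm (l2_of phi) <= M.
Proof.
move=> M0 phiM; have phi2 : phi \in @l2_pred R I H.
  by apply/asboolP; exists (M ^+ 2).
rewrite /l2_of; case: pselect => // h; split => //.
exact: l2norm_le.
Qed.

Lemma sumsq_le_nrm x S : uniq S -> sumsq x S <= nrm x ^+ 2.
Proof. exact: sumsq_le. Qed.

Definition delta (s : I) (v : H) : l2 I H :=
  l2_of (fun t => if t == s then v else 0).

Lemma delta_bounded s v :
  (forall t, delta s v t = if t == s then v else 0) /\ nrm (delta s v) <= nrm v.
Proof.
apply: l2_of_bounded => [|S uS]; first exact: nrm_ge0.
rewrite /sumsq; under eq_bigr do rewrite (fun_if (fun w : H => nrm w ^+ 2)) nrm0 expr0n/=.
rewrite -big_mkcond/= -big_filter.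
have : (size [seq t <- S | t == s] <= 1)%N.
  by rewrite size_filter count_uniq_mem//; case: (_ \in _).
have : all (pred1 s) [seq t <- S | t == s] by exact: filter_all.
case: [seq _ <- _ | _] => [|t [|//]] _ _; first by rewrite big_nil sqr_ge0.
by rewrite big_seq1.
Qed.

Lemma deltaE s v t : delta s v t = if t == s then v else 0.
Proof. exact: (delta_bounded s v).1. Qed.

Lemma dot_delta s v x : dot (delta s v) x = dot v (x s).
Proof.
apply: (@dot_limit_unique _ _ _ (delta s v) x); first exact: l2_dot_limit.
move=> e e0; exists [:: s] => S uS sub.
suff -> : partial_dot (delta s v) x S = dot v (x s) by rewrite subrr nrm0 ltW.
rewrite /partial_dot (bigD1_seq s)//=; last exact/sub/mem_head.
rewrite deltaE eqxx big1 ?addr0// => t /negPf ts.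
by rewrite deltaE ts dot0l.
Qed.

(** All but e^2 of the squared norm of [x] is carried by a finite set S, and [y]
    is dominated by what remains. *)
Lemma l2_tail x (e : R) : 0 < e -> exists2 S, uniq S & forall y,
  (forall s, s \in S -> y s = 0) -> (forall s, nrm (y s) <= nrm (x s)) ->
  nrm y <= e.
Proof.
move=> e0; have [|S uS Sx] := @l2norm_approx _ _ _ x (e ^+ 2).
  by rewrite exprn_gt0.
exists S => // y y0 yx; apply: l2norm_le => [|T uT]; first exact: ltW.
pose U := undup (S ++ T); have uU : uniq U by exact: undup_uniq.
have SU : {subset S <= U} by move=> s sS; rewrite mem_undup mem_cat sS.
have TU : {subset T <= U} by move=> s sT; rewrite mem_undup mem_cat sT orbT.
apply: (le_trans (sumsq_mono y uT uU TU)).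
have -> : sumsq y U = sumsq y [seq s <- U | s \notin S].
  rewrite (sumsq_split y uS uU SU) [X in X + _]big1_seq ?add0r// => s /= sS.
  by rewrite y0// nrm0 expr0n.
apply: (@le_trans _ _ (sumsq x [seq s <- U | s \notin S])).
  by apply: ler_sumsq => s _; exact: yx.
have := sumsq_le x uU; rewrite (sumsq_split x uS uU SU); lra.
Qed.

Lemma l2_expansion x (e : R) : 0 < e -> exists2 S, uniq S &
  nrm (x - \sum_(s <- S) delta s (x s)) <= e.
Proof.
move=> /(l2_tail x)[S uS tail]; exists S => //.
have sumE T t : uniq T ->
    (\sum_(s <- T) delta s (x s)) t = if t \in T then x t else 0.
  elim: T => [|s T ih] /=; first by rewrite big_nil.
  move=> /andP[sT uT]; rewrite big_cons l2D ih// deltaE inE.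
  by have [->|_] := eqVneq t s; rewrite ?(negPf sT) ?addr0 ?add0r.
apply: tail => s => [sS|]; rewrite l2D l2N sumE//; first by rewrite sS subrr.
by case: ifP => _; rewrite ?subrr ?subr0// nrm0 nrm_ge0.
Qed.

End SquareSummableTools.

(** * Formal finite sums and the integrated form of a covariant representation *)

Section FiniteSums.
Variables (R : realType) (G : zmodType) (X : topologicalType).
Variable act : G -> X -> X.
Hypothesis act_action : is_action act.
Hypothesis act_continuous : forall g, continuous (act g).

(** A list of pairs (f, g) stands for the element \sum f u_g of the
    convolution algebra; group elements may be repeated. *)
Definition fsum := seq ((X -> R[i]^o) * G).
Implicit Types (d : fsum) (f : X -> R[i]^o) (g : G).

Fixpoint fsum_continuous d : Prop :=
  if d is p :: d' then continuous p.1 /\ fsum_continuous d' else True.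

Lemma fsum_continuous_cat d d' :
  fsum_continuous d -> fsum_continuous d' -> fsum_continuous (d ++ d').
Proof. by elim: d => //= p d ih [cp /ih cd] /cd. Qed.

Lemma fsum_continuous_map d (F : (X -> R[i]^o) * G -> (X -> R[i]^o) * G) :
  (forall p, continuous p.1 -> continuous (F p).1) ->
  fsum_continuous d -> fsum_continuous (map F d).
Proof. by move=> cF; elim: d => //= p d ih [/cF cp /ih cd]. Qed.

Lemma fsum_continuous_nth d k :
  fsum_continuous d -> continuous (nth (fun=> 0, 0) d k).1.
Proof.
elim: d k => [|p d ih] [|k] //=; rewrite ?nth_nil//=.
- by move=> _; exact: continuous_constC.
- by move=> _; exact: continuous_constC.
- by case.
- by move=> [_ /ih].
Qed.

Definition fscale (k : R[i]) d : fsum := [seq (fun t => k * p.1 t, p.2) | p <- d].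

(** (f u_g) (f1 u_g1) = f (g f1) u_(g + g1). *)
Definition fmul1 (p : (X -> R[i]^o) * G) d : fsum :=
  [seq (fun t => p.1 t * translate act p.2 r.1 t, p.2 + r.2) | r <- d].

Fixpoint fmul d d' : fsum := if d is p :: d0 then fmul1 p d' ++ fmul d0 d' else [::].

(** The adjoint of f u_g is u_g^-1 f^*, whose function part is translated to
    the left of the group element. *)
Definition fstar d : fsum :=
  [seq (translate act (- p.2) (fun t => (p.1 t)^* : R[i]^o), - p.2) | p <- d].

Lemma translate_continuous g f : continuous f -> continuous (translate act g f).
Proof. by move=> cf t; apply: continuous_comp; [exact: act_continuous|exact: cf]. Qed.

Lemma continuousZC (k : R[i]) f : continuous f -> continuous (fun t => k * f t : R[i]^o).
Proof. by move=> cf; exact: (continuousMC (@continuous_constC _ _ k) cf). Qed.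

Lemma fsum_continuous_scale k d : fsum_continuous d -> fsum_continuous (fscale k d).
Proof. by apply: fsum_continuous_map => p; exact: continuousZC. Qed.

Lemma fsum_continuous_mul d d' :
  fsum_continuous d -> fsum_continuous d' -> fsum_continuous (fmul d d').
Proof.
elim: d => //= p d ih [cp /ih cd] cd'.
apply: fsum_continuous_cat; last exact: cd.
move: cd'; apply: fsum_continuous_map => r cr /=.
exact: (continuousMC cp (translate_continuous cr)).
Qed.

Lemma fsum_continuous_star d : fsum_continuous d -> fsum_continuous (fstar d).
Proof.
apply: fsum_continuous_map => p cp.
exact: (translate_continuous (continuous_conj cp)).
Qed.

Section Evaluation.
Variables (A : cstarAlgType R) (i : (X -> R[i]^o) -> A) (u : G -> A).
Hypothesis cov : covariant_pair act i u.

Definition feval d : A := \sum_(p <- d) cmul (i p.1) (u p.2).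

Lemma feval_nil : feval [::] = 0. Proof. exact: big_nil. Qed.

Lemma feval_cons p d : feval (p :: d) = cmul (i p.1) (u p.2) + feval d.
Proof. exact: big_cons. Qed.

Lemma feval_cat d d' : feval (d ++ d') = feval d + feval d'.
Proof. exact: big_cat. Qed.

Lemma covpair_0 : i (fun=> 0) = 0.
Proof.
have c0 := @continuous_constC R X 0.
have := covpair_DZ cov 1 c0 c0.
have -> : (fun t : X => 1 * 0 + 0 : R[i]^o) = (fun=> 0).
  by apply/funext => t; rewrite mulr0 addr0.
by rewrite scale1r => /eqP; rewrite addrC -subr_eq subrr => /eqP.
Qed.

Lemma covpair_Z k f : continuous f -> i (fun t => k * f t) = k *: i f.
Proof.
move=> cf; have := covpair_DZ cov k cf (@continuous_constC R X 0).
rewrite covpair_0 addr0 => <-; congr i.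
by apply/funext => t; rewrite addr0.
Qed.

Lemma covpair_D f f' : continuous f -> continuous f' ->
  i (fun t => f t + f' t) = i f + i f'.
Proof.
move=> cf cf'; have := covpair_DZ cov 1 cf cf'; rewrite scale1r => <-.
by congr i; apply/funext => t; rewrite mul1r.
Qed.

Lemma feval_scale k d : fsum_continuous d -> feval (fscale k d) = k *: feval d.
Proof.
elim: d => [|p d ih] /=; first by rewrite !feval_nil scaler0.
move=> [cp /ih e]; rewrite !feval_cons/= e scalerDr.
by rewrite (covpair_Z k cp) cmulZl.
Qed.

Lemma feval_mul1 p d : continuous p.1 -> fsum_continuous d ->
  feval (fmul1 p d) = cmul (cmul (i p.1) (u p.2)) (feval d).
Proof.
move=> cp; elim: d => [|r d ih] /=; first by rewrite !feval_nil cmul0r.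
move=> [cr /ih e]; rewrite !feval_cons e cmulDr; congr (_ + _) => /=.
rewrite (covpair_M cov cp (translate_continuous cr)) (covpair_unitaryD cov).
rewrite -!cmulA; congr cmul; rewrite !cmulA; congr cmul.
by rewrite (covpair_covariant cov).
Qed.

Lemma feval_mul d d' : fsum_continuous d -> fsum_continuous d' ->
  feval (fmul d d') = cmul (feval d) (feval d').
Proof.
move=> + cd'; elim: d => [|p d ih] /=; first by rewrite feval_nil cmul0l.
move=> [cp /ih e]; rewrite feval_cat feval_cons e cmulDl.
by rewrite (feval_mul1 cp cd').
Qed.

Lemma feval_star d : fsum_continuous d -> feval (fstar d) = star (feval d).
Proof.
elim: d => [|p d ih] /=; first by rewrite feval_nil star0.
move=> [cp /ih e]; rewrite !feval_cons e starD; congr (_ + _) => /=.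
rewrite starM (covpair_unitary_star cov) -(covpair_star cov cp).
by rewrite (covpair_covariant cov _ (continuous_conj cp)).
Qed.

End Evaluation.

Section Operators.
Variables (H : hilbertType R) (pi : (X -> R[i]^o) -> H -> H) (U : G -> H -> H).
Hypothesis cov : covariant_rep act pi U.

Definition fop d (x : H) : H := \sum_(p <- d) pi p.1 (U p.2 x).

Lemma covrep_function_rep : function_rep pi.
Proof. by case: cov. Qed.

Let fr := covrep_function_rep.

Lemma covrep_U0 g : U g 0 = 0.
Proof.
have := covrep_unitary_linear cov g 1 0 0; rewrite !scale1r addr0 => /eqP.
by rewrite -subr_eq subrr => /eqP.
Qed.

Lemma covrep_adjoint g x y : dot (U (- g) x) y = dot x (U g y).
Proof.
rewrite -(covrep_unitary cov g) -(proj2 (covrep_action cov)) subrr.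
by rewrite (proj1 (covrep_action cov)).
Qed.

Lemma fop_nil x : fop [::] x = 0. Proof. exact: big_nil. Qed.

Lemma fop_cons p d x : fop (p :: d) x = pi p.1 (U p.2 x) + fop d x.
Proof. exact: big_cons. Qed.

Lemma fop_cat d d' x : fop (d ++ d') x = fop d x + fop d' x.
Proof. exact: big_cat. Qed.

Lemma fop_linear d : fsum_continuous d -> linear (fop d).
Proof.
move=> + k x y; elim: d => [|p d ih] /=.
  by rewrite !fop_nil scaler0 addr0.
move=> [cp /ih e]; rewrite !fop_cons e (covrep_unitary_linear cov).
by rewrite (frep_linear fr cp) scalerDr addrACA.
Qed.

Lemma fop_scale k d x : fsum_continuous d -> fop (fscale k d) x = k *: fop d x.
Proof.
elim: d => [|p d ih] /=; first by rewrite !fop_nil scaler0.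
move=> [cp /ih e]; rewrite !fop_cons/= e scalerDr; congr (_ + _).
rewrite (frep_M fr _ (@continuous_constC _ _ k) cp).
by rewrite frep_cst.
Qed.

Lemma fop_mul d d' x : fsum_continuous d -> fsum_continuous d' ->
  fop (fmul d d') x = fop d (fop d' x).
Proof.
move=> + cd'; elim: d => [|p d ih] /=; first by rewrite !fop_nil.
move=> [cp /ih e]; rewrite fop_cat fop_cons e; congr (_ + _).
elim: d' cd' {ih e} => [|r d' ih] /=.
  by rewrite !fop_nil covrep_U0 (frep0v fr cp).
move=> [cr cd']; rewrite !fop_cons (ih cd')/=.
have UD y z : U p.2 (y + z) = U p.2 y + U p.2 z.
  by have := covrep_unitary_linear cov p.2 1 y z; rewrite !scale1r.
rewrite UD (frepDv fr _ _ cp); congr (_ + _).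
rewrite (covrep_covariant cov _ _ cr).
rewrite (frep_M fr _ cp (translate_continuous cr)).
by rewrite (proj2 (covrep_action cov)).
Qed.

Lemma fop_star d x y : fsum_continuous d -> dot (fop (fstar d) x) y = dot x (fop d y).
Proof.
elim: d => [|p d ih] /=; first by rewrite !fop_nil dot0l dot0r.
move=> [cp /ih e]; rewrite !fop_cons/= dotDl dotDr e; congr (_ + _).
rewrite -(covrep_covariant cov _ _ (continuous_conj cp)).
by rewrite covrep_adjoint (frep_star fr _ _ cp).
Qed.

End Operators.

Section Integration.
Variables (A : cstarAlgType R) (i : (X -> R[i]^o) -> A) (u : G -> A).
Hypothesis cp : crossed_product act i u.
Let cov := cp_covariant cp.

Lemma feval_dense (a : A) (e : R) : 0 < e ->
  exists2 d, fsum_continuous d & nrm (a - feval i u d) < e.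
Proof.
move=> e0; have : closure [set a | exists n (f : 'I_n -> X -> R[i]^o) (g : 'I_n -> G),
    (forall k, continuous (f k)) /\
    a = \sum_(k < n) cmul (i (f k)) (u (g k))] a by rewrite (cp_dense cp).
move=> /closure_nrm/(_ e e0)[_ [n [f [g [cf ->]]]] ab].
exists [seq (f k, g k) | k <- index_enum 'I_n]; last by rewrite /feval big_map.
elim: (index_enum _) => [|k s ih] /=; first exact: I.
by split; [exact: cf|exact: ih].
Qed.

(** Identities are checked on finite sums, which are dense. *)
Lemma feval_dense_eq (V : normedModType R[i]) (F F' : A -> V) (K K' : R) :
  (forall a b, nrm (F a - F b) <= nrm (a - b) * K) ->
  (forall a b, nrm (F' a - F' b) <= nrm (a - b) * K') ->
  (forall d, fsum_continuous d -> F (feval i u d) = F' (feval i u d)) ->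
  forall a, F a = F' a.
Proof.
move=> FK F'K FF' a; apply/subr0_eq; apply: (@nrm_le_epsM _ _ _ (`|K| + `|K'|)) => e e0.
have [d cd ad] := feval_dense a e0.
have := nrmB_trans (F (feval i u d)) (F a) (F' a); rewrite {2}(FF' _ cd).
move/le_trans; apply; rewrite mulrDr; apply: lerD.
  apply: (le_trans (FK _ _)); apply: (@le_trans _ _ (nrm (a - feval i u d) * `|K|)).
    by rewrite ler_wpM2l ?nrm_ge0 ?ler_norm.
  by rewrite ler_wpM2r ?normr_ge0 ?ltW.
rewrite nrmBC.
apply: (le_trans (F'K _ _)); apply: (@le_trans _ _ (nrm (a - feval i u d) * `|K'|)).
  by rewrite ler_wpM2l ?nrm_ge0 ?ler_norm.
by rewrite ler_wpM2r ?normr_ge0 ?ltW.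
Qed.

Lemma fsum_ord d (V : nmodType) (F : (X -> R[i]^o) * G -> V) :
  \sum_(p <- d) F p = \sum_(k < size d) F (nth (fun=> 0, 0) d k).
Proof. by rewrite (big_nth (fun=> 0, 0)) big_mkord. Qed.

Lemma feval_nrm_le d (M : R) : fsum_continuous d -> 0 <= M ->
  (forall (H : hilbertType R) (pi : (X -> R[i]^o) -> H -> H) (U : G -> H -> H),
    covariant_rep act pi U -> forall x, nrm (fop pi U d x) <= M * nrm x) ->
  nrm (feval i u d) <= M.
Proof.
move=> cd M0 h; rewrite -nrm_le /feval fsum_ord.
have [_] := @cp_norm R G X act A i u cp (size d)
  (fun k => (nth (fun=> 0, 0) d k).1) (fun k => (nth (fun=> 0, 0) d k).2) M
  (fun k => @fsum_continuous_nth d k cd) M0.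
apply.
move=> H pi U /h/(_ _) hx x; rewrite (nrmE x) -rmorphM nrm_le.
by have := hx x; rewrite /fop fsum_ord.
Qed.

Section IntegratedForm.
Variables (H : hilbertType R) (pi : (X -> R[i]^o) -> H -> H) (U : G -> H -> H).
Hypothesis covr : covariant_rep act pi U.

Lemma fop_nrm_le d x : fsum_continuous d ->
  nrm (fop pi U d x) <= nrm (feval i u d) * nrm x.
Proof.
move=> cd; rewrite -nrm_le rmorphM/= -(nrmE x) /fop fsum_ord.
have [+ _] := @cp_norm R G X act A i u cp (size d)
  (fun k => (nth (fun=> 0, 0) d k).1) (fun k => (nth (fun=> 0, 0) d k).2) _
  (fun k => @fsum_continuous_nth d k cd) (nrm_ge0 (feval i u d)).
rewrite nrm_le => /(_ _ H pi U covr x); apply.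
by rewrite /feval fsum_ord.
Qed.

Lemma fop_nrmB d d' x : fsum_continuous d -> fsum_continuous d' ->
  nrm (fop pi U d x - fop pi U d' x) <= nrm (feval i u d - feval i u d') * nrm x.
Proof.
move=> cd cd'; pose d'' := d ++ fscale (-1) d'.
have cd'' : fsum_continuous d''.
  by apply: fsum_continuous_cat => //; exact: fsum_continuous_scale.
have := fop_nrm_le x cd''.
by rewrite fop_cat feval_cat fop_scale// feval_scale// !scaleN1r.
Qed.

(** The operators of approximating finite sums form a Cauchy sequence because
    the norm of the full crossed product dominates them. *)
Lemma integrated_exists (a : A) (x : H) : exists y : H,
  forall d, fsum_continuous d ->
    nrm (y - fop pi U d x) <= nrm (a - feval i u d) * nrm x.
Proof.
have inv0 n : 0 < (n.+1%:R : R)^-1 by rewrite invr_gt0.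
have /choice[d dP] n : exists d, fsum_continuous d /\
    nrm (a - feval i u d) < (n.+1%:R)^-1.
  by have [d cd ad] := feval_dense a (inv0 n); exists d.
have small (e : R) : 0 < e -> exists N, forall n, (N <= n)%N ->
    nrm (a - feval i u (d n)) * (nrm x + 1) < e.
  move=> e0; have x1 : 0 < nrm x + 1 by rewrite ltr_wpDl ?nrm_ge0.
  exists (Num.bound ((nrm x + 1) / e)) => n Nn.
  have [_ an] := dP n; rewrite -ltr_pdivlMr//; apply: (lt_trans an).
  rewrite invf_plt ?posrE ?divr_gt0// invf_div.
  apply: (lt_le_trans (archi_boundP (ltW (divr_gt0 x1 e0)))).
  by rewrite ler_nat (leq_trans Nn).
have x01 : nrm x <= nrm x + 1 by rewrite lerDl.
have dd n m : nrm (fop pi U (d n) x - fop pi U (d m) x) <=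
    nrm (a - feval i u (d n)) * (nrm x + 1) + nrm (a - feval i u (d m)) * (nrm x + 1).
  have [cn _] := dP n; have [cm _] := dP m.
  apply: (le_trans (fop_nrmB x cn cm)); rewrite -mulrDl.
  apply: ler_pM; rewrite ?nrm_ge0//.
  have := nrmB_trans a (feval i u (d n)) (feval i u (d m)).
  by rewrite (nrmBC (feval i u (d n)) a).
have [|y yP] := @nrm_complete _ H (fun n => fop pi U (d n) x).
  move=> e e0; have [N hN] := small (e / 2) (divr_gt0 e0 (ltr0n R 2)); exists N => n Nn.
  apply: (le_lt_trans (dd N n)).
  by rewrite [ltRHS]splitr ltrD ?hN.
exists y => d' cd'; apply/ler_addgt0Pr => e e0.
have [N1 h1] := yP (e / 2) (divr_gt0 e0 (ltr0n R 2)).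
have [N2 h2] := small (e / 2) (divr_gt0 e0 (ltr0n R 2)).
pose n := maxn N1 N2; have {}h1 := h1 n (leq_maxl _ _).
have {}h2 := h2 n (leq_maxr _ _); have [cn _] := dP n.
have h3 := nrmB_trans (fop pi U (d n) x) y (fop pi U d' x).
have h4 := fop_nrmB x cn cd'.
have h5 := nrmB_trans a (feval i u (d n)) (feval i u d').
rewrite (nrmBC (feval i u (d n)) a) in h5.
have h6 := ler_wpM2r (nrm_ge0 x) h5; rewrite mulrDl in h6.
have h7 := ler_wpM2l (nrm_ge0 (a - feval i u (d n))) x01.
lra.
Qed.

Definition integrated (a : A) (x : H) : H := sval (cid (integrated_exists a x)).

Lemma integrated_approx a x d : fsum_continuous d ->
  nrm (integrated a x - fop pi U d x) <= nrm (a - feval i u d) * nrm x.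
Proof. by move=> cd; exact: (svalP (cid (integrated_exists a x)) d cd). Qed.

Lemma integrated_feval d x : fsum_continuous d ->
  integrated (feval i u d) x = fop pi U d x.
Proof.
move=> cd; apply/subr0_eq; apply: nrm_eq0; apply/eqP; rewrite eq_le nrm_ge0 andbT.
by have := integrated_approx (feval i u d) x cd; rewrite subrr nrm0 mul0r.
Qed.

Lemma integrated_contractive a x : nrm (integrated a x) <= nrm a * nrm x.
Proof.
have := @integrated_approx a x [::] I.
by rewrite fop_nil feval_nil !subr0.
Qed.

Lemma integrated_DZ k a b x :
  integrated (k *: a + b) x = k *: integrated a x + integrated b x.
Proof.
apply/subr0_eq; apply: (@nrm_le_epsM _ _ _ (2 * (cabs k + 1) * nrm x)) => e e0.
have [d cd ad] := feval_dense a e0; have [d' cd' bd'] := feval_dense b e0.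
have csd : fsum_continuous (fscale k d) by exact: fsum_continuous_scale.
have cdd : fsum_continuous (fscale k d ++ d') by exact: fsum_continuous_cat.
have hs : nrm (k *: a + b - feval i u (fscale k d ++ d')) <= cabs k * e + e.
  rewrite feval_cat (feval_scale cov)// opprD addrACA -scalerBr.
  by rewrite (le_trans (nrmD _ _))// nrmZ lerD ?ler_wpM2l ?nrm_ge0// ltW.
have h1 := integrated_approx (k *: a + b) x cdd.
have h2 := integrated_approx a x cd; have h3 := integrated_approx b x cd'.
rewrite (le_trans (nrmB_trans (fop pi U (fscale k d ++ d') x) _ _))//.
have -> : e * (2 * (cabs k + 1) * nrm x) =
  (cabs k * e + e) * nrm x + (cabs k * e + e) * nrm x by ring.
apply: lerD; first by rewrite (le_trans h1)// ler_wpM2r ?nrm_ge0.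
rewrite nrmBC fop_cat fop_scale// opprD addrACA -scalerBr (le_trans (nrmD _ _))//.
rewrite mulrDl nrmZ -mulrA; apply: lerD.
  by rewrite ler_wpM2l ?nrm_ge0// (le_trans h2)// ler_wpM2r ?nrm_ge0// ltW.
by rewrite (le_trans h3)// ler_wpM2r ?nrm_ge0// ltW.
Qed.

Lemma integratedB a b x : integrated (a - b) x = integrated a x - integrated b x.
Proof.
by rewrite -[- b]scaleN1r addrC integrated_DZ scaleN1r addrC.
Qed.

Lemma integrated_lipschitz a b x :
  nrm (integrated a x - integrated b x) <= nrm (a - b) * nrm x.
Proof. by rewrite -integratedB; exact: integrated_contractive. Qed.

Lemma integrated_linear a : linear (integrated a).
Proof.
move=> k x y; move: a.
apply: (@feval_dense_eq H _ _ (nrm (k *: x + y)) (cabs k * nrm x + nrm y)).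
- by move=> a b; exact: integrated_lipschitz.
- move=> a b; rewrite opprD addrACA -scalerBr (le_trans (nrmD _ _))//.
  rewrite nrmZ mulrDr mulrCA lerD ?ler_wpM2l ?nrm_ge0//; exact: integrated_lipschitz.
- by move=> d cd; rewrite !integrated_feval//; exact: (fop_linear covr).
Qed.

Lemma integrated_vB a x y : integrated a (x - y) = integrated a x - integrated a y.
Proof. by rewrite addrC -scaleN1r integrated_linear scaleN1r addrC. Qed.

Lemma integratedM a b x : integrated (cmul a b) x = integrated a (integrated b x).
Proof.
move: a; apply: (@feval_dense_eq H _ _ (nrm b * nrm x) (nrm b * nrm x)).
- move=> a a'; apply: (le_trans (integrated_lipschitz _ _ _)).
  by rewrite -cmulNl -cmulDl mulrA ler_wpM2r ?nrm_ge0 ?nrm_cmul.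
- move=> a a'; apply: (le_trans (integrated_lipschitz _ _ _)).
  by rewrite ler_wpM2l ?nrm_ge0 ?integrated_contractive.
move=> d cd; move: b.
apply: (@feval_dense_eq H _ _ (nrm (feval i u d) * nrm x) (nrm (feval i u d) * nrm x)).
- move=> b b'; apply: (le_trans (integrated_lipschitz _ _ _)).
  by rewrite -cmulNr -cmulDr mulrCA mulrA ler_wpM2r ?nrm_ge0 ?nrm_cmul.
- move=> b b'; rewrite -integrated_vB (le_trans (integrated_contractive _ _))//.
  by rewrite mulrCA ler_wpM2l ?nrm_ge0// integrated_lipschitz.
move=> d' cd'; rewrite -(feval_mul cov)// !integrated_feval//.
  exact: (fop_mul covr).
exact: fsum_continuous_mul.
Qed.

Lemma integrated_star a x y : dot (integrated (star a) x) y = dot x (integrated a y).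
Proof.
move: a; apply: (@feval_dense_eq R[i]^o _ _ (nrm x * nrm y) (nrm x * nrm y)).
- move=> a b; rewrite -dotNl -dotDl -integratedB -starN -starD.
  apply: (le_trans (cauchy_schwarz _ _)); rewrite mulrA ler_wpM2r ?nrm_ge0//.
  by rewrite (le_trans (integrated_contractive _ _))// nrm_star.
- move=> a b; rewrite -dotNr -dotDr -integratedB.
  apply: (le_trans (cauchy_schwarz _ _)); rewrite mulrCA ler_wpM2l ?nrm_ge0//.
  exact: integrated_contractive.
- move=> d cd; rewrite -(feval_star cov)// !integrated_feval//.
    exact: (fop_star covr).
  exact: fsum_continuous_star.
Qed.

Lemma integrated_representation : representation integrated.
Proof.
split.
- exact: integrated_linear.
- move=> a; apply: (bounded_linear_continuous_nrm (integrated_linear a)).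
  exact: integrated_contractive.
- exact: integrated_DZ.
- exact: integratedM.
- exact: integrated_star.
Qed.

Lemma integrated_function f x : continuous f -> integrated (i f) x = pi f x.
Proof.
move=> cf; have := @integrated_feval [:: (f, 0)] x (conj cf I).
rewrite /feval /fop !big_seq1/= (covpair_unitary0 cov) cmul1r.
by rewrite (proj1 (covrep_action covr)).
Qed.

Lemma integrated_unitary g x : integrated (u g) x = U g x.
Proof.
have := @integrated_feval [:: (fun=> 1, g)] x (conj (@continuous_constC _ _ _) I).
by rewrite /feval /fop !big_seq1/= (covpair_1 cov) cmul1l (covrep_1 covr).
Qed.

End IntegratedForm.

End Integration.

End FiniteSums.

(** * Almost invariant vectors for abelian groups *)

Section AlmostInvariant.
Variable G : zmodType.
Implicit Types (w c : seq G) (gs : seq G).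

(** Multisets, as sequences: [c] is contained in both [w] and its translate by
    [g], and exhausts [w] up to the proportion 1 / n. *)
Definition almost_invariant (n : nat) w (g : G) : Prop :=
  exists c, [/\ forall x, (count_mem x c <= count_mem x w)%N,
    forall x, (count_mem x c <= count_mem (x - g)%R w)%N &
    (n * size w <= n * size c + size w)%N].

Definition translates w (g : G) (ks : seq nat) : seq G :=
  flatten [seq [seq t + g *+ k | t <- w] | k <- ks].

Lemma count_translates w g ks x :
  count_mem x (translates w g ks) = (\sum_(k <- ks) count_mem (x - g *+ k)%R w)%N.
Proof.
rewrite /translates count_flatten -map_comp sumnE big_map; apply: eq_bigr => k _ /=.
by rewrite count_map; apply: eq_count => t /=; rewrite [RHS]eq_sym subr_eq eq_sym.
Qed.

Lemma size_translates w g ks : size (translates w g ks) = (size ks * size w)%N.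
Proof.
rewrite size_flatten /shape -map_comp sumnE big_map.
under eq_bigr do rewrite /= size_map.
by rewrite big_const_seq count_predT iter_addn_0 mulnC.
Qed.

(** Averaging over 0, g, ..., (n - 1) g makes a multiset almost invariant under
    [g] without spoiling its invariance under the other elements of the group,
    because the group is commutative. *)
Lemma almost_invariant_exists gs (n : nat) : (0 < n)%N ->
  exists2 w, (0 < size w)%N & {in gs, forall g, almost_invariant n w g}.
Proof.
case: n => // m _; set n := m.+1.
elim: gs => [|g gs [w w0 wgs]]; first by exists [:: 0].
pose ks := iota 0 n.
exists (translates w g ks); first by rewrite size_translates size_iota muln_gt0.
move=> h; rewrite inE => /orP[/eqP->{h}|/wgs[c [cw cwh sc]]].
- exists (translates w g (iota 1 m)); split=> [x|x|].
  + by rewrite !count_translates /ks /= big_cons leq_addl.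
  + have -> : ks = iota 0 m ++ [:: m] by rewrite /ks /n -[m.+1]addn1 iotaD.
    rewrite !count_translates big_cat/=.
    rewrite (iotaDl 1 0) big_map (leq_trans _ (leq_addr _ _))//.
    by apply: eq_leq; apply: eq_bigr => k _; rewrite mulrS opprD addrA.
  + by rewrite !size_translates !size_iota -mulnDr -[(m * _ + _)%N]addnC -mulSn.
- exists (translates c g ks); split=> [x|x|].
  + by rewrite !count_translates; apply: leq_sum => k _.
  + rewrite !count_translates; apply: leq_sum => k _.
    by rewrite addrAC.
  + by rewrite !size_translates size_iota -mulnDr leq_mul.
Qed.

Lemma sum_count_sub (T w : seq G) : uniq T -> {subset w <= T} ->
  (\sum_(t <- T) count_mem t w)%N = size w.
Proof.
move=> uT; elim: w => [|a w ih] wT /=; first by rewrite big1.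
rewrite big_split/= ih; last by move=> t tw; apply: wT; rewrite inE tw orbT.
rewrite (bigD1_seq a)//=; last exact/wT/mem_head.
by rewrite eqxx big1 ?addn0// => t /negPf; rewrite eq_sym => ->.
Qed.

Lemma sum_count_le (T w : seq G) : uniq T ->
  (\sum_(t <- T) count_mem t w <= size w)%N.
Proof.
move=> uT; elim: w => [|a w ih] /=; first by rewrite big1.
rewrite big_split/= -add1n leq_add//.
have [aT|aT] := boolP (a \in T).
  rewrite (bigD1_seq a)//= eqxx big1 ?addn0// => t /negPf.
  by rewrite eq_sym => ->.
rewrite big1_seq// => t /= tT; rewrite (_ : a == t = false)//.
by apply/negbTE/eqP => at_; rewrite at_ tT in aT.
Qed.

(** Unit vectors of l2(G), finitely supported, whose matrix coefficients for
    the regular representation are close to 1. *)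
Lemma almost_invariant_vectors (R : realType) gs (e : R) : 0 < e ->
  exists (T : seq G) (psi : G -> R),
    [/\ uniq T, forall t, t \notin T -> psi t = 0,
      \sum_(s <- T) psi s ^+ 2 = 1 &
      {in gs, forall g, `|1 - \sum_(s <- T) psi s * psi (s - g)| <= e}].
Proof.
move=> e0; pose n := (Num.bound e^-1).
have ei0 : 0 < e^-1 by rewrite invr_gt0.
have en : e^-1 < n%:R by exact: archi_boundP (ltW ei0).
have n0 : (0 < n)%N by rewrite -(ltr_nat R) (lt_trans ei0).
have [w w0 wgs] := almost_invariant_exists gs n0.
have N0 : 0 < (size w)%:R :> R by rewrite ltr0n.
pose a t : R := (count_mem t w)%:R / (size w)%:R.
have a0 t : 0 <= a t by rewrite divr_ge0.
pose psi t := Num.sqrt (a t).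
have psi2 t : psi t ^+ 2 = a t by rewrite sqr_sqrtr.
exists (undup w), psi; split.
- exact: undup_uniq.
- move=> t; rewrite mem_undup => /count_memPn tw.
  by rewrite /psi /a tw mul0r sqrtr0.
- under eq_bigr do rewrite psi2.
  rewrite -mulr_suml -natr_sum sum_count_sub ?undup_uniq//.
    by rewrite divff// gt_eqF.
  by move=> t; rewrite mem_undup.
move=> g /wgs[c [cw cwg sc]].
have le1 : \sum_(s <- undup w) psi s * psi (s - g) <= 1.
  apply: (@le_trans _ _ (\sum_(s <- undup w) (a s + a (s - g)) / 2)).
    apply: ler_sum => s _; rewrite -!psi2.
    by have := sqr_ge0 (psi s - psi (s - g)); rewrite ler_pdivlMr//; nra.
  rewrite -mulr_suml big_split/= ler_pdivrMr// mul1r -[2]/(1 + 1) lerD//.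
    rewrite -mulr_suml -natr_sum ler_pdivrMr// mul1r ler_nat.
    by rewrite sum_count_le// undup_uniq.
  rewrite -mulr_suml -natr_sum ler_pdivrMr// mul1r ler_nat.
  rewrite -(big_map (fun s => s - g) xpredT (fun t => count_mem t w)) sum_count_le//.
  by rewrite map_inj_uniq ?undup_uniq//; exact: addIr.
rewrite ger0_norm ?subr_ge0// lerBlDr -lerBlDl.
apply: (@le_trans _ _ ((size c)%:R / (size w)%:R)).
  rewrite ler_pdivlMr// mulrBl mul1r lerBlDr.
  have nR : 0 < n%:R :> R by rewrite ltr0n.
  have sc' : n%:R * (size w)%:R <= n%:R * (size c)%:R + (size w)%:R :> R.
    by rewrite -!natrM -natrD ler_nat.
  have en' : 1 <= e * n%:R.
    by rewrite mulrC -ler_pdivrMr// mul1r ltW.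
  rewrite -(ler_pM2l nR) mulrDr (le_trans sc')// lerD2l.
  by rewrite mulrA (mulrC n%:R) ler_peMl// ltW.
have <- : (\sum_(s <- undup w) count_mem s c)%N = size c.
  apply: sum_count_sub; first exact: undup_uniq.
  move=> t tc; rewrite mem_undup -has_pred1 has_count.
  by rewrite (leq_trans _ (cw t))// -has_count has_pred1.
rewrite natr_sum mulr_suml; apply: ler_sum => s _.
rewrite -[leLHS]ger0_norm ?divr_ge0// -sqrtr_sqr -sqrtrM// ler_wsqrtr//.
rewrite expr2 /a; apply: ler_pM; rewrite ?divr_ge0//.
  by rewrite ler_pM2r ?invr_gt0// ler_nat.
by rewrite ler_pM2r ?invr_gt0// ler_nat.
Qed.

End AlmostInvariant.

(** * Induced representations on square-summable families over the group *)

Section Induced.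
Variables (R : realType) (G : zmodType) (X : topologicalType).
Variable act : G -> X -> X.
Hypothesis act_action : is_action act.
Hypothesis act_continuous : forall g, continuous (act g).
Hypothesis cX : compact [set: X].
Variables (H : hilbertType R) (pi : (X -> R[i]^o) -> H -> H).
Hypothesis fr : function_rep pi.
Implicit Types (f : X -> R[i]^o) (x y : l2 G H) (g s t : G).

(** The representation of the crossed product induced from a representation of
    the functions alone: at the coordinate [s], functions act through their
    translate by [s]. *)
Definition ind_fun f x : l2 G H := l2_of (fun s => pi (fun p => f (act s p)) (x s)).

Definition ind_shift g x : l2 G H := l2_of (fun s => x (s - g)).

Lemma comp_act_continuous f s : continuous f -> continuous (fun p => f (act s p)).
Proof. by move=> cf p; apply: continuous_comp; [exact: act_continuous|exact: cf]. Qed.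

Lemma ind_fun_bounded f (M : R) x : continuous f -> 0 <= M ->
  (forall p, cabs (f p) <= M) ->
  (forall s, ind_fun f x s = pi (fun p => f (act s p)) (x s)) /\
  nrm (ind_fun f x) <= M * nrm x.
Proof.
move=> cf M0 fM; apply: l2_of_bounded => [|S uS].
  by rewrite mulr_ge0 ?nrm_ge0.
rewrite exprMn; apply: (@le_trans _ _ (M ^+ 2 * sumsq x S)); last first.
  by rewrite ler_wpM2l ?sqr_ge0 ?sumsq_le_nrm.
rewrite /sumsq mulr_sumr; apply: ler_sum => s _; rewrite -exprMn.
rewrite ler_pXn2r ?nnegrE ?mulr_ge0 ?nrm_ge0//.
exact: (frep_bound fr _ (comp_act_continuous cf) M0).
Qed.

Lemma ind_funE f x s : continuous f ->
  ind_fun f x s = pi (fun p => f (act s p)) (x s).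
Proof.
by move=> cf; have [M M0 fM] := compact_bounded cX cf; case: (ind_fun_bounded x cf M0 fM).
Qed.

Lemma ind_shift_bounded g x :
  (forall s, ind_shift g x s = x (s - g)) /\ nrm (ind_shift g x) <= nrm x.
Proof.
apply: l2_of_bounded => [|S uS]; first exact: nrm_ge0.
have -> : sumsq (fun s => x (s - g)) S = sumsq x [seq s - g | s <- S].
  by rewrite /sumsq big_map.
by apply: sumsq_le_nrm; rewrite map_inj_uniq//; exact: addIr.
Qed.

Lemma ind_shiftE g x s : ind_shift g x s = x (s - g).
Proof. exact: (ind_shift_bounded g x).1. Qed.

Lemma ind_shift_linear g : linear (ind_shift g).
Proof. by move=> k x y; apply: l2_ext => s; rewrite l2D l2Z !ind_shiftE. Qed.

Lemma ind_shift_action : is_action ind_shift.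
Proof.
split=> [x|g h x]; apply: l2_ext => s; rewrite !ind_shiftE ?subr0//.
by rewrite opprD addrA.
Qed.

Lemma ind_shift_nrm g x : nrm (ind_shift g x) = nrm x.
Proof.
apply/eqP; rewrite eq_le (ind_shift_bounded g x).2/=.
have [U0 UD] := ind_shift_action.
by rewrite -[X in nrm X <= _]U0 -[X in ind_shift X _](addNr g) UD (ind_shift_bounded _ _).2.
Qed.

Lemma ind_shift_unitary g x y : dot (ind_shift g x) (ind_shift g y) = dot x y.
Proof.
exact: isometry_dot (ind_shift_linear g) (ind_shift_nrm g) _ _.
Qed.

Lemma ind_covariant : covariant_rep act ind_fun ind_shift.
Proof.
have lin f : continuous f -> linear (ind_fun f).
  move=> cf k x y; apply: l2_ext => s.
  rewrite l2D l2Z !(ind_funE _ _ cf) l2D l2Z.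
  exact: (frep_linear fr (comp_act_continuous cf)).
split.
- exact: lin.
- move=> f cf; have [M M0 fM] := compact_bounded cX cf.
  apply: (bounded_linear_continuous_nrm (lin f cf)) => x.
  exact: (ind_fun_bounded x cf M0 fM).2.
- move=> k f f' x cf cf'; apply: l2_ext => s; rewrite l2D l2Z.
  rewrite (ind_funE _ _ (continuousDZ cf cf')) (ind_funE _ _ cf) (ind_funE _ _ cf').
  exact: (frep_DZ fr _ _ (comp_act_continuous cf) (comp_act_continuous cf')).
- move=> x; apply: l2_ext => s; rewrite (ind_funE _ _ (@continuous_constC _ _ 1)).
  exact: (frep_1 fr).
- move=> f f' x cf cf'; apply: l2_ext => s.
  rewrite (ind_funE _ _ (continuousMC cf cf')) (ind_funE _ _ cf) (ind_funE _ _ cf').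
  exact: (frep_M fr _ (comp_act_continuous cf) (comp_act_continuous cf')).
- move=> f x y cf.
  have lim1 := l2_dot_limit (ind_fun (fun p => (f p)^* : R[i]^o) x) y.
  apply: (dot_limit_unique lim1).
  move=> e e0; have [S0 h] := l2_dot_limit x (ind_fun f y) e0.
  exists S0 => S uS sub.
  have -> : partial_dot (ind_fun (fun p => (f p)^*) x) y S =
      partial_dot x (ind_fun f y) S; last exact: h.
  apply: eq_bigr => s _; rewrite (ind_funE _ _ (continuous_conj cf)) (ind_funE _ _ cf).
  exact: (frep_star fr _ _ (comp_act_continuous cf)).
- exact: ind_shift_linear.
- exact: ind_shift_unitary.
- exact: ind_shift_action.
- move=> g f x cf; apply: l2_ext => s.
  rewrite ind_shiftE (ind_funE _ _ cf).
  rewrite (ind_funE _ _ (translate_continuous act_continuous cf)) ind_shiftE.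
  congr (pi _ _); apply/funext => p; rewrite /translate -(proj2 act_action).
  by rewrite addrC.
Qed.

Lemma ind_shift_delta g t v : ind_shift g (delta t v) = delta (t + g) v.
Proof. by apply: l2_ext => s; rewrite ind_shiftE !deltaE subr_eq. Qed.

Lemma ind_fun_delta f t v : continuous f ->
  ind_fun f (delta t v) = delta t (pi (fun p => f (act t p)) v).
Proof.
move=> cf; apply: l2_ext => s; rewrite (ind_funE _ _ cf) !deltaE.
by case: eqP => [->//|_]; rewrite (frep0v fr (comp_act_continuous cf)).
Qed.

End Induced.

(** * Ideals of the crossed product are detected by functions *)

Section Bumps.
Variables (R : realType) (X : topologicalType).
Hypotheses (cX : compact [set: X]) (hX : hausdorff_space X).

Lemma bump (N : set X) x : open N -> N x ->
  exists h : X -> R, [/\ continuous h, forall y, 0 <= h y <= 1, h x = 1 &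
    forall y, ~ N y -> h y = 0].
Proof.
move=> oN Nx.
have sep : uniform_separator (~` N) [set x].
  apply: normal_uniform_separator.
  - exact: compact_normal.
  - exact: open_closedC.
  - exact/accessible_closed_set1/hausdorff_accessible.
  - by apply/seteqP; split=> // y [Ny yx]; apply: Ny; rewrite yx.
exists (@Urysohn X R (~` N) [set x]); split.
- exact: Urysohn_continuous.
- move=> y; have := @Urysohn_range X R (~` N) [set x].
  by move=> /(_ (Urysohn (~` N) [set x] y))/(_ _)/=; rewrite in_itv; apply; exists y.
- by apply: (Urysohn_sub1 sep); exists x.
- by move=> y Ny; apply: (Urysohn_sub0 sep); exists y.
Qed.

End Bumps.

Section FreeAction.
Variables (R : realType) (G : zmodType) (X : topologicalType).
Variable act : G -> X -> X.
Hypotheses (act_continuous : forall g, continuous (act g)).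
Hypotheses (act_free : free_action act).
Hypotheses (cX : compact [set: X]) (hX : hausdorff_space X).

(** A free action moves x away from itself, hence also a neighbourhood of x. *)
Lemma displaced_nbhd (ks : seq G) x : exists N : set X, [/\ open N, N x &
  forall k, k \in ks -> k != 0 -> forall y, N y -> ~ N (act k y)].
Proof.
elim: ks => [|k ks [N [oN Nx NP]]].
  by exists setT; split => //; exact: openT.
have [->|k0] := eqVneq k 0.
  exists N; split=> // l; rewrite inE => /orP[/eqP->|lks]; first by rewrite eqxx.
  exact: NP.
have kx : act k x != x by apply/eqP => /act_free/eqP; rewrite (negPf k0).
have := hX; rewrite open_hausdorff => /(_ _ _ kx) [[W V] [Okx Vx] [oO oV OV]]; rewrite /= in Okx Vx.
exists (N `&` (V `&` (act k @^-1` W))); split.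
- apply: openI => //; apply: openI; first by [].
  by apply: open_comp => // y _; exact: act_continuous.
- by split=> //; split; [rewrite inE in Vx|rewrite inE in Okx].
- move=> l; rewrite inE => /orP[/eqP->|lks] l0 y [Ny [Vy Oy]] [Nly [Vly _]].
    have WV : (W `&` V) (act k y) by [].
    by move/eqP: OV => /= OV; rewrite OV in WV.
  exact: (NP l lks l0 y Ny Nly).
Qed.

Lemma displaced_bump (ks : seq G) x : exists h : X -> R,
  [/\ continuous h, forall y, 0 <= h y <= 1, h x = 1 &
    forall k, k \in ks -> k != 0 -> forall y, h y * h (act k y) = 0].
Proof.
have [N [oN Nx NP]] := displaced_nbhd ks x.
have [h [ch h01 hx h0]] := @bump R _ cX hX N x oN Nx.
exists h; split=> // k kks k0 y.
have [Ny|Ny] := pselect (N y); last by rewrite h0// mul0r.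
by rewrite [h (act k y)]h0 ?mulr0//; exact: NP.
Qed.

End FreeAction.

Section IdealIntersection.
Variables (R : realType) (G : zmodType) (X : topologicalType).
Variable act : G -> X -> X.
Hypotheses (act_action : is_action act) (act_continuous : forall g, continuous (act g)).
Hypotheses (cX : compact [set: X]).
Variables (A : cstarAlgType R) (i : (X -> R[i]^o) -> A) (u : G -> A).
Hypothesis cp : crossed_product act i u.
Let cov := cp_covariant cp.
Implicit Types (f : X -> R[i]^o) (d : fsum R G X) (g : G).

(** Nondegeneracy; irreducible representations have it, and it makes the
    restriction of [rho] to functions and group elements covariant. *)
Definition unital_rep (H : hilbertType R) (rho : A -> H -> H) : Prop :=
  forall x, rho cone x = x.

Lemma rep_covariant (H : hilbertType R) (rho : A -> H -> H) :
  representation rho -> unital_rep rho ->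
  covariant_rep act (fun f => rho (i f)) (fun g => rho (u g)).
Proof.
move=> rep un; split.
- by move=> f _; exact: (rep_linear rep).
- by move=> f _; exact: (rep_continuous rep).
- by move=> k f f' x cf cf'; rewrite (covpair_DZ cov _ cf cf') (rep_DZ rep).
- by move=> x; rewrite (covpair_1 cov) un.
- by move=> f f' x cf cf'; rewrite (covpair_M cov cf cf') (repM rep).
- by move=> f x y cf; rewrite (covpair_star cov cf) (rep_star rep).
- by move=> g; exact: (rep_linear rep).
- move=> g x y; rewrite -(rep_star rep) (covpair_unitary_star cov) -(repM rep).
  by rewrite -(covpair_unitaryD cov) addNr (covpair_unitary0 cov) un.
- split=> [x|g h x]; first by rewrite (covpair_unitary0 cov) un.
  by rewrite (covpair_unitaryD cov) (repM rep).
- move=> g f x cf; rewrite -!(repM rep).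
  by rewrite (covpair_covariant cov _ cf).
Qed.

Lemma rep_feval (H : hilbertType R) (rho : A -> H -> H) d x : representation rho ->
  rho (feval i u d) x = fop (fun f => rho (i f)) (fun g => rho (u g)) d x.
Proof.
move=> rep; elim: d => [|p d ih]; first by rewrite feval_nil fop_nil (rep0 rep).
by rewrite feval_cons fop_cons (repD rep) ih (repM rep).
Qed.

Lemma nrm_function f (M : R) : continuous f -> 0 <= M ->
  (forall x, cabs (f x) <= M) -> nrm (i f) <= M.
Proof.
move=> cf M0 fM; have := @feval_nrm_le R G X act A i u cp [:: (f, 0)] M (conj cf I) M0.
rewrite /feval big_seq1/= (covpair_unitary0 cov) cmul1r; apply=> H pi U covr x.
rewrite /fop big_seq1/= (proj1 (covrep_action covr)).
exact: (frep_bound (covrep_function_rep covr) _ cf M0).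
Qed.

Lemma nrm_unitary g : nrm (u g) <= 1.
Proof.
apply: nrm_isometry; rewrite (covpair_unitary_star cov) -(covpair_unitaryD cov).
by rewrite addNr (covpair_unitary0 cov).
Qed.

(** A formal sum may contain several terms with the same group element. *)
Definition coef d g : X -> R[i]^o := fun x => \sum_(p <- d | p.2 == g) p.1 x.

Lemma coef_cons p d g :
  coef (p :: d) g = fun x => if p.2 == g then p.1 x + coef d g x else coef d g x.
Proof. by apply/funext => x; rewrite /coef big_cons. Qed.

Lemma coef_continuous d g : fsum_continuous d -> continuous (coef d g).
Proof.
elim: d => [|p d ih] /=.
  move=> _; have -> : coef [::] g = fun=> 0.
    by apply/funext => x; rewrite /coef big_nil.
  exact: continuous_constC.
move=> [cp1 /ih cd]; rewrite coef_cons.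
by case: (p.2 == g); [exact: (continuousDC cp1 cd)|exact: cd].
Qed.

(** Compressing by a function whose support is displaced by the other group
    elements isolates one coefficient. *)
Lemma compress_feval d g (h : X -> R) : fsum_continuous d -> continuous h ->
  (forall p, p \in [seq p.2 | p <- d] -> p != g ->
    forall x, h x * h (act (g - p) x) = 0) ->
  cmul (i (fun x => (h x)%:C))
    (cmul (feval i u d) (i (translate act (- g) (fun x => (h x)%:C)))) =
  cmul (i (fun x => (h x * h x)%:C * coef d g x)) (u g).
Proof.
move=> + ch; have cH := continuous_realC ch.
have cH' := translate_continuous act_continuous (g := - g) cH.
have cHH := continuous_realC (continuousMr ch ch).
elim: d => [_ _|p d ih].
  rewrite feval_nil cmul0l cmul0r.
  have -> : (fun x => (h x * h x)%:C * coef [::] g x) = fun=> 0.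
    by apply/funext => x; rewrite /coef big_nil mulr0.
  by rewrite (covpair_0 cov) cmul0l.
move=> [cp1 cd] hd.
have {}ih := ih cd (fun q qd => hd q (mem_behead (s := p.2 :: _) qd)).
rewrite feval_cons cmulDl cmulDr ih.
have cT := translate_continuous act_continuous (g := p.2) cH'.
have -> : cmul (i (fun x => (h x)%:C)) (cmul (cmul (i p.1) (u p.2))
    (i (translate act (- g) (fun x => (h x)%:C)))) =
  cmul (i (fun x => (h x)%:C * (p.1 x *
    translate act p.2 (translate act (- g) (fun x => (h x)%:C)) x))) (u p.2).
  rewrite (covpair_M cov cH (continuousMC cp1 cT)) (covpair_M cov cp1 cT).
  by rewrite -!cmulA; do 2 congr cmul; rewrite (covpair_covariant cov _ cH').
have trE x : translate act p.2 (translate act (- g) (fun x => (h x)%:C : R[i]^o)) x =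
    (h (act (g - p.2) x))%:C.
  by rewrite /translate opprK (proj2 act_action).
have [pg|pg] := eqVneq p.2 g.
  have -> : (fun x => (h x)%:C * (p.1 x *
    translate act p.2 (translate act (- g) (fun x => (h x)%:C)) x)) =
    (fun x => (h x * h x)%:C * p.1 x).
    apply/funext => x; rewrite trE pg subrr (proj1 act_action) rmorphM/=.
    by rewrite mulrCA mulrC.
  rewrite pg -cmulDl -(covpair_D cov (continuousMC cHH cp1)
    (continuousMC cHH (coef_continuous cd))).
  congr (cmul (i _) _); apply/funext => x.
  by rewrite coef_cons pg eqxx mulrDr.
have -> : (fun x => (h x)%:C * (p.1 x *
    translate act p.2 (translate act (- g) (fun x => (h x)%:C)) x)) = fun=> 0.
  apply/funext => x; rewrite trE mulrCA -rmorphM hd ?mulr0//.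
  exact: mem_head.
rewrite (covpair_0 cov) cmul0l add0r; congr (cmul (i _) _); apply/funext => x.
by rewrite coef_cons (negPf pg).
Qed.

Section Family.
Hypotheses (act_free : free_action act) (hX : hausdorff_space X).
Variable Ps : set (set A).
Hypothesis Ps_kernels : forall P, Ps P -> exists (H : hilbertType R) (rho : A -> H -> H),
  [/\ representation rho, unital_rep rho & P = rep_kernel rho].

Definition killed : set A := \bigcap_(P in Ps) P.

Definition killed_functions : set (X -> R[i]^o) :=
  [set f | continuous f /\ killed (i f)].

Lemma killed_ideal a b c : killed b -> killed (cmul a (cmul b c)).
Proof.
move=> Kb P PsP; have [H [rho [rep _ PE]]] := Ps_kernels PsP.
have := Kb P PsP; rewrite PE => rb x.
by rewrite !(repM rep) rb (rep0v rep).
Qed.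

Lemma killedMl a b : killed b -> killed (cmul a b).
Proof. by move=> /(killed_ideal a cone); rewrite cmul1r. Qed.

Lemma killedD a b : killed a -> killed b -> killed (a + b).
Proof.
move=> Ka Kb P PsP; have [H [rho [rep _ PE]]] := Ps_kernels PsP.
have := Ka P PsP; have := Kb P PsP; rewrite PE => rb ra x.
by rewrite (repD rep) ra rb addr0.
Qed.

Lemma killed0 : killed 0.
Proof.
move=> P PsP; have [H [rho [rep _ ->]]] := Ps_kernels PsP.
by move=> x; rewrite (rep0 rep).
Qed.

Lemma killed_functions0 : killed_functions (fun=> 0).
Proof.
by split; [exact: continuous_constC|rewrite (covpair_0 cov); exact: killed0].
Qed.

Lemma killed_functionsD f f' : killed_functions f -> killed_functions f' ->
  killed_functions (fun x => f x + f' x).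
Proof.
move=> [cf Kf] [cf' Kf']; split; first exact: (continuousDC cf cf').
by rewrite (covpair_D cov cf cf'); exact: killedD.
Qed.

Lemma killed_functionsM f f' : continuous f -> killed_functions f' ->
  killed_functions (fun x => f x * f' x).
Proof.
move=> cf [cf' Kf']; split; first exact: (continuousMC cf cf').
by rewrite (covpair_M cov cf cf'); exact: killedMl.
Qed.

Lemma killed_functions_act f s : killed_functions f ->
  killed_functions (fun x => f (act s x)).
Proof.
move=> [cf Kf]; have cft := comp_act_continuous act_continuous (s := s) cf.
split; first exact: cft.
have -> : i (fun x => f (act s x)) = cmul (u (- s)) (cmul (i f) (u s)).
  rewrite cmulA (covpair_covariant cov _ cf) -cmulA -(covpair_unitaryD cov).
  rewrite addNr (covpair_unitary0 cov) cmul1r; congr i.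
  by apply/funext => x; rewrite /translate opprK.
exact: killed_ideal.
Qed.

Definition hull : set X := zero_set killed_functions.

Lemma hull_act s x : hull x -> hull (act s x).
Proof. by move=> Zx f /(killed_functions_act s)/Zx. Qed.

(** Compressed to a small neighbourhood of [x], a sum that is close to a killed
    element becomes a function that is small modulo the killed elements, hence
    small at the points of the hull. For g = 0 this is the contractivity of the
    conditional expectation onto the functions. *)
Lemma coef_bound d a g x : fsum_continuous d -> killed a -> hull x ->
  cabs (coef d g x) <= nrm (a - feval i u d).
Proof.
move=> cd Ka Zx; rewrite leNgt; apply/negP; set m := nrm _; set c := cabs _ => mc.
have [h [ch h01 hx h0]] := @displaced_bump R G X act act_continuous act_free cX hX
  [seq g - p.2 | p <- d] x.
have hdisp p : p \in [seq p.2 | p <- d] -> p != g ->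
    forall y, h y * h (act (g - p) y) = 0.
  move=> pd pg; apply: h0; last by rewrite subr_eq0 eq_sym.
  by move/mapP: pd => [r rd ->]; apply/mapP; exists r.
have cH := continuous_realC ch.
have cH' := translate_continuous act_continuous (g := - g) cH.
have cC := coef_continuous (g := g) cd.
pose k y : R[i]^o := (h y * h y)%:C * coef d g y.
have ck : continuous k := continuousMC (continuous_realC (continuousMr ch ch)) cC.
have h1 y : cabs (h y)%:C <= 1.
  by have /andP[y0 y1] := h01 y; rewrite cabs_real ger0_norm.
pose T b := cmul (cmul (i (fun x => (h x)%:C))
    (cmul b (i (translate act (- g) (fun x => (h x)%:C))))) (u (- g)).
have TE : T (feval i u d) = i k.
  rewrite /T compress_feval// -cmulA -(covpair_unitaryD cov) subrr.
  by rewrite (covpair_unitary0 cov) cmul1r.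
have Tnrm b : nrm (T b) <= nrm b.
  rewrite /T (le_trans (nrm_cmul _ _))// -[leRHS]mulr1 ler_pM ?nrm_ge0 ?nrm_unitary//.
  rewrite (le_trans (nrm_cmul _ _))// -[leRHS]mul1r ler_pM ?nrm_ge0//.
    exact: (nrm_function cH ler01 h1).
  rewrite (le_trans (nrm_cmul _ _))// -[leRHS]mulr1 ler_wpM2l ?nrm_ge0//.
  exact: (nrm_function cH' ler01 (fun y => h1 _)).
have TB b b' : T (b - b') = T b - T b'.
  by rewrite /T cmulDl cmulNl cmulDr cmulNr cmulDl cmulNl.
pose m' := (m + c) / 2.
have mm' : m < m' by rewrite midf_lt.
have m'c : m' < c by rewrite midf_lt.
have ik (H : hilbertType R) (rho : A -> H -> H) (y : H) : representation rho -> rep_kernel rho a ->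
    nrm (rho (i k) y) <= m * nrm y.
  move=> rep ra; have -> : rho (i k) y = - rho (T (a - feval i u d)) y.
    rewrite TB TE (repD rep) (repN rep) /T !(repM rep) ra (rep0v rep).
    by rewrite add0r opprK.
  rewrite nrmN (le_trans (rep_contractive rep _ _))//.
  by rewrite ler_wpM2r ?nrm_ge0 ?Tnrm.
have Nk : killed_functions (fun y => (Num.max (cabs (k y) - m') 0)%:C).
  split.
    have cn := continuous_nrm ck.
    exact: (continuous_realC (continuous_maxr (c := 0)
      (continuousDr cn (@continuous_constr R X (- m'))))).
  move=> P PsP; have [H [rho [rep un PE]]] := Ps_kernels PsP.
  have := Ka P PsP; rewrite PE => ra y.
  have fr := covrep_function_rep (rep_covariant rep un).
  have cut := frep_cut_eq0 fr y ck (nrm_ge0 (a - feval i u d)) mm'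
    (fun z => ik H rho z rep ra).
  exact: cut.
have := Zx _ Nk; rewrite /k hx mulr1 mul1r -/c => /complexI.
by rewrite max_l ?subr_ge0 ?(ltW m'c)// => /eqP; rewrite subr_eq0 gt_eqF.
Qed.

Variables (H : hilbertType R) (sigma : A -> H -> H).
Hypotheses (rep : representation sigma) (un : unital_rep sigma).
Hypothesis sigma_killed : forall f, killed_functions f -> forall x, sigma (i f) x = 0.

Let covr := rep_covariant rep un.
Let fr := covrep_function_rep covr.

Lemma sigma_hull_bound f (e : R) x : continuous f -> 0 < e ->
  (forall y, hull y -> cabs (f y) <= e) -> nrm (sigma (i f) x) <= 2 * e * nrm x.
Proof.
move=> cf e0 fe.
have Ncont f' : killed_functions f' -> continuous f' by case.
have [f1 [cf1 Kf1] f1P] := ideal_approx cX Ncont killed_functions0 killed_functionsD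
  killed_functionsM cf (ltW e0) e0 fe.
have cf1' := continuousDZ (c := -1) cf1 cf.
have -> : sigma (i f) x = sigma (i (fun y => -1 * f1 y + f y)) x.
  rewrite (covpair_DZ cov _ cf1 cf) (rep_DZ rep) (sigma_killed (conj cf1 Kf1)).
  by rewrite scaler0 add0r.
apply: (frep_bound fr _ cf1'); first by rewrite mulr_ge0// ltW.
move=> y; have := f1P y; rewrite mulN1r addrC; move/le_trans; apply.
by rewrite mulr_natl mulr2n.
Qed.

Let act_ind := ind_covariant act_action act_continuous cX fr.

(** Induced from the restriction of [sigma] to functions. *)
Definition regular := integrated cp act_ind.

Let regular_rep : representation regular :=
  integrated_representation act_continuous cp act_ind.

(** Every matrix coefficient of the regular representation is a Fourier
    coefficient, hence small on the hull. *)
Lemma regular_killed a : killed a -> forall t v, regular a (delta t v) = 0.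
Proof.
move=> Ka t v; apply: l2_ext => s; rewrite l20.
apply: (@nrm_le_epsM _ _ _ (3 * nrm v)) => e e0.
have [d cd ad] := feval_dense cp a e0.
have h1 : nrm (fop (ind_fun act (fun f => sigma (i f))) (@ind_shift R G H) d (delta t v) s)
    <= 2 * e * nrm v.
  have -> : fop (ind_fun act (fun f => sigma (i f))) (@ind_shift R G H) d (delta t v) s =
      sigma (i (fun x => coef d (s - t) (act s x))) v.
    elim: d cd {ad} => [_|p d ih] /=.
      rewrite fop_nil l20; have -> : (fun x => coef [::] (s - t) (act s x)) = fun=> 0.
        by apply/funext => x; rewrite /coef big_nil.
      by rewrite (covpair_0 cov) (rep0 rep).
    move=> [cp1 cd]; rewrite fop_cons l2D (ih cd) ind_shift_delta.
    rewrite (ind_fun_delta act_continuous cX fr _ _ cp1) deltaE.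
    have pst : (p.2 == s - t) = (s == t + p.2).
      by rewrite eq_sym subr_eq [p.2 + t]addrC.
    rewrite -pst; case: ifP => ps.
      have st : t + p.2 = s by move: ps; rewrite pst => /eqP.
      have -> : (fun x => coef (p :: d) (s - t) (act s x)) =
          fun x => p.1 (act s x) + coef d (s - t) (act s x).
        by apply/funext => x; rewrite coef_cons ps.
      have cp1s := comp_act_continuous act_continuous (s := s) cp1.
      have cds := comp_act_continuous act_continuous (s := s)
        (coef_continuous (g := s - t) cd).
      by rewrite (covpair_D cov cp1s cds) (repD rep) st.
    rewrite add0r; congr (sigma (i _) _); apply/funext => x.
    by rewrite coef_cons ps.
  apply: (sigma_hull_bound _ (comp_act_continuous act_continuous (s := s)
    (coef_continuous cd)) e0).
  by move=> x /(hull_act s)/(coef_bound (s - t) cd Ka)/le_trans; apply; exact: ltW.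
have h2 := integrated_approx cp act_ind a (delta t v) cd.
have h3 := nrm_coord (regular a (delta t v) -
  fop (ind_fun act (fun f => sigma (i f))) (@ind_shift R G H) d (delta t v)) s.
have h4 : nrm (delta t v) <= nrm v := (delta_bounded t v).2.
have h5 : nrm (a - feval i u d) * nrm (delta t v) <= e * nrm v.
  by apply: ler_pM; rewrite ?nrm_ge0// ltW.
have h6 : nrm (regular a (delta t v) s) <= nrm ((regular a (delta t v) -
  fop (ind_fun act (fun f => sigma (i f))) (@ind_shift R G H) d (delta t v)) s) +
  nrm (fop (ind_fun act (fun f => sigma (i f))) (@ind_shift R G H) d (delta t v) s).
  by rewrite l2D l2N -{1}[regular a _ s](subrK
   (fop (ind_fun act (fun f => sigma (i f))) (@ind_shift R G H) d (delta t v) s)) nrmD.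
apply: (le_trans h6).
have -> : e * (3 * nrm v) = e * nrm v + 2 * e * nrm v by ring.
by rewrite lerD// (le_trans h3)// (le_trans h2).
Qed.

(** The vector sum_t psi(t) delta_t (U_t^-1 x): in this copy of [x] the regular
    representation looks like [sigma], up to the coefficients of [psi]. *)
Let spread (T : seq G) (psi : G -> R) (x : H) : l2 G H :=
  \sum_(t <- T) delta t ((psi t)%:C *: sigma (u (- t)) x).

Section Spread.
Variables (T : seq G) (psi : G -> R).
Hypotheses (uT : uniq T) (psi0 : forall t, t \notin T -> psi t = 0).
Hypothesis psi1 : \sum_(s <- T) psi s ^+ 2 = 1.

Lemma spreadE x s : spread T psi x s = (psi s)%:C *: sigma (u (- s)) x.
Proof.
have sumE T' : uniq T' -> (\sum_(t <- T') delta t ((psi t)%:C *: sigma (u (- t)) x)) s =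
    if s \in T' then (psi s)%:C *: sigma (u (- s)) x else 0.
  elim: T' => [|t T' ih] /=; first by rewrite big_nil.
  move=> /andP[tT' uT']; rewrite big_cons l2D ih// deltaE inE.
  by have [->|_] := eqVneq s t; rewrite ?(negPf tT') ?addr0 ?add0r.
by rewrite /spread sumE//; case: ifPn => // /psi0->; rewrite scale0r.
Qed.

Lemma dot_spread z x :
  dot z (spread T psi x) = \sum_(s <- T) (psi s)%:C * dot (z s) (sigma (u (- s)) x).
Proof.
rewrite /spread dot_sumr; apply: eq_bigr => s _.
by rewrite dotC dot_delta -dotC dotZr conj_realC.
Qed.

Lemma nrm_spread x : nrm (spread T psi x) = nrm x.
Proof.
apply/eqP; rewrite -(@eqrXn2 _ 2)// ?nrm_ge0//; apply/eqP; apply: complexI.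
rewrite -dot_nrm dot_spread -[RHS]mul1r -[1]/(1%:C) -psi1 rmorph_sum mulr_suml.
apply: eq_bigr => s _; rewrite spreadE dotZl (covrep_unitary covr) dot_nrm mulrA.
by rewrite -rmorphM -expr2.
Qed.

Lemma dot_regular_spread d x y : fsum_continuous d ->
  dot (fop (ind_fun act (fun f => sigma (i f))) (@ind_shift R G H) d (spread T psi x))
    (spread T psi y) =
  \sum_(p <- d) (\sum_(s <- T) psi s * psi (s - p.2))%:C *
    dot (sigma (i p.1) (sigma (u p.2) x)) y.
Proof.
elim: d => [|p d ih] /=; first by rewrite fop_nil dot0l big_nil.
move=> [cp1 /ih {}ih]; rewrite fop_cons dotDl big_cons ih; congr (_ + _).
rewrite dot_spread rmorph_sum mulr_suml; apply: eq_bigr => s _.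
rewrite (ind_funE act_continuous cX fr _ _ cp1) ind_shiftE spreadE.
have cps := comp_act_continuous act_continuous (s := s) cp1.
rewrite (repZv rep) dotZl mulrA rmorphM; congr (_ * _).
rewrite -(covrep_unitary covr (- s) (sigma (i p.1) (sigma (u p.2) x)) y).
rewrite (covrep_covariant covr (- s) _ cp1) -(repM rep (u (- s)) (u p.2)).
rewrite -(covpair_unitaryD cov) opprB [p.2 - s]addrC; congr (dot (sigma (i _) _) _).
by apply/funext => z; rewrite /translate opprK.
Qed.

End Spread.

(** Amenability: averaged against almost invariant vectors, the matrix
    coefficients of the regular representation converge to those of [sigma]. *)
Lemma regular_faithful a :
  (forall t v, regular a (delta t v) = 0) -> forall x, sigma a x = 0.
Proof.
move=> reg0 x; apply: dot_eq0 => y.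
apply: (@nrm_le_epsM _ R[i]^o _ (2 * (nrm x * nrm y) + 1)) => e e0.
have [d cd ad] := feval_dense cp a e0.
pose c (p : (X -> R[i]^o) * G) := dot (sigma (i p.1) (sigma (u p.2) x)) y.
pose C := \sum_(p <- d) cabs (c p).
have C0 : 0 <= C by apply: sumr_ge0 => p _; exact: nrm_ge0.
have C1 : 0 < C + 1 by rewrite ltr_wpDl.
have [T [psi [uT psi0 psi1 Tpsi]]] :=
  @almost_invariant_vectors G R [seq p.2 | p <- d] _ (divr_gt0 e0 C1).
pose phi g := \sum_(s <- T) psi s * psi (s - g).
have h1 : cabs (\sum_(p <- d) (phi p.2)%:C * c p) <= e * (nrm x * nrm y).
  rewrite -(dot_regular_spread uT psi0 _ _ cd); set z := fop _ _ _ _.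
  have r0 : regular a (spread T psi x) = 0.
    rewrite /spread; elim: (T) => [|t T' ih].
      by rewrite big_nil (rep0v regular_rep).
    by rewrite big_cons (repDv regular_rep) reg0 ih addr0.
  have := integrated_approx cp act_ind a (spread T psi x) cd.
  rewrite -/regular r0 sub0r nrmN -/z (nrm_spread uT psi0 psi1) => hz.
  apply: (le_trans (cauchy_schwarz _ _)); rewrite (nrm_spread uT psi0 psi1) mulrA.
  rewrite ler_wpM2r ?nrm_ge0// (le_trans hz)// ler_wpM2r ?nrm_ge0//.
  exact: ltW.
have h2 : cabs (\sum_(p <- d) c p - \sum_(p <- d) (phi p.2)%:C * c p) <= e.
  apply: (@le_trans _ _ (e / (C + 1) * C)); last first.
    by rewrite mulrAC ler_pdivrMr// ler_wpM2l ?(ltW e0)// lerDl.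
  have le_phi : {in [seq p.2 | p <- d], forall g, cabs (1 - phi g)%:C <= e / (C + 1)}.
    by move=> g /Tpsi; rewrite cabs_real.
  move: (e / (C + 1)) le_phi => r le_phi; rewrite -sumrB /C mulr_sumr.
  elim: (d) le_phi => [|p d' ih] le_phi; first by rewrite !big_nil nrm0.
  rewrite !big_cons (le_trans (@nrmD _ R[i]^o _ _))// lerD//.
    rewrite -{1}[c p]mul1r -mulrBl cabsM ler_wpM2r ?nrm_ge0//.
    by have := le_phi p.2 (mem_head _ _); rewrite rmorphB rmorph1.
  by apply: ih => g gd; apply: le_phi; rewrite inE gd orbT.
have h3 : cabs (dot (sigma a x) y - \sum_(p <- d) c p) <= e * (nrm x * nrm y).
  have -> : \sum_(p <- d) c p = dot (sigma (feval i u d) x) y.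
    by rewrite (rep_feval _ _ rep) /fop dot_suml.
  rewrite -dotNl -dotDl -(repN rep) -(repD rep).
  apply: (le_trans (cauchy_schwarz _ _)); rewrite mulrA ler_wpM2r ?nrm_ge0//.
  rewrite (le_trans (rep_contractive rep _ _))// ler_wpM2r ?nrm_ge0//.
  exact: ltW.
move: h1 h2 h3; set s1 := \sum_(p <- d) _ * _; set s2 := \sum_(p <- d) c p.
move=> h1 h2 h3.
have := @nrmB_trans _ R[i]^o s2 (dot (sigma a x) y) 0.
have := @nrmB_trans _ R[i]^o s1 s2 0; rewrite !subr0.
lra.
Qed.

(** The regular representation is the link: it kills what the family kills, and
    [sigma] kills what it kills. *)
Theorem ideal_intersection a : killed a -> forall x, sigma a x = 0.
Proof. by move=> Ka; apply: regular_faithful; exact: regular_killed. Qed.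

End Family.
End IdealIntersection.

(** * Topology of the circle *)

Section CircleTopology.
Variable R : realType.
Implicit Types (s t x y : R) (c : circle R) (U : set (circle R)).

Local Notation pr := (@to_circle R).

Lemma to_circle_continuous : continuous pr.
Proof. exact: pi_continuous. Qed.

Lemma to_circle_eq x y : pr x = pr y <-> (x - y) \is a Num.int.
Proof. by split=> [/eqmodP|xy]; [|apply/eqmodP]. Qed.

Lemma to_circle_surj c : exists x, pr x = c.
Proof. by exists (repr c); rewrite /to_circle reprK. Qed.

Lemma to_circle_shift x (n : int) : pr (x + n%:~R) = pr x.
Proof. by apply/to_circle_eq; rewrite addrC addKr intr_int. Qed.

Lemma to_circle_eqE x y : pr x = pr y -> exists n : int, x = y + n%:~R.
Proof.
by move=> /to_circle_eq/intrP[n xyn]; exists n; rewrite -xyn addrC subrK.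
Qed.

Lemma open_circleE U : open U <-> open (pr @^-1` U).
Proof. by []. Qed.

Lemma to_circle_open (B : set R) : open B -> open (pr @` B).
Proof.
move=> oB; apply/open_circleE; rewrite openE => t [s Bs /to_circle_eqE[n tn]].
have st : s - n%:~R = t by rewrite tn addrK.
have : nbhs (t + n%:~R) B by apply: open_nbhs_nbhs; split => //; rewrite -st subrK.
move=> /nbhs_ballP[e /= e0 eB]; apply/nbhs_ballP; exists e => // z tz.
exists (z + n%:~R); last exact: to_circle_shift.
by apply: eB; move: tz; rewrite -!ball_normE/= opprD addrACA subrr addr0.
Qed.

Lemma circle_compact : compact [set: circle R].
Proof.
have -> : [set: circle R] = pr @` `[0, 1].
  apply/seteqP; split=> // c _; have [x <-] := to_circle_surj c.
  exists (x - (Num.floor x)%:~R); last by rewrite -mulrNz to_circle_shift.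
  rewrite /= in_itv/= subr_ge0 floor_le_tmp lerBlDl.
  by rewrite ltW// -[X in _ + X]/(1%:~R) -intrD floorD1_gt.
apply: continuous_compact; last exact: segment_compact.
by apply: continuous_subspaceT; exact: to_circle_continuous.
Qed.

Lemma circle_hausdorff : hausdorff_space (circle R).
Proof.
rewrite open_hausdorff => p q; have [x <-] := to_circle_surj p.
have [y <-] := to_circle_surj q => /eqP xy.
pose n := Num.floor (x - y); pose d := x - y - n%:~R.
have d1 : d < 1 by have := floorD1_gt (x - y); rewrite intrD /d -/n; lra.
have d0 : 0 < d.
  rewrite lt_neqAle /d subr_ge0 floor_le_tmp andbT eq_sym subr_eq0.
  by apply/eqP => xyn; apply: xy; apply/to_circle_eq; rewrite xyn intr_int.
pose e := Num.min d (1 - d) / 2.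
have e0 : 0 < e by rewrite divr_gt0// lt_min d0 subr_gt0.
have ed : 2 * e <= d by rewrite mulrC divfK// ge_min lexx.
have e1 : 2 * e <= 1 - d by rewrite mulrC divfK// ge_min lexx orbT.
exists (pr @` ball x e, pr @` ball y e); split=> /=.
- by rewrite inE; exists x => //; exact: ballxx.
- by rewrite inE; exists y => //; exact: ballxx.
- exact: (to_circle_open (ball_open _ _)).
- exact: (to_circle_open (ball_open _ _)).
apply/eqP/seteqP; split=> // c [[a xa <-] [b yb /to_circle_eqE[m bam]]].
move: xa yb; rewrite -!ball_normE/= !ltr_norml => /andP[xa1 xa2] /andP[yb1 yb2].
have dm : d - (- n - m)%:~R = (x - a) - (y - b).
  by rewrite bam /d intrD !mulrNz; ring.
have lt0 : 0 < (- n - m)%:~R :> R by lra.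
have lt1 : (- n - m)%:~R < 1 :> R by lra.
by move: lt0 lt1; rewrite ltr0z gtz0_ge1 ltrz1 ltNge => ->.
Qed.

Lemma ball_connected t (e : R) : connected (ball t e).
Proof. by apply/connected_intervalP; rewrite ball_itv; exact: interval_is_interval. Qed.

(** The circle is locally connected: images of intervals are connected. *)
Lemma circle_component_open U c : open U -> open (connected_component U c).
Proof.
move=> oU; rewrite openE => z cz.
have Uz : U z := connected_component_sub cz.
have [t tz] := to_circle_surj z.
have : nbhs t (pr @^-1` U).
  by apply: open_nbhs_nbhs; split; [exact/open_circleE|rewrite /= tz].
move=> /nbhs_ballP[e /= e0 eU].
have Dz : (pr @` ball t e) z by exists t => //; exact: ballxx.
have sub : pr @` ball t e `<=` connected_component U c.
  rewrite (same_connected_component cz); apply: connected_component_max => //.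
    by move=> _ [s ts <-]; exact: eU.
  apply: connected_continuous_connected; first exact: ball_connected.
  by apply: continuous_subspaceT; exact: to_circle_continuous.
apply: filterS sub _; apply: open_nbhs_nbhs; split => //.
exact: (to_circle_open (ball_open _ _)).
Qed.

Section Components.
Variable U : set (circle R).
Hypothesis oU : open U.

Let V := pr @^-1` U.

Let V_shift t (n : int) : V (t + n%:~R) <-> V t.
Proof. by rewrite /V /preimage/= to_circle_shift. Qed.

Let V_ball t : V t -> exists2 e : R, 0 < e & forall s, `|t - s| < e -> V s.
Proof.
move=> Vt; have : nbhs t V.
  by apply: open_nbhs_nbhs; split => //; exact/open_circleE.
by move=> /nbhs_ballP[e /= e0 eV]; exists e.
Qed.

Definition joined s t : Prop :=
  forall z, (s <= z <= t) || (t <= z <= s) -> U (pr z).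

Lemma joined_trans s t x : joined s t -> joined t x -> joined s x.
Proof.
move=> st tx z sz.
have [/st//|nst] := boolP ((s <= z <= t) || (t <= z <= s)).
apply: tx; move: nst; rewrite negb_or !negb_and => /andP[n1 n2].
case/orP: sz => /andP[h1 h2]; apply/orP; [left|right].
  by move: n1; rewrite h1/= -ltNge => /ltW->.
by move: n2; rewrite h2 orbF -ltNge => /ltW->; rewrite h1.
Qed.

(** The points that can be reached from [s] along segments form an open set, and
    so do the points of U that cannot. *)
Lemma component_joined s c : U (pr s) -> connected_component U (pr s) c ->
  exists2 t, pr t = c & joined s t.
Proof.
move=> Us Uc; pose E := [set c | exists2 t, pr t = c & joined s t].
have near_joined t e : (forall s, `|t - s| < e -> V s) ->
    forall t', `|t - t'| < e -> joined t t'.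
  move=> eV t'; rewrite ltr_norml => /andP[h1 h2] z /orP[] /andP[z1 z2];
    by apply: eV; rewrite ltr_norml; lra.
have joined_end t : joined s t -> V t.
  by move=> st; apply: st; rewrite !lexx andbT/= le_total.
have oE : open E.
  rewrite openE => _ [t <- st]; have [e e0 eV] := V_ball (joined_end _ st).
  apply: (@filterS _ _ _ (pr @` ball t e)); last first.
    apply: open_nbhs_nbhs; split; first exact: (to_circle_open (ball_open _ _)).
    by exists t => //; exact: ballxx.
  move=> _ [t' tt' <-]; exists t' => //; apply: (joined_trans st).
  by apply: near_joined eV _ _; move: tt'; rewrite -ball_normE.
have oE' : open (U `\` E).
  rewrite openE => c' [Uc' nEc']; have [t tc'] := to_circle_surj c'.
  have [e e0 eV] : exists2 e : R, 0 < e & forall s, `|t - s| < e -> V s.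
    by apply: V_ball; rewrite /V /= tc'.
  apply: (@filterS _ _ _ (pr @` ball t e)); last first.
    apply: open_nbhs_nbhs; split; first exact: (to_circle_open (ball_open _ _)).
    by exists t => //; exact: ballxx.
  move=> _ [t' tt' <-]; have {}tt' : `|t - t'| < e by move: tt'; rewrite -ball_normE.
  split; first exact: eV.
  move=> [t'' /to_circle_eqE[n t''n] st'']; apply: nEc'.
  exists (t + n%:~R); first by rewrite to_circle_shift.
  apply: (joined_trans st''); rewrite t''n => z z1.
  have -> : z = (z - n%:~R) + n%:~R by rewrite subrK.
  apply/V_shift; apply: (near_joined _ _ eV _ tt').
  by rewrite !lerBlDr !lerBrDr orbC.
suff CE : connected_component U (pr s) `&` E = connected_component U (pr s).
  have [_] : (connected_component U (pr s) `&` E) c by rewrite CE.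
  exact.
apply: (@component_connected _ U (pr s)).
- exists (pr s); split; first exact: connected_component_refl.
  exists s => // z; rewrite orbb => /andP[sz zs].
  by have -> : z = s by apply/eqP; rewrite eq_le zs.
- by exists E.
- exists (~` (U `\` E)); first exact: open_closedC.
  apply/seteqP; split=> c' [Cc' Ec']; split=> //; first by case.
  apply: contrapT => nE; apply: Ec'; split=> //.
  exact: connected_component_sub Cc'.
Qed.

(** The lift F is onto and respects U, so it maps the right endpoint of a lifted
    component to the right endpoint of the image, an integer translate of the
    same component. *)
Lemma component_fixed_point (phi : circle R -> circle R) c :
  (exists c', ~ U c') -> orientation_preserving phi ->
  (forall c, exists c', phi c' = c) -> (forall c, U (phi c) <-> U c) ->
  U c -> connected_component U c (phi c) -> exists b, phi b = b.
Proof.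
move=> [c0 nUc0] [F [Finc F1 Flift]] phi_surj phiU.
have [s <-] := to_circle_surj c => Us /(component_joined Us)[t tphi st].
have [y0 y0c] := to_circle_surj c0.
have Fn x (n : nat) : F (x + n%:R) = F x + n%:R.
  elim: n => [|n ih]; first by rewrite !addr0.
  by rewrite -natr1 addrA F1 ih addrA.
have Fz x (n : int) : F (x + n%:~R) = F x + n%:~R.
  case: n => n; first exact: Fn.
  rewrite NegzE mulrNz; apply/eqP; rewrite eq_sym subr_eq; apply/eqP.
  by rewrite -[_ *~ _]/(n.+1%:R) -Fn subrK.
have Fsurj x : exists z, F z = x.
  have [c' c'x] := phi_surj (pr x); have [z zc'] := to_circle_surj c'.
  move: c'x; rewrite -zc' -Flift => /esym/to_circle_eqE[n xn].
  by exists (z + n%:~R); rewrite Fz.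
have VF x : V (F x) <-> V x by rewrite /V /preimage/= Flift; exact: phiU.
have Fle x y : F x < F y -> x < y.
  move=> Fxy; rewrite ltNge le_eqVlt; apply/negP => /orP[/eqP yx|/Finc yx].
    by move: Fxy; rewrite yx ltxx.
  by have := lt_trans Fxy yx; rewrite ltxx.
have [n Fsn] : exists n : int, F s = t + n%:~R.
  by apply: to_circle_eqE; rewrite Flift tphi.
pose S := [set y | s <= y /\ ~ V y].
have S0 : S !=set0.
  pose m := Num.ceil (s - y0); exists (y0 + m%:~R); split.
    by rewrite -lerBlDl ceil_ge.
  by move=> /V_shift; rewrite /V /= y0c.
have lbS : has_lbound S by exists s => y [].
pose b := inf S.
have sb : s <= b by apply: lb_le_inf => // y [].
have V_lt z : s <= z -> z < b -> V z.
  move=> sz zb; apply: contrapT => nVz.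
  by have := ge_inf lbS (conj sz nVz : S z); rewrite leNgt zb.
have nVb : ~ V b.
  move=> /V_ball[e e0 eV]; have [|y [sy nVy] yb] := @inf_adherent _ S e e0.
    by split.
  apply: (nVy); apply: eV; have by_ : b <= y := ge_inf lbS (conj sy nVy : S y).
  by rewrite ltr_norml; move: yb by_; rewrite -/b; lra.
have tb : t < b.
  rewrite ltNge; apply/negP => bt; apply: nVb; apply: st.
  by rewrite sb bt.
have V_lt' z : t <= z -> z < b -> V z.
  move=> tz zb; have [sz|zs] := leP s z; first exact: V_lt.
  by apply: st; rewrite tz (ltW zs) orbT.
have sb' : s < b.
  rewrite lt_neqAle sb andbT; apply/eqP => sb0; apply: nVb.
  by rewrite -sb0.
suff Fb : F b = b + n%:~R by exists (pr b); rewrite -Flift Fb to_circle_shift.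
apply/eqP; rewrite eq_le; apply/andP; split; rewrite leNgt; apply/negP => h.
  have [z Fz'] := Fsurj (b + n%:~R).
  have zb : z < b by apply: Fle; rewrite Fz'.
  have sz : s < z by apply: Fle; rewrite Fz' Fsn ltrD2r.
  by apply: nVb; apply/(V_shift b n); rewrite -Fz'; apply/VF; exact: V_lt (ltW sz) zb.
apply: nVb; apply/VF.
have -> : F b = (F b - n%:~R) + n%:~R by rewrite subrK.
apply/V_shift; apply: V_lt'; last by rewrite ltrBlDr.
by rewrite lerBrDr -Fsn ltW// Finc.
Qed.

End Components.
End CircleTopology.

(** * Dynamics of a free Denjoy action *)

Section SubtypeTopology.
Variables (X : topologicalType) (Y : set X).

Lemma set_val_continuous : continuous (fun y : set_type Y => set_val y : X).
Proof. exact: initial_continuous. Qed.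

Lemma open_set_typeP (B : set (set_type Y)) :
  open B -> exists2 W : set X, open W & set_val @^-1` W = B.
Proof. by []. Qed.

Lemma compact_set_type : compact Y -> compact [set: set_type Y].
Proof.
move=> cY F PF _; pose F' := (fun y : set_type Y => set_val y : X) @ F.
have FY : F' Y.
  change (F (set_val @^-1` Y)).
  by apply: filterS filterT => y _; exact: (set_valP y).
have [p [Yp cp]] := cY F' _ FY.
exists (SigSub (mem_set Yp)); split=> // B N FB.
rewrite nbhsE => -[_ [[W oW <-] Wp] WN].
have [|_ [[b Bb <-] Wb]] := cp [set set_val b | b in B] W _ (open_nbhs_nbhs (conj oW Wp)).
  change (F (set_val @^-1` [set set_val b | b in B])).
  by apply: filterS FB => b Bb; exists b.
by exists b; split => //; exact: WN.
Qed.

End SubtypeTopology.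

Lemma homeomorphism_closed (X Y : topologicalType) (h : X -> Y) (k : Y -> X) :
  cancel h k -> cancel k h -> (forall C, closed C -> closed (h @^-1` C)) ->
  (forall C, closed C -> closed (h @` C)) -> homeomorphism h.
Proof.
move=> hk kh hc hi; split; first by apply/continuous_closedP.
exists k; split=> //; apply/continuous_closedP => C cC.
have -> : k @^-1` C = h @` C; last exact: hi.
by apply/seteqP; split=> [y Cky|_ [x Cx <-]];
  [exists (k y)|rewrite /preimage/= hk].
Qed.

Section OrbitClosure.
Variables (G : zmodType) (X : topologicalType) (act : G -> X -> X).
Hypotheses (act_action : is_action act) (act_continuous : forall g, continuous (act g)).

Lemma actK g x : act (- g) (act g x) = x.
Proof. by rewrite -(proj2 act_action) addNr (proj1 act_action). Qed.

Lemma actVK g x : act g (act (- g) x) = x.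
Proof. by rewrite -(proj2 act_action) subrr (proj1 act_action). Qed.

Lemma orbit_closure_invariant x : invariant_set act (closure (orbit_of act x)).
Proof.
move=> g z xz B Bz; have [_ [[h _ <-] Bw]] := xz _ (act_continuous Bz).
exists (act g (act h x)); split => //.
by exists (g + h) => //; rewrite (proj2 act_action).
Qed.

Lemma zero_on_closure (R : realType) (f : X -> R[i]^o) (S : set X) : continuous f ->
  (forall x, S x -> f x = 0) -> forall x, closure S x -> f x = 0.
Proof.
move=> /continuous_nrmP cf f0 x Sx; apply: (@nrm_le_eps _ R[i]^o) => e e0.
have [y [Sy /= xy]] := Sx _ (cf x e e0).
by move: xy; rewrite (f0 _ Sy) subr0 => /ltW.
Qed.

End OrbitClosure.

Section Denjoy.
Variables (R : realType) (G : zmodType) (act : G -> circle R -> circle R).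
Hypotheses (act_denjoy : denjoy_action act) (act_free : free_action act).
Variable Y : set (circle R).
Hypothesis Y_minimal : minimal_set act Y.

Let act_action : is_action act. Proof. by case: act_denjoy. Qed.
Let act_continuous g : continuous (act g).
Proof. by case: act_denjoy => _ /(_ g)[]. Qed.

Let oU : open (~` Y).
Proof. by case: Y_minimal => _ cY _ _; exact: closed_openC. Qed.

Lemma gap_invariant g x : (~` Y) (act g x) <-> (~` Y) x.
Proof.
have invY : invariant_set act Y by case: Y_minimal.
split=> [nY /(invY g)//|nY /(invY (- g))].
by rewrite (actK act_action).
Qed.

(** A group element that preserves a component fixes its endpoint, and the
    action is free. *)
Lemma component_stabiliser g x : (~` Y) x ->
  connected_component (~` Y) x (act g x) -> g = 0.
Proof.
move=> Ux Cgx; have [b] : exists b, act g b = b; last exact: act_free.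
apply: (component_fixed_point oU _ _ _ _ Ux Cgx).
- by have [[y Yy] _ _ _] := Y_minimal; exists y => /(_ Yy).
- by case: act_denjoy => _ /(_ g)[].
- by move=> c; exists (act (- g) c); exact: actVK.
- by move=> c; exact: gap_invariant.
Qed.

Lemma component_act g x : (~` Y) x ->
  act g @` connected_component (~` Y) x = connected_component (~` Y) (act g x).
Proof.
have sub h y : (~` Y) y ->
    act h @` connected_component (~` Y) y `<=` connected_component (~` Y) (act h y).
  move=> Uy; apply: connected_component_max.
  - by exists y => //; exact: connected_component_refl.
  - by move=> _ [z /connected_component_sub Uz <-]; exact/gap_invariant.
  - apply: connected_continuous_connected; first exact: component_connected.
    by apply: continuous_subspaceT; exact: act_continuous.
move=> Ux; apply/seteqP; split; first exact: sub.
move=> z zC; exists (act (- g) z); last exact: actVK.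
have Ugx : (~` Y) (act g x) by exact/gap_invariant.
by have := sub (- g) _ Ugx (act (- g) z); rewrite (actK act_action); apply; exists z.
Qed.

Lemma component_eq x y : connected_component (~` Y) x y ->
  connected_component (~` Y) y = connected_component (~` Y) x.
Proof. by move=> xy; rewrite (same_connected_component xy). Qed.

(** An orbit accumulates somewhere by compactness, and not in a gap, since a gap
    contains at most one of its points. *)
Lemma minimal_sub_closure x : Y `<=` closure (orbit_of act x).
Proof.
pose Z := closure (orbit_of act x).
have [[z [Zz Yz]]|nZY] := pselect ((Z `&` Y) !=set0).
  have [_ cY invY minY] := Y_minimal.
  suff <- : Z `&` Y = Y by move=> y [].
  apply: minY.
  - by exists z.
  - by apply: closedI => //; exact: closed_closure.
  - move=> g y [Zy Yy]; split; last exact: invY.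
    have invZ := @orbit_closure_invariant _ _ _ act_action act_continuous x.
    exact: invZ.
  - by move=> y [].
have [_ _ _ /(_ x)] := act_denjoy; case.
pose B w := if pselect ((~` Y) w) then connected_component (~` Y) w else ~` Z.
have [||s _ sB] := @compact_finite_cover _ [set: circle R] B.
- exact: circle_compact.
- move=> w _; rewrite /B; case: pselect => Uw; apply: open_nbhs_nbhs; split.
  + exact: circle_component_open.
  + exact: connected_component_refl.
  + exact/closed_openC/closed_closure.
  + by move=> Zw; apply: nZY; exists w; split => //; exact: contrapT.
have -> : orbit_of act x = \bigcup_(w in [set` s]) (orbit_of act x `&` B w).
  apply/seteqP; split=> [y xy|y [w _ []]//].
  by have [w ws Bwy] := sB y I; exists w.
apply: bigcup_finite; first exact: finite_seq.
move=> w _; rewrite /B; case: pselect => Uw; last first.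
  rewrite (_ : _ `&` _ = set0) ?finite_set0//; apply/seteqP; split=> // y [xy].
  by apply; exact: subset_closure.
have [[y [xy Cy]]|C0] := pselect ((orbit_of act x `&` connected_component (~` Y) w) !=set0).
  apply: (@sub_finite_set _ _ [set y]); last exact: finite_set1.
  move=> y' [xy' Cy']; move: xy xy' Cy Cy' => [g _ <-] [g' _ <-] Cy Cy' /=.
  have Uy := connected_component_sub Cy.
  have : connected_component (~` Y) (act g x) (act (g' - g) (act g x)).
    by rewrite -(proj2 act_action) subrK (component_eq Cy).
  by move=> /(component_stabiliser Uy)/eqP; rewrite subr_eq0 => /eqP->.
rewrite (_ : _ `&` _ = set0) ?finite_set0//; apply/seteqP; split=> // y Cy.
by apply: C0; exists y.
Qed.

Section Transversal.
Variable reps : set (set (circle R)).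
Hypothesis reps_transversal : component_transversal act (~` Y) reps.

Let Y0 := \bigcup_(C in reps) C.

Let reps_component D y : reps D -> D y -> D = connected_component (~` Y) y.
Proof.
by move=> /(proj1 reps_transversal)[x _ <-] /component_eq.
Qed.

Lemma transversal_gap x : Y0 x -> (~` Y) x.
Proof.
move=> [D Dreps Dx]; have DE := reps_component Dreps Dx.
by move: Dx; rewrite DE => /connected_component_sub.
Qed.

Lemma transversal_open : open Y0.
Proof.
apply: bigcup_open => D /(proj1 reps_transversal)[x _ <-].
exact: circle_component_open.
Qed.

(** [Y0] is a fundamental domain for the action on the gaps. *)
Lemma transversal_free g x : Y0 x -> Y0 (act g x) -> g = 0.
Proof.
move=> Y0x [D Dreps Dgx]; have Ux := transversal_gap Y0x.
have [D' D'reps D'x] := Y0x.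
have D'E := reps_component D'reps D'x; have DE := reps_component Dreps Dgx.
have CU : components (~` Y) D' by exact: (proj1 reps_transversal).
have [E [_ Euniq]] := proj2 reps_transversal D' CU.
have ED' : E = D'.
  apply: Euniq; split=> //; exists 0; rewrite (_ : act 0 = id) ?image_id//.
  by apply/funext => z; exact: (proj1 act_action).
have ED : E = D by apply: Euniq; split=> //; exists g; rewrite D'E component_act.
by apply: (component_stabiliser Ux); rewrite -D'E -ED' ED.
Qed.

Lemma transversal_meets x : (~` Y) x -> exists g, Y0 (act g x).
Proof.
move=> Ux; have CU : components (~` Y) (connected_component (~` Y) x) by exists x.
have [D [[Dreps [g DE]] _]] := proj2 reps_transversal _ CU.
exists g; exists D => //; rewrite DE; exists x => //.
exact: connected_component_refl.
Qed.

End Transversal.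
End Denjoy.

(** * Primitive ideals of a crossed product by a free action *)

Section EvaluationRep.
Variables (R : realType) (X : topologicalType).

Definition point_eval (x : X) (f : X -> R[i]^o) (v : cline R) : cline R := f x *: v.

Lemma point_eval_rep x : function_rep (point_eval x).
Proof.
split=> //.
- by move=> f _ k v w; rewrite /point_eval scalerDr !scalerA mulrC.
- by move=> k f g v _ _; rewrite /point_eval scalerDl scalerA.
- by move=> v; rewrite /point_eval scale1r.
- by move=> f g v _ _; rewrite /point_eval scalerA.
- by move=> f v w _; rewrite /point_eval dotZl dotZr.
Qed.

End EvaluationRep.

Section UnitalReps.
Variables (R : realType) (A : cstarAlgType R).

(** The vectors fixed by rho(1) form a closed invariant subspace, which contains
    the range of every rho(a). *)
Lemma irreducible_unital (H : hilbertType R) (rho : A -> H -> H) :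
  representation rho -> irreducible_rep rho -> unital_rep rho.
Proof.
move=> rep [[a [x /eqP ax]] irr]; pose K := [set y | rho cone y = y].
suff KT : K = setT by move=> y; have : K y by rewrite KT.
have [||||K0|//] := irr K.
- rewrite closure_id; apply/seteqP; split; first exact: subset_closure.
  move=> y /closure_nrm Ky; apply/subr0_eq; apply: nrm_le_eps => e e0.
  have e3 : 0 < e / (nrm (cone : A) + 1).
    by rewrite divr_gt0// ltr_wpDl ?nrm_ge0.
  have [z Kz yz] := Ky _ e3.
  have -> : rho cone y - y = rho cone (y - z) + (z - y).
    by rewrite (repBv rep) Kz addrA subrK.
  apply: (le_trans (nrmD _ _)); rewrite (nrmBC z y).
  have := rep_contractive rep cone (y - z).
  move=> h; apply: (@le_trans _ _ ((nrm (cone : A) + 1) * nrm (y - z))).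
    by rewrite mulrDl mul1r lerD2r.
  by rewrite mulrC -ler_pdivlMr ?ltW// ltr_wpDl ?nrm_ge0.
- exact: (rep0v rep).
- by move=> k y z Ky Kz; rewrite /K /= (repDv rep) (repZv rep) Ky Kz.
- by move=> b y Ky; rewrite /K /= -(repM rep) cmul1l.
case: ax; have : K (rho a x) by rewrite /K /= -(repM rep) cmul1l.
by rewrite K0.
Qed.

Lemma closed_prim (F : set (prim A)) : closed F <-> hull_kernel F `<=` F.
Proof.
rewrite -closure_primE closure_id; split=> [<-//|h].
by apply/seteqP; split=> //; exact: subset_closure.
Qed.

Lemma prim_kernel (P : prim A) : exists (H : hilbertType R) (rho : A -> H -> H),
  [/\ representation rho, unital_rep rho & ideal_of P = rep_kernel rho].
Proof.
have [H [rho [rep irr PE]]] := svalP P; exists H, rho; split=> //.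
exact: irreducible_unital.
Qed.

End UnitalReps.

Section CrossedProductPrim.
Variables (R : realType) (G : zmodType) (X : topologicalType).
Variable act : G -> X -> X.
Hypotheses (act_action : is_action act) (act_continuous : forall g, continuous (act g)).
Hypotheses (cX : compact [set: X]).
Variables (A : cstarAlgType R) (i : (X -> R[i]^o) -> A) (u : G -> A).
Hypothesis cp : crossed_product act i u.
Let cov := cp_covariant cp.
Implicit Types (f : X -> R[i]^o) (d : fsum R G X) (g s t : G) (x y : X).

Lemma integrated_unital (H : hilbertType R) (pi : (X -> R[i]^o) -> H -> H)
    (U : G -> H -> H) (covr : covariant_rep act pi U) : unital_rep (integrated cp covr).
Proof.
move=> x; rewrite -(covpair_1 cov) (integrated_function cp covr) ?(covrep_1 covr)//.
exact: continuous_constC.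
Qed.

Section OrbitRep.
Variable x : X.

Let one : cline R := (1 : R[i]).

Definition orbit_covariant :=
  ind_covariant act_action act_continuous cX (@point_eval_rep R X x).

(** For a free action G is the orbit of [x], and this is the representation on
    the square-summable functions on the orbit. *)
Definition orbit_rep : A -> l2 G (cline R) -> l2 G (cline R) :=
  integrated cp orbit_covariant.

Lemma orbit_rep_rep : representation orbit_rep.
Proof. exact: (integrated_representation act_continuous cp orbit_covariant). Qed.

Lemma orbit_rep_unital : unital_rep orbit_rep.
Proof. exact: integrated_unital. Qed.

Lemma orbit_rep_function f (z : l2 G (cline R)) s : continuous f ->
  orbit_rep (i f) z s = f (act s x) *: z s.
Proof.
move=> cf; rewrite /orbit_rep (integrated_function cp orbit_covariant _ cf).
by rewrite (ind_funE act_continuous cX (@point_eval_rep R X x) _ _ cf).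
Qed.

Lemma orbit_rep_unitary g (z : l2 G (cline R)) : orbit_rep (u g) z = ind_shift g z.
Proof. exact: integrated_unitary. Qed.

Lemma orbit_kernel_function f : continuous f ->
  rep_kernel orbit_rep (i f) <-> forall s, f (act s x) = 0.
Proof.
move=> cf; split=> [Kf s|f0 z]; last first.
  by apply: l2_ext => s; rewrite (orbit_rep_function _ _ cf) f0 scale0r.
have := congr1 (fun z : l2 G (cline R) => z s) (Kf (delta s one)).
rewrite (orbit_rep_function _ _ cf) deltaE eqxx => h.
by rewrite -[LHS]mulr1; exact: h.
Qed.

Section Irreducible.
Hypotheses (act_free : free_action act) (hX : hausdorff_space X).

Let clineE (v : cline R) : v = (v : R[i]) *: one.
Proof. by rewrite -[LHS](mulr1 (v : R[i])). Qed.

(** A bump function at a point of the orbit cuts a vector down to nearly a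
    single coordinate, so an invariant subspace contains a basis vector, hence
    all its translates. *)
Lemma orbit_rep_irreducible : irreducible_rep orbit_rep.
Proof.
split.
  exists cone, (delta 0 one); rewrite orbit_rep_unital; apply/eqP => d0.
  have := congr1 (fun z : l2 G (cline R) => z 0) d0.
  by rewrite deltaE eqxx => /eqP; rewrite (oner_eq0 R[i]).
move=> K cK K0 Klin Kinv; have [K00|nK0] := pselect (K `<=` [set 0]).
  by left; apply/seteqP; split=> // _ ->.
right; apply/seteqP; split=> // w _.
have [z Kz z0] : exists2 z, K z & z <> 0.
  by apply: contrapT => nz; apply: nK0 => z Kz; apply: contrapT => z0; apply: nz; exists z.
have [g zg] : exists g, z g <> 0.
  by apply: contrapT => nz; apply: z0; apply: l2_ext => s; apply: contrapT => zs;
     apply: nz; exists s.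
have Kcl (y : l2 G (cline R)) :
    (forall e : R, 0 < e -> exists2 y', K y' & nrm (y - y') < e) -> K y.
  by move=> h; rewrite (iffLR (closure_id K) cK); apply/closure_nrm.
have KZ (k : R[i]) (y : l2 G (cline R)) : K y -> K (k *: y).
  by move=> Ky; rewrite -[k *: y]addr0; exact: Klin.
have Kdg : K (delta g (z g)).
  apply: Kcl => e e0; have e2 : 0 < e / 2 by rewrite divr_gt0.
  have [S _ tail] := l2_tail z e2.
  have [h [ch h01 hg h0]] := @displaced_bump R G X act act_continuous act_free cX hX
    [seq s - g | s <- S] (act g x).
  have cH := continuous_realC ch.
  exists (orbit_rep (i (fun y => (h y)%:C)) z); first exact: Kinv.
  rewrite nrmBC (@le_lt_trans _ _ (e / 2))//; last by rewrite ltr_pdivrMr// mulr2n mulrDr mulr1 ltrDl.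
  have coord s : (orbit_rep (i (fun y => (h y)%:C)) z - delta g (z g)) s =
      if s == g then 0 else (h (act s x))%:C *: z s.
    rewrite l2D l2N (orbit_rep_function _ _ cH) deltaE.
    by case: eqP => [->|_]; rewrite ?subr0// hg scale1r subrr.
  apply: tail => s; rewrite coord; case: eqVneq => // sg.
  - move=> sS; have := h0 (s - g) (map_f _ sS); rewrite subr_eq0 => /(_ sg (act g x)).
    by rewrite hg mul1r -(proj2 act_action) subrK => ->; rewrite scale0r.
  - by rewrite nrm0 nrm_ge0.
  - have /andP[hs0 hs1] := h01 (act s x).
    by rewrite nrmZ cabs_real ger0_norm// ler_piMl ?nrm_ge0.
have Kd1 : K (delta g one).
  have -> : delta g one = ((z g : R[i])^-1) *: delta g (z g).
    apply: l2_ext => s; rewrite l2Z !deltaE; case: eqP => _; last by rewrite scaler0.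
    have zg0 : (z g : R[i]) != 0 by apply/eqP.
    exact: (esym (mulVf zg0)).
  exact: KZ.
have Kds s (v : cline R) : K (delta s v).
  have -> : delta s v = (v : R[i]) *: orbit_rep (u (s - g)) (delta g one).
    rewrite orbit_rep_unitary ind_shift_delta addrC subrK.
    apply: l2_ext => t; rewrite l2Z !deltaE; case: eqP => _; last by rewrite scaler0.
    exact: clineE.
  exact/KZ/Kinv.
apply: Kcl => e e0; have e2 : 0 < e / 2 by rewrite divr_gt0.
have [S _ wS] := l2_expansion w e2.
exists (\sum_(s <- S) delta s (w s)).
  elim: S {wS} => [|s S ih]; first by rewrite big_nil.
  by rewrite big_cons -[delta _ _]scale1r; exact: Klin.
by rewrite (le_lt_trans wS)// ltr_pdivrMr// mulr2n mulrDr mulr1 ltrDl.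
Qed.

Lemma orbit_kernel_primitive : primitive_ideal (rep_kernel orbit_rep).
Proof.
exists (l2 G (cline R)), orbit_rep; split=> //.
- exact: orbit_rep_rep.
- exact: orbit_rep_irreducible.
Qed.

Definition orbit_prim : prim A := exist _ _ orbit_kernel_primitive.

Lemma orbit_primP f : continuous f ->
  ideal_of orbit_prim (i f) <-> forall s, f (act s x) = 0.
Proof. exact: orbit_kernel_function. Qed.

End Irreducible.
End OrbitRep.

Section Prim.
Hypotheses (act_free : free_action act) (hX : hausdorff_space X).

Lemma prim_family_kernels (F : set (prim A)) (P : set A) :
  [set ideal_of Q | Q in F] P -> exists (H : hilbertType R) (rho : A -> H -> H),
    [/\ representation rho, unital_rep rho & P = rep_kernel rho].
Proof. by move=> [Q _ <-]; exact: prim_kernel. Qed.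

Lemma killed_primE (F : set (prim A)) :
  killed [set ideal_of Q | Q in F] = \bigcap_(Q in F) ideal_of Q.
Proof.
apply/seteqP; split=> a h; first by move=> Q FQ; apply: h; exists Q.
by move=> _ [Q FQ <-]; exact: h.
Qed.

(** The topology of Prim(A) only sees the functions in each ideal. *)
Lemma hull_kernelP (F : set (prim A)) (P : prim A) : hull_kernel F P <->
  forall f, continuous f -> (forall Q, F Q -> ideal_of Q (i f)) -> ideal_of P (i f).
Proof.
split=> [hP f cf Ff|h]; first by apply: hP => Q; exact: Ff.
have [H [rho [rep un PE]]] := prim_kernel P.
move=> a; rewrite -killed_primE PE => Ka.
apply: (ideal_intersection act_action act_continuous cX cp act_free hX
  (@prim_family_kernels F) rep un _ Ka) => f [cf].
rewrite killed_primE => Kf.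
by have := h f cf Kf; rewrite PE.
Qed.

Lemma prim_eqP (P Q : prim A) :
  (forall f, continuous f -> ideal_of P (i f) <-> ideal_of Q (i f)) -> P = Q.
Proof.
move=> PQ; have sub (P1 P2 : prim A) :
    (forall f, continuous f -> ideal_of P1 (i f) -> ideal_of P2 (i f)) ->
    ideal_of P1 `<=` ideal_of P2.
  move=> h a P1a; have /hull_kernelP : forall f, continuous f ->
    (forall Q, [set P1] Q -> ideal_of Q (i f)) -> ideal_of P2 (i f).
    by move=> f cf /(_ P1 erefl); exact: h.
  by apply=> _ ->.
have E : ideal_of P = ideal_of Q.
  by apply/seteqP; split; apply: sub => f cf /(PQ f cf).
move: P Q E {PQ sub} => [P hP] [Q hQ] /= PQ; rewrite /ideal_of/= in PQ.
by subst Q; congr exist; exact: Prop_irrelevance.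
Qed.

Definition prim_hull (P : prim A) : set X :=
  [set x | forall f, continuous f -> ideal_of P (i f) -> f x = 0].

Lemma prim_hull_act (P : prim A) g x : prim_hull P x -> prim_hull P (act g x).
Proof.
have E : prim_hull P = hull i [set ideal_of Q | Q in [set P]].
  apply/seteqP; split=> z h f.
    move=> [cf]; rewrite killed_primE => Kf; apply: h => //.
    exact: Kf.
  move=> cf Pf; apply: h; split=> //; rewrite killed_primE => _ ->.
  exact: Pf.
rewrite E; apply: (hull_act act_continuous cp).
exact: prim_family_kernels.
Qed.

Lemma prim_hullP (P : prim A) f : continuous f ->
  (forall x, prim_hull P x -> f x = 0) -> ideal_of P (i f).
Proof.
move=> cf f0; have [H [rho [rep un PE]]] := prim_kernel P; rewrite PE => v.
have PsK := @prim_family_kernels [set P].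
apply: (@nrm_le_epsM _ _ _ (2 * nrm v)) => e e0; rewrite mulrA (mulrC e).
apply: (sigma_hull_bound cX cp PsK rep un _ v cf e0).
  move=> f' [cf']; rewrite killed_primE => /(_ P erefl).
  by rewrite PE.
move=> x hx; rewrite f0 ?nrm0 ?ltW// => f' cf' Pf'; apply: hx; split=> //.
by rewrite killed_primE => _ ->.
Qed.

(** Primitive ideals are prime, so their hulls are irreducible as invariant sets:
    the functions [h] and [h'] generate ideals with product zero. *)
Lemma prim_hull_prime (P : prim A) (h h' : X -> R) x x' :
  continuous h -> continuous h' -> prim_hull P x -> prim_hull P x' ->
  (forall g y, h y * h' (act g y) = 0) -> h x = 0 \/ h' x' = 0.
Proof.
move=> ch ch' Px Px' hh'.
have cH := continuous_realC ch; have cH' := continuous_realC ch'.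
have [H [rho [rep un PE]]] := prim_kernel P.
suff : forall c, sval P (cmul (i (fun y => (h y)%:C)) (cmul c (i (fun y => (h' y)%:C)))).
  move=> /(primitive_ideal_prime (svalP P))[/(Px _ cH)|/(Px' _ cH')] /complexI ->.
    by left.
  by right.
move=> c; rewrite -/(ideal_of P) PE => v; rewrite !(repM rep).
set w := rho (i (fun y => (h' y)%:C)) v; move: c.
have K0 := nrm_ge0 (i (fun y => (h y)%:C)).
apply: (@feval_dense_eq R G X act A i u cp H
   (fun c => rho (i (fun y => (h y)%:C)) (rho c w)) (fun=> 0)
   (nrm (i (fun y => (h y)%:C)) * nrm w) 0).
- move=> a b; have -> : rho (i (fun y => (h y)%:C)) (rho a w) -
      rho (i (fun y => (h y)%:C)) (rho b w) =
      rho (cmul (i (fun y => (h y)%:C)) (a - b)) w.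
    by rewrite (repM rep) (repD rep) (repN rep) (repBv rep).
  rewrite (le_trans (rep_contractive rep _ _))// mulrA ler_wpM2r ?nrm_ge0//.
  by rewrite mulrC nrm_cmul.
- by move=> a b; rewrite subrr nrm0 mulr0.
move=> d cd; rewrite /w -!(repM rep) -cmulA; have -> : cmul (i (fun y => (h y)%:C))
    (cmul (feval i u d) (i (fun y => (h' y)%:C))) = 0.
  elim: d cd => [|p d ih] /=; first by rewrite feval_nil cmul0l cmul0r.
  move=> [cp1 /ih {}ih]; rewrite feval_cons cmulDl cmulDr ih addr0.
  rewrite -[cmul (cmul (i p.1) _) _]cmulA (covpair_covariant cov _ cH').
  have cT := translate_continuous act_continuous (g := p.2) cH'.
  rewrite !cmulA -(covpair_M cov cH cp1) -(covpair_M cov (continuousMC cH cp1) cT).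
  have -> : (fun y => (h y)%:C * p.1 y * translate act p.2 (fun z : X => (h' z)%:C) y) =
      fun=> 0.
    by apply/funext => y; rewrite /translate mulrAC -rmorphM hh' mul0r.
  by rewrite (covpair_0 cov) cmul0l.
by rewrite (rep0 rep).
Qed.

End Prim.
End CrossedProductPrim.

(** * The kernel of the restriction map *)

Section Restriction.
Variables (R : realType) (G : zmodType) (X : topologicalType).
Variable act : G -> X -> X.
Hypotheses (act_action : is_action act) (act_continuous : forall g, continuous (act g)).
Hypotheses (act_free : free_action act) (cX : compact [set: X]) (hX : hausdorff_space X).
Variables (Y : set X) (Yclosed : closed Y) (invY : invariant_set act Y).
Variables (A : cstarAlgType R) (i : (X -> R[i]^o) -> A) (u : G -> A).
Hypothesis cp : crossed_product act i u.
Variables (B : cstarAlgType R) (j : (set_type Y -> R[i]^o) -> B) (v : G -> B).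
Hypothesis cpB : crossed_product (restrict_action invY) j v.
Variable q : A -> B.
Hypothesis q_restriction : induced_by_restriction i u j v q.

Let ract := restrict_action invY.

Let ract_action : is_action ract.
Proof.
by split=> [y|g h y]; apply: val_inj;
  [exact: (proj1 act_action)|exact: (proj2 act_action)].
Qed.

Let ract_continuous g : continuous (ract g).
Proof.
have h : continuous (fun y : set_type Y => act g (set_val y)).
  by move=> y; apply: continuous_comp; [exact: set_val_continuous|exact: act_continuous].
apply/continuousP => _ [W oW <-].
exact: (iffLR (continuousP _) h W oW).
Qed.

Let cY : compact [set: set_type Y].
Proof. by apply: compact_set_type; exact: (subclosed_compact _ cX). Qed.

Let qD a b : q (a + b) = q a + q b.
Proof.
by case: q_restriction => -[lin _ _] _ _; have := lin 1 a b; rewrite !scale1r.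
Qed.

Let q0 : q 0 = 0.
Proof.
by have /eqP := qD 0 0; rewrite addr0 addrC -subr_eq subrr => /eqP.
Qed.

Let q_feval d : fsum_continuous d ->
  q (feval i u d) = \sum_(p <- d) cmul (j (p.1 \o set_val)) (v p.2).
Proof.
case: q_restriction => -[_ qM _] qi qu.
elim: d => [|p d ih] /=; first by rewrite feval_nil big_nil q0.
by move=> [cp1 /ih {}ih]; rewrite feval_cons big_cons qD ih qM (qi _ cp1) qu.
Qed.

Lemma restrict_representation (H : hilbertType R) (rho : B -> H -> H) :
  representation rho -> representation (fun a => rho (q a)).
Proof.
case: q_restriction => -[lin qM qstar] _ _ rep; split.
- by move=> a; exact: (rep_linear rep).
- by move=> a; exact: (rep_continuous rep).
- by move=> k a b x; rewrite lin (rep_DZ rep).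
- by move=> a b x; rewrite qM (repM rep).
- by move=> a x y; rewrite qstar (rep_star rep).
Qed.

Lemma restrict_unital (H : hilbertType R) (rho : B -> H -> H) :
  unital_rep rho -> unital_rep (fun a => rho (q a)).
Proof.
case: q_restriction => _ _ qu un x.
rewrite -(covpair_unitary0 (cp_covariant cp)) qu.
by rewrite (covpair_unitary0 (cp_covariant cpB)) un.
Qed.

(** Representations separate points: the norm of a full crossed product is the
    supremum over covariant representations. *)
Lemma crossed_product_separated (b : B) :
  (forall (H : hilbertType R) (pi : (set_type Y -> R[i]^o) -> H -> H) (U : G -> H -> H)
    (covr : covariant_rep ract pi U) x, integrated cpB covr b x = 0) -> b = 0.
Proof.
move=> b0; apply: (@nrm_le_epsM _ _ _ 2) => e e0.
have [d cd bd] := feval_dense cpB b e0.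
have h : nrm (feval j v d) <= e.
  apply: (feval_nrm_le cpB cd (ltW e0)) => H pi U covr x.
  have := integrated_approx cpB covr b x cd; rewrite b0 sub0r nrmN.
  move/le_trans; apply; rewrite ler_wpM2r ?nrm_ge0//; exact: ltW.
have := nrmD (b - feval j v d) (feval j v d); rewrite subrK.
by move/le_trans; apply; rewrite mulr_natr mulr2n lerD// ltW.
Qed.

Let orbit_repA := orbit_rep act_action act_continuous cX cp.

Variable y : set_type Y.

(** The orbit of a point of Y carries a representation of both algebras. *)
Lemma orbit_rep_restrict a (z : l2 G (cline R)) :
  orbit_rep ract_action ract_continuous cY cpB y (q a) z = orbit_repA (set_val y) a z.
Proof.
set repB := orbit_rep ract_action ract_continuous cY cpB y.
have repBq : representation (fun a => repB (q a)).
  by apply: restrict_representation; exact: orbit_rep_rep.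
have repA : representation (orbit_repA (set_val y)) by exact: orbit_rep_rep.
move: a.
apply: (@feval_dense_eq R G X act A i u cp _ (fun a => repB (q a) z)
  (fun a => orbit_repA (set_val y) a z) (nrm z) (nrm z)).
- move=> a b; have := rep_contractive repBq (a - b) z.
  by rewrite (repD repBq) (repN repBq).
- move=> a b; have := rep_contractive repA (a - b) z.
  by rewrite (repD repA) (repN repA).
move=> d cd; rewrite (q_feval cd).
have repB' : representation repB by exact: orbit_rep_rep.
elim: d cd => [|p d ih] /=; first by rewrite big_nil feval_nil (rep0 repB') (rep0 repA).
move=> [cp1 /ih {}ih]; rewrite big_cons feval_cons (repD repB') (repD repA) ih.
congr (_ + _); rewrite (repM repB') (repM repA); apply: l2_ext => s.
have cp1' : continuous (p.1 \o set_val : set_type Y -> R[i]^o).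
  by move=> t; apply: continuous_comp; [exact: set_val_continuous|exact: cp1].
rewrite (orbit_rep_function _ _ _ _ _ _ _ cp1') (orbit_rep_function _ _ _ _ _ _ _ cp1).
by rewrite /repB /orbit_repA !orbit_rep_unitary.
Qed.

(** Every representation of the crossed product by Y kills, after restriction,
    the functions that vanish on a dense orbit of Y; by [ideal_intersection] it
    kills the kernel of the representation on that orbit. *)
Lemma restriction_kernel (a : A) :
  Y `<=` closure (orbit_of act (set_val y)) ->
  q a = 0 <-> rep_kernel (orbit_repA (set_val y)) a.
Proof.
move=> Ydense; split=> [qa z|Ka].
  rewrite -orbit_rep_restrict qa; apply: rep0.
  exact: orbit_rep_rep.
apply: crossed_product_separated => H pi U covr.
have rep := restrict_representation (integrated_representation ract_continuous cpB covr).
have un := restrict_unital (integrated_unital cpB covr).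
pose Ps := [set rep_kernel (orbit_repA (set_val y))].
apply: (@ideal_intersection R G X act act_action act_continuous cX A i u cp act_free hX
  Ps _ H (fun a => integrated cpB covr (q a)) rep un).
- move=> _ ->; exists (l2 G (cline R)), (orbit_repA (set_val y)); split=> //.
    exact: orbit_rep_rep.
  exact: orbit_rep_unital.
- move=> f [cf /(_ _ erefl)/(orbit_kernel_function _ _ _ _ _ cf) f0] x.
  case: q_restriction => _ /(_ _ cf)-> _.
  have -> : f \o set_val = (fun _ : set_type Y => 0 : R[i]^o).
    apply/funext => t /=; apply: (zero_on_closure cf (S := orbit_of act (set_val y))).
      by move=> _ [s _ <-]; exact: f0.
    exact/Ydense/(set_valP t).
  rewrite (covpair_0 (cp_covariant cpB)).
  exact: (rep0 (integrated_representation ract_continuous cpB covr)).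
- by move=> _ ->.
Qed.

End Restriction.

(** * The primitive ideal space *)

Theorem proposition3p11 (R : realType) (G : zmodType)
    (act : G -> circle R -> circle R)
    (G_countable : countable [set: G]) (G_infinite : infinite_set [set: G])
    (act_denjoy : denjoy_action act) (act_free : free_action act)
    (Y : set (circle R)) (Y_minimal : minimal_set act Y)
    (A : cstarAlgType R) (i : (circle R -> R[i]^o) -> A) (u : G -> A)
    (A_crossed : crossed_product act i u)
    (B : cstarAlgType R) (j : (set_type Y -> R[i]^o) -> B) (v : G -> B)
    (B_crossed : crossed_product
      (restrict_action (minimal_set_invariant Y_minimal)) j v)
    (q : A -> B) (q_restriction : induced_by_restriction i u j v q)
    (reps : set (set (circle R)))
    (reps_transversal : component_transversal act (~` Y) reps) :
  let J : set A := [set a | q a = 0] in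
  let Y0 : set (circle R) := \bigcup_(C in reps) C in
  exists h : adjoin_point (set_type Y0) -> prim A,
    homeomorphism h /\ ideal_of (h None) = J.
Proof.
move=> J Y0; have [actA actH _ _] := act_denjoy.
have actC g : continuous (act g) by case: (actH g).
have cX := @circle_compact R; have hX := @circle_hausdorff R.
have [[y0 Yy0] cY invY _] := Y_minimal.
pose P x := orbit_prim actA actC cX A_crossed x act_free hX.
have PE x f : continuous f -> ideal_of (P x) (i f) <-> forall s, f (act s x) = 0.
  exact: orbit_primP.
have Ycl x : Y `<=` closure (orbit_of act x).
  exact: (minimal_sub_closure act_denjoy act_free Y_minimal).
have Pzero x f y : continuous f -> ideal_of (P x) (i f) ->
    closure (orbit_of act x) y -> f y = 0.
  move=> cf /(PE x f cf) f0; apply: (zero_on_closure cf) => _ [s _ <-].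
  exact: f0.
have Y0_open : open Y0 by exact: (transversal_open Y_minimal reps_transversal).
have Y0_gap x : Y0 x -> ~ Y x by exact: (transversal_gap reps_transversal).
have Y0_free g x : Y0 x -> Y0 (act g x) -> g = 0.
  exact: (transversal_free act_denjoy act_free Y_minimal reps_transversal).
have Y0_meets x : ~ Y x -> exists g, Y0 (act g x).
  exact: (transversal_meets reps_transversal).
have bump0 (N : set (circle R)) x : open N -> N x -> Y0 x ->
    exists h : circle R -> R, [/\ continuous h, h x = 1 & forall y, h y <> 0 -> N y /\ Y0 y].
  move=> oN Nx Y0x; have [] := @bump R _ cX hX (N `&` Y0) x (openI oN Y0_open).
    by [].
  move=> h [ch _ hx h0]; exists h; split=> // y hy.
  by apply: contrapT => Ny; apply: hy; exact: h0.
pose h (o : adjoin_point (set_type Y0)) : prim A :=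
  if o is Some x then P (set_val x) else P y0.
have P_Y x (f : circle R -> R[i]^o) : continuous f -> ideal_of (P x) (i f) ->
    ideal_of (P y0) (i f).
  move=> cf Pf; apply/(PE y0 f cf) => s; apply: (Pzero x f _ cf Pf).
  exact/Ycl/invY.
(* An orbit meets the open set Y0 at most once, so a bump function supported in
   N and Y0 is not seen by the orbits through Y0 minus N, nor by those in Y. *)
have separate (N : set (circle R)) x : open N -> N x -> Y0 x ->
    exists f : circle R -> R[i]^o, [/\ continuous f, ~ ideal_of (P x) (i f),
      ideal_of (P y0) (i f) & forall z, Y0 z -> ~ N z -> ideal_of (P z) (i f)].
  move=> oN Nx Y0x; have [b [cb bx b0]] := bump0 N x oN Nx Y0x.
  have cB := continuous_realC cb; exists (fun y => (b y)%:C); split=> //.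
  - move=> /(PE x _ cB)/(_ 0); rewrite (proj1 actA) bx => /complexI/eqP.
    by rewrite oner_eq0.
  - apply/(PE y0 _ cB) => s; suff -> : b (act s y0) = 0 by [].
    by apply: contrapT => /b0[_ /Y0_gap]; apply; exact: invY.
  - move=> z Y0z Nz; apply/(PE z _ cB) => s; suff -> : b (act s z) = 0 by [].
    apply: contrapT => /b0[Nsz Y0sz]; apply: Nz.
    by rewrite -[z](proj1 actA) -(Y0_free s z Y0z Y0sz).
have h_inj o o' : h o = h o' -> o = o'.
  have notNone x : h (Some x) <> h None.
    move=> hx; have [f [cf nfx fy _]] := separate setT _ openT I (set_valP x).
    have PP : P (set_val x) = P y0 := hx.
    by apply: nfx; rewrite PP.
  case: o o' => [x|] [x'|] hxx'.
  2: by case: (notNone x hxx').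
  2: by case: (notNone x' (esym hxx')).
  2: reflexivity.
  congr Some; apply: val_inj; apply: contrapT => xx'.
  have oN : open (~` [set set_val x']).
    apply: closed_openC; apply: accessible_closed_set1.
    exact: hausdorff_accessible.
  have [f [cf nfx _ fz]] := separate _ _ oN xx' (set_valP x).
  have PP : P (set_val x) = P (set_val x') := hxx'.
  apply: nfx; rewrite PP.
  exact: (fz _ (set_valP x') (fun nxx => nxx erefl)).
have h_surj Q : exists o, h o = Q.
  have Qact g z := @prim_hull_act _ _ _ _ actC _ _ _ A_crossed Q g z.
  have Qhull f cf := @prim_hullP _ _ _ _ cX _ _ _ A_crossed Q f cf.
  have eqP := @prim_eqP _ _ _ _ actA actC cX _ _ _ A_crossed act_free hX.
  (* A hull contained in Y is Y, by minimality. Otherwise it contains a point x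
     of Y0, and primeness leaves no room for another orbit outside Y. *)
  have [[z [Qz Yz]]|QY] := pselect (exists z, prim_hull i Q z /\ ~ Y z).
    have [g Y0x] := Y0_meets z Yz; pose x := act g z.
    have Qx : prim_hull i Q x by exact: Qact.
    exists (Some (SigSub (mem_set Y0x))); apply: eqP => f cf; split=> [Pf|Qf].
      apply: Qhull => // z' Qz'; have [Yz'|Yz'] := pselect (Y z').
        by apply: (Pzero x f z' cf Pf); exact: Ycl.
      have [g' Y0x'] := Y0_meets z' Yz'; pose x' := act g' z'.
      have [xx'|xx'] := eqVneq x x'.
        have -> : z' = act (- g') x by rewrite xx' /x' (actK actA).
        exact: (iffLR (PE x f cf) Pf).
      have := hX; rewrite open_hausdorff => /(_ _ _ xx')[[N N'] [Nx N'x'] [oN oN' NN']].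
      rewrite /= !inE in Nx N'x'.
      have [b [cb bx b0]] := bump0 N x oN Nx Y0x.
      have [b' [cb' b'x' b'0]] := bump0 N' x' oN' N'x' Y0x'.
      have [|b0x|b0x'] := @prim_hull_prime _ _ _ _ actC _ _ _ A_crossed Q b b' x x'
        cb cb' Qx (Qact g' z' Qz').
      - move=> s y; apply: contrapT => /eqP; rewrite mulf_eq0 negb_or => /andP[/eqP by_ /eqP b'sy].
        have [Ny Y0y] := b0 _ by_; have [N'sy Y0sy] := b'0 _ b'sy.
        move: N'sy; rewrite (Y0_free s y Y0y Y0sy) (proj1 actA) => N'y.
        have NNy : (N `&` N') y by [].
        by move/eqP: NN' => /= NN'; rewrite NN' in NNy.
      - by move/eqP: bx; rewrite b0x eq_sym oner_eq0.
      - by move/eqP: b'x'; rewrite b0x' eq_sym oner_eq0.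
    by apply/(PE x f cf) => s; apply: (Qact s x Qx).
  exists None; apply: eqP => f cf; split=> [Pf|Qf].
    apply: Qhull => // z Qz; apply: (Pzero y0 f z cf Pf); apply: Ycl.
    by apply: contrapT => Yz; apply: QY; exists z.
  have [z Qz] : exists z, prim_hull i Q z.
    apply: contrapT => nz; apply: (primitive_ideal_proper (svalP Q)).
    rewrite -(covpair_1 (cp_covariant A_crossed)).
    apply: Qhull; first exact: continuous_constC.
    by move=> z Qz; case: nz; exists z.
  apply: (P_Y z f cf); apply/(PE z f cf) => s.
  exact: (Qact s z Qz f cf Qf).
have hullP := @hull_kernelP _ _ _ _ actA actC cX _ _ _ A_crossed act_free hX.
have image_closed C : closed C -> closed (h @` C).
  move=> /closed_adjoinP[->|[F cF ->]].
    by rewrite image_set0; exact: closed0.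
  apply/closed_prim => Q hQ; have [p oQ] := h_surj Q; exists p; last exact: oQ.
  case: p oQ => [x|] oQ; last by right.
  left; exists x => //; apply: contrapT => nFx.
  (* x has a neighbourhood W that misses F, hence a function on which P_x
     differs from all the ideals of the image. *)
  have [W oW WF] := open_set_typeP (closed_openC cF).
  have Wx : W (set_val x) by have : (~` F) x := nFx; rewrite -WF.
  have [f [cf nfx fy fz]] := separate W _ oW Wx (set_valP x).
  have PQ : P (set_val x) = Q := oQ.
  apply: nfx; rewrite PQ.
  apply: (iffLR (hullP _ Q) hQ f cf) => _ [p Cp <-].
  case: Cp => [[z Fz <-]|->]; last exact: fy.
  apply: (fz _ (set_valP z)) => Wz.
  by have : (~` F) z by rewrite -WF.
have preimage_closed C : closed C -> closed (h @^-1` C).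
  move=> /closed_prim hC; apply/closed_adjoinP.
  have [[Q CQ]|C0] := pselect (C !=set0); last first.
    by left; apply/seteqP; split=> // o Co; apply: C0; exists (h o).
  (* Every orbit closure contains Y, so the hull of a nonempty set contains the
     image of the added point. *)
  right; exists [set x | C (h (Some x))]; last first.
    apply/seteqP; split=> [[x|] Cx|_ [[x Cx <-]|->]] //; [by left; exists x|by right|].
    apply: hC; apply/hullP => f cf Cf; have := Cf Q CQ.
    have [p <-] := h_surj Q; case: p => [x|]; last exact: id.
    exact: (P_Y (set_val x) f cf).
  rewrite closure_id; apply/seteqP; split; first exact: subset_closure.
  move=> x Fx; apply: hC; apply/hullP => f cf Cf; apply/(PE _ f cf) => s.
  have cfs : continuous (fun t : set_type Y0 => f (act s (set_val t))).
    move=> t; apply: continuous_comp; last exact: cf.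
    by apply: continuous_comp; [exact: set_val_continuous|exact: actC].
  apply: (zero_on_closure cfs _ Fx) => t Ft.
  exact: (iffLR (PE _ f cf) (Cf _ Ft) s).
have [k kP] := choice h_surj.
exists h; split.
  apply: (@homeomorphism_closed _ _ h k) => // o; apply: h_inj; exact: kP.
apply/seteqP; split=> a; rewrite /J /= => ha.
  exact/(restriction_kernel actA actC act_free cX hX cY A_crossed B_crossed
    q_restriction (y := SigSub (mem_set Yy0)) a (Ycl y0)).
exact/(restriction_kernel actA actC act_free cX hX cY A_crossed B_crossed
    q_restriction (y := SigSub (mem_set Yy0)) a (Ycl y0)).
Qed.
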